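(* Let $\mu\in\mathbb{C}$ with $\Re(\mu)>1$, and let $k\in\{0,-1\}$. Then $$\zeta(\mu)=\sum_{n=0}^\infty B_{n,\ge 2}^{(\mu)}\frac{\bigl(W_k(-1)\bigr)^n}{n!},$$ where $\zeta$ is the Riemann zeta function.
   Context: $W_k$ ($k\in\mathbb{Z}$) denote the branches of the Lambert $W$ function, i.e. the solutions $W$ of $We^W=a$, with $W_0$ the principal branch and $W_{-1}$ the other standard branch; $W_0(-1)=\overline{W_{-1}(-1)}\approx -0.318132+1.33724i$. For integers $n,k\ge0$, $\left\{ {n \atop k} \right\}_{\ge 2}$ is the number of partitions of an $n$-element set into $k$ nonempty blocks each having at least $2$ elements (with the value $1$ for $n=k=0$). For complex $\mu$, define $$B_{n,\ge 2}^{(\mu)}=\sum_{k=0}^n(-1)^{n-k}\frac{k!}{(k+1)^\mu}\left\{ {n \atop k} \right\}_{\ge 2}\qquad(n\ge0),$$ with $(k+1)^\mu=e^{\mu\log(k+1)}$. *)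

(* Defs.v *)
From HB Require Import structures.
From mathcomp Require Import all_boot all_order all_algebra complex.
From mathcomp Require Import all_classical all_reals all_analysis.

Set Implicit Arguments.
Unset Strict Implicit.
Unset Printing Implicit Defensive.

Import Order.TTheory GRing.Theory Num.Theory.
Import numFieldNormedType.Exports.

Local Open Scope classical_set_scope.
Local Open Scope ring_scope.
Local Open Scope complex_scope.

(* [finset.partition] already requires the blocks to be nonempty; for
   n = k = 0 the empty partition of 'I_0 is counted. *)
Definition stirling2_ge2 (n k : nat) : nat :=
  #|[set P : {set {set 'I_n}} | [&& finset.partition P [set: 'I_n]%SET,
      #|P| == k & [forall (B | B \in P), 2 <= #|B|]%N]]%SET|.

Definition cexp (R : realType) (z : R[i]) : R[i] :=
  (expR (complex.Re z) * cos (complex.Im z)) +i*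
  (expR (complex.Re z) * sin (complex.Im z)).

(* x ^ mu = e ^ (mu log x), meaningful for x > 0. *)
Definition cpow (R : realType) (x : R) (mu : R[i]) : R[i] :=
  cexp (mu * (ln x)%:C).

Definition poly_bernoulli_ge2 (R : realType) (mu : R[i]) (n : nat) : R[i] :=
  \sum_(k < n.+1) (-1) ^+ (n - k) * (k`!%:R / cpow k.+1%:R mu) *
    (stirling2_ge2 n k)%:R.

(* The Dirichlet series of zeta: only meaningful for Re mu > 1. The topology of
   the complex plane is the one that the numFieldType R[i] induces on R[i]^o. *)
Definition zeta (R : realType) (mu : R[i]) : R[i]^o :=
  limn (series (fun n : nat => (cpow n.+1%:R mu)^-1 : R[i]^o)).

(* Branches of the Lambert function, following the conventions of Corless,
   Gonnet, Hare, Jeffrey and Knuth, "On the Lambert W function" (1996),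
   Section 4. The ranges of the branches are separated by the curves
   -b cot b + i b, for 2 m pi < |b| < (2 m + 1) pi, which separate the range
   of W_m from that of W_(m+1) (b > 0) and the range of W_(-m) from that of
   W_(-m-1) (b < 0), and by the ray ]-oo, -1], which separates those of W_1
   and W_(-1). Every branch cut lies on the negative real axis and is closed
   from above (counter-clockwise continuity), so that a point of a separating
   curve belongs to the region lying below that curve. *)
Definition lambert_curve (R : realType) (b : R) : R := - (b * cos b / sin b).

(* w lies in the range of some W_j with j > m. *)
Definition lambert_above (R : realType) (m : nat) (w : R[i]) : Prop :=
  let a := complex.Re w in let b := complex.Im w in
  (m.*2.+1%:R * pi <= b) \/
  (m.*2%:R * pi < b < m.*2.+1%:R * pi /\ a < lambert_curve b).

(* w lies in the range of some W_(-j) with j > m. *)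
Definition lambert_below (R : realType) (m : nat) (w : R[i]) : Prop :=
  let a := complex.Re w in let b := complex.Im w in
  [\/ b <= - (m.*2.+1%:R * pi),
      - (m.*2.+1%:R * pi) < b < - (m.*2%:R * pi) /\ a <= lambert_curve b |
      [/\ m = 0%N, b = 0 & a <= -1]].

(* The branch point -1 = W_0(-1/e) = W_(-1)(-1/e) is the only point that
   belongs to two ranges. *)
Definition lambert_range (R : realType) (k : int) (w : R[i]) : Prop :=
  match k with
  | Posz 0 => ~ lambert_above 0 w /\ (~ lambert_below 0 w \/ w = -1)
  | Posz m.+1 => lambert_above m w /\ ~ lambert_above m.+1 w
  | Negz m => lambert_below m w /\ ~ lambert_below m.+1 w
  end.

(* W_k(z); the value is 0 by default where W_k is undefined, i.e. for z = 0 and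
   k != 0. *)
Definition lambertW (R : realType) (k : int) (z : R[i]) : R[i] :=
  xget 0 [set w | w * cexp w = z /\ lambert_range k w].

(* Main.v *)
Require Import Defs.
From HB Require Import structures.
From mathcomp Require Import all_boot all_order all_algebra complex.
From mathcomp Require Import all_classical all_reals all_analysis.
From mathcomp Require Import cyclic separable cyclotomic measurable_realfun.
From mathcomp Require Import ring lra zify.

(* Put u(x) = 1 - x - e^-x, so that the sum of B_n x^n / n! is formally the sum of
   u(x)^k / (k+1)^mu, and u(W) = 1 exactly when W e^W = -1. The double series does not
   converge absolutely at x = W, so the order of summation is exchanged through the
   Gamma integral: with s = e^-t, Gamma(mu) (k+1)^-mu is the integral of
   t^(mu-1) e^-t s^k, hence Gamma(mu) B_n / n! is the integral of t^(mu-1) e^-t p_n(s),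
   where p_n(s) is the n-th Taylor coefficient of the resolvent 1 / (1 - s u(x)).

   Everything follows by dominated convergence from the estimate
     sum_n |p_n(s)| |W|^n <= C / (1 - s)   (0 < s < 1),
   since then the sum of p_n(s) W^n is 1 / (1 - s u(W)) = 1 / (1 - s), which is also the
   limit of the geometric sums that produce zeta(mu).

   For s < 1 the function 1 - s u has no zero in the disc |x| <= |W|: its zeros satisfy
   t + x + e^-x = 0 with t > 0, and Im x, |x| increase with t. A Wiener-type lemma then
   puts its inverse in the algebra of absolutely convergent Taylor series, locally
   uniformly in s. Near s = 1 the two simple zeros W and its conjugate of 1 - u are split
   off as a quadratic factor, whose perturbed roots leave the disc at a speed
   proportional to 1 - s. *)

Set Implicit Arguments.
Unset Strict Implicit.
Unset Printing Implicit Defensive.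

Import Order.TTheory GRing.Theory Num.Theory.
Import numFieldNormedType.Exports.
Import Normc.

Local Open Scope classical_set_scope.
Local Open Scope ring_scope.
Local Open Scope complex_scope.

Section ComplexModulus.
Variable R : rcfType.
Implicit Types x y z : R[i].

Lemma normcE_complex z : `|z| = (normc z)%:C.
Proof. by []. Qed.

Lemma normc_ge0 z : 0 <= normc z.
Proof. exact: (normr_ge0 (z : Rcomplex R)). Qed.

Lemma normcB x y : normc (x - y) <= normc x + normc y.
Proof. exact: (ler_normB (x : Rcomplex R)). Qed.

Lemma lerB_distc x y : normc x - normc y <= normc (x - y).
Proof. exact: (lerB_dist (x : Rcomplex R)). Qed.

Lemma normc_sum (I : Type) (r : seq I) (P : pred I) (F : I -> R[i]) :
  normc (\sum_(i <- r | P i) F i) <= \sum_(i <- r | P i) normc (F i).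
Proof. exact: (ler_norm_sum r (F : I -> Rcomplex R)). Qed.

Lemma normcX x n : normc (x ^+ n) = normc x ^+ n.
Proof. by elim: n => [|n IH]; rewrite ?expr0 ?normc1// !exprS normcM IH. Qed.

Lemma normc_real (r : R) : normc r%:C = `|r|.
Proof. by rewrite /= expr0n /= addr0 sqrtr_sqr. Qed.

Lemma distc_real (r s : R) : normc (r%:C - s%:C) = `|r - s|.
Proof. by rewrite -rmorphB; exact: normc_real. Qed.

Lemma normc_nat n : normc (n%:R : R[i]) = n%:R.
Proof. by rewrite -(rmorph_nat (real_complex R)) normc_real ger0_norm. Qed.

Lemma normc_conj x : normc x^*%C = normc x.
Proof. by case: x => a b /=; rewrite sqrrN. Qed.

Lemma conjcM x y : (x * y)^*%C = x^*%C * y^*%C.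
Proof. exact: rmorphM. Qed.

Lemma conjcB x y : (x - y)^*%C = x^*%C - y^*%C.
Proof. exact: rmorphB. Qed.

Lemma normc_eq0 x : (normc x == 0) = (x == 0).
Proof. exact: (normr_eq0 (x : Rcomplex R)). Qed.

Lemma normc_gt0 x : (0 < normc x) = (x != 0).
Proof. exact: (normr_gt0 (x : Rcomplex R)). Qed.

Lemma sqr_normc_ReIm x : normc x ^+ 2 = complex.Re x ^+ 2 + complex.Im x ^+ 2.
Proof. by case: x => a b /=; rewrite sqr_sqrtr// addr_ge0 ?sqr_ge0. Qed.

Lemma ler_Re_normc x : `|complex.Re x| <= normc x.
Proof. by case: x => a b /=; rewrite -sqrtr_sqr ler_wsqrtr// lerDl sqr_ge0. Qed.

Lemma ler_Im_normc x : `|complex.Im x| <= normc x.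
Proof. by case: x => a b /=; rewrite -sqrtr_sqr ler_wsqrtr// lerDr sqr_ge0. Qed.

Lemma ler_normc_ReIm x : normc x <= `|complex.Re x| + `|complex.Im x|.
Proof.
rewrite -(@ler_pXn2r _ 2)// ?nnegrE ?normc_ge0 ?addr_ge0//.
rewrite sqr_normc_ReIm sqrrD !real_normK ?num_real// addrAC lerDl.
by rewrite mulrn_wge0// mulr_ge0.
Qed.

Lemma Re_addc x y : complex.Re (x + y) = complex.Re x + complex.Re y.
Proof. by case: x y => [? ?] [? ?]. Qed.

Lemma Im_addc x y : complex.Im (x + y) = complex.Im x + complex.Im y.
Proof. by case: x y => [? ?] [? ?]. Qed.

Lemma Re_subc x y : complex.Re (x - y) = complex.Re x - complex.Re y.
Proof. by case: x y => [? ?] [? ?]. Qed.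

Lemma Im_subc x y : complex.Im (x - y) = complex.Im x - complex.Im y.
Proof. by case: x y => [? ?] [? ?]. Qed.

Lemma Re_mulc x y : complex.Re (x * y) =
  complex.Re x * complex.Re y - complex.Im x * complex.Im y.
Proof. by case: x y => [? ?] [? ?]. Qed.

Lemma Re_mulc_real x (r : R) : complex.Re (x * r%:C) = complex.Re x * r.
Proof. by rewrite Re_mulc /= mulr0 subr0. Qed.

Lemma Im_mulc x y : complex.Im (x * y) =
  complex.Re x * complex.Im y + complex.Im x * complex.Re y.
Proof. by case: x y => [? ?] [? ?]. Qed.

Lemma Re_sum (I : Type) (r : seq I) (P : pred I) (F : I -> R[i]) :
  complex.Re (\sum_(i <- r | P i) F i) = \sum_(i <- r | P i) complex.Re (F i).
Proof. exact: (raddf_sum (@complex.Re R : {additive Rcomplex R -> R})). Qed.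

Lemma Im_sum (I : Type) (r : seq I) (P : pred I) (F : I -> R[i]) :
  complex.Im (\sum_(i <- r | P i) F i) = \sum_(i <- r | P i) complex.Im (F i).
Proof. exact: (raddf_sum (@complex.Im R : {additive Rcomplex R -> R})). Qed.

Lemma subrX_le x y n : normc x <= 1 -> normc y <= 1 ->
  normc (x ^+ n - y ^+ n) <= n%:R * normc (x - y).
Proof.
move=> x_le1 y_le1; rewrite subrXX normcM mulrC ler_wpM2r ?normc_ge0//.
apply: le_trans (normc_sum _ _ _) _.
apply: (@le_trans _ _ (\sum_(i < n) 1)); last by rewrite sumr_const card_ord.
by apply: ler_sum => i _; rewrite normcM !normcX mulr_ile1 ?exprn_ge0 ?exprn_ile1 ?normc_ge0.
Qed.

End ComplexModulus.

Section ComplexConvergence.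
Variable R : realType.
Implicit Types (u : nat -> R[i]^o) (l : R[i]^o).

Lemma cvgC_normcP u l : (u @ \oo --> l) <->
  (forall e : R, 0 < e -> \forall n \near \oo, normc (l - u n) < e).
Proof.
split=> [/cvgrPdist_lt u_l e e0|u_l].
  have eC0 : 0 < e%:C :> R[i] by rewrite ltcR.
  by apply: filterS (u_l _ eC0) => n; rewrite normcE_complex ltcR.
apply/cvgrPdist_lt => -[e e'] /[dup]; rewrite {1}ltcE /= => /andP[/eqP -> e0] _.
by apply: filterS (u_l _ e0) => n; rewrite normcE_complex ltcR.
Qed.

Lemma cvgC_ReIm u l : u @ \oo --> l <->
  (fun n => complex.Re (u n)) @ \oo --> complex.Re l /\
  (fun n => complex.Im (u n)) @ \oo --> complex.Im l.
Proof.
split=> [/cvgC_normcP u_l|[/cvgrPdist_lt Re_l /cvgrPdist_lt Im_l]].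
  split; apply/cvgrPdist_lt => e /u_l; apply: filterS => n; apply: le_lt_trans.
    by rewrite -Re_subc ler_Re_normc.
  by rewrite -Im_subc ler_Im_normc.
apply/cvgC_normcP => e e0; have e2 : 0 < e / 2 by rewrite divr_gt0.
near=> n; apply: le_lt_trans (ler_normc_ReIm _) _; rewrite Re_subc Im_subc [ltRHS]splitr.
by apply: ltrD; near: n; [exact: Re_l | exact: Im_l].
Unshelve. all: by end_near. Qed.

Lemma cvgC_normc_le u l (M : R) :
  u @ \oo --> l -> (forall n, normc (u n) <= M) -> normc l <= M.
Proof.
move=> /cvgC_normcP u_l u_le; apply/ler_addgt0Pr => e /u_l[N _ /(_ N (leqnn N))].
move=> /ltW dist_le; rewrite -[leLHS](subrK (normc (u N))) addrC lerD//.
exact: le_trans (lerB_distc _ _) dist_le.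
Qed.

End ComplexConvergence.

Definition fps (K : Type) := nat -> K.

Section FormalPowerSeries.
Variable K : comNzRingType.
Implicit Types a b c e : fps K.

HB.instance Definition _ := GRing.Zmodule.copy (fps K) (nat -> K).

Definition fps_one : fps K := fun n => (n == 0%N)%:R.
Definition fps_mul a b : fps K := fun n => \sum_(i < n.+1) a i * b (n - i)%N.

Let fps_mul_poly a b n m : (n < m)%N ->
  fps_mul a b n = (\poly_(i < m) a i * \poly_(i < m) b i)`_n.
Proof.
move=> nm; rewrite coefM; apply: eq_bigr => -[i /= iN] _.
by rewrite !coef_poly !ifT//; lia.
Qed.

Let fps_mulC : commutative fps_mul.
Proof.
by move=> a b; apply/funext => n; rewrite !(@fps_mul_poly _ _ _ n.+1)// mulrC.
Qed.

Let fps_mulA : associative fps_mul.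
Proof.
move=> a b c; apply/funext => n; pose trunc a := \poly_(i < n.+1) a i.
transitivity ((trunc a * (trunc b * trunc c))`_n).
  rewrite coefM; apply: eq_bigr => -[i /= iN] _.
  by rewrite -fps_mul_poly ?coef_poly ?ifT//; lia.
rewrite mulrA coefM; apply: eq_bigr => -[i /= iN] _.
by rewrite -fps_mul_poly ?coef_poly ?ifT//; lia.
Qed.

Let fps_mul1 : left_id fps_one fps_mul.
Proof.
move=> a; apply/funext => n; rewrite /fps_mul big_ord_recl /= subn0 mul1r.
by rewrite big1 ?addr0// => i _; rewrite /fps_one /= mul0r.
Qed.

Let fps_mulDl : left_distributive fps_mul +%R.
Proof.
move=> a b c; apply/funext => n.
rewrite -[RHS]/(fps_mul a c n + fps_mul b c n) /fps_mul -big_split /=.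
by apply: eq_bigr => i _; rewrite mulrDl.
Qed.

Let fps_oner_neq0 : fps_one != 0 :> fps K.
Proof. by apply/eqP => /(congr1 (@^~ 0%N)); apply/eqP; exact: oner_neq0. Qed.

HB.instance Definition _ := GRing.Zmodule_isComNzRing.Build (fps K)
  fps_mulA fps_mulC fps_mul1 fps_mulDl fps_oner_neq0.

Lemma coef_fps1 n : (1 : fps K) n = (n == 0%N)%:R. Proof. by []. Qed.
Lemma coef_fpsD a b n : (a + b) n = a n + b n. Proof. by []. Qed.
Lemma coef_fpsN a n : (- a) n = - a n. Proof. by []. Qed.
Lemma coef_fpsM a b n : (a * b) n = \sum_(i < n.+1) a i * b (n - i)%N.
Proof. by []. Qed.

Lemma coef_fps_sum (I : Type) (r : seq I) (P : pred I) (F : I -> fps K) n :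
  (\sum_(i <- r | P i) F i) n = \sum_(i <- r | P i) F i n.
Proof. by elim/big_rec2: _ => // i y1 y2 _ <-. Qed.

Definition fpsC (k : K) : fps K := fun n => k *+ (n == 0%N).
Definition fpsX : fps K := fun n => (n == 1%N)%:R.

Lemma coef_fpsCM k a n : (fpsC k * a) n = k * a n.
Proof.
rewrite coef_fpsM big_ord_recl /= /fpsC subn0 big1 ?addr0// => i _.
by rewrite mul0r.
Qed.

Fact fpsC_is_zmod_morphism : zmod_morphism fpsC.
Proof. by move=> k l; apply/funext => n; rewrite /fpsC mulrnBl. Qed.

Fact fpsC_is_monoid_morphism : monoid_morphism fpsC.
Proof.
split=> [|k l]; apply/funext => n; first by [].
by rewrite coef_fpsCM /fpsC mulrnAr.
Qed.

HB.instance Definition _ := GRing.isZmodMorphism.Build K (fps K) fpsC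
  fpsC_is_zmod_morphism.
HB.instance Definition _ := GRing.isMonoidMorphism.Build K (fps K) fpsC
  fpsC_is_monoid_morphism.

Lemma coef_fpsXM a n : (fpsX * a) n = if n is m.+1 then a m else 0.
Proof.
case: n => [|n]; first by rewrite coef_fpsM big_ord1 mul0r.
rewrite coef_fpsM 2!big_ord_recl /= mul0r add0r mul1r subn1 big1 ?addr0// => i _.
by rewrite mul0r.
Qed.

Definition fps_shift a : fps K := fun n => a n.+1.

Lemma fps_shiftE a : a = fpsC (a 0%N) + fpsX * fps_shift a.
Proof.
by apply/funext => -[|n]; rewrite coef_fpsD coef_fpsXM /fpsC ?addr0 ?add0r.
Qed.

Lemma iter_fps_shiftE k a n : iter k fps_shift a n = a (k + n)%N.
Proof. by elim: k n => // k IH n; rewrite iterS /fps_shift IH addnS. Qed.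

Definition fps_dil (t : K) a : fps K := fun n => a n * t ^+ n.

Fact fps_dil_is_zmod_morphism t : zmod_morphism (fps_dil t).
Proof.
by move=> a b; apply/funext => n; rewrite /fps_dil !(coef_fpsD, coef_fpsN) mulrBl.
Qed.

Fact fps_dil_is_monoid_morphism t : monoid_morphism (fps_dil t).
Proof.
split=> [|a b]; apply/funext => n.
  by rewrite /fps_dil coef_fps1; case: n => [|n]; rewrite ?mulr1 ?mul0r.
rewrite /fps_dil !coef_fpsM mulr_suml; apply: eq_bigr => -[i /= iN] _.
by rewrite mulrACA -exprD subnKC.
Qed.

HB.instance Definition _ t := GRing.isZmodMorphism.Build (fps K) (fps K)
  (fps_dil t) (fps_dil_is_zmod_morphism t).
HB.instance Definition _ t := GRing.isMonoidMorphism.Build (fps K) (fps K)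
  (fps_dil t) (fps_dil_is_monoid_morphism t).

Lemma fps_dil1 a : fps_dil 1 a = a.
Proof. by apply/funext => n; rewrite /fps_dil expr1n mulr1. Qed.

Lemma fps_dil0 a : fps_dil 0 a = fpsC (a 0%N).
Proof. by apply/funext => -[|n]; rewrite /fps_dil ?mulr1// exprS mul0r mulr0. Qed.

Lemma fps_dil_dil s t a : fps_dil s (fps_dil t a) = fps_dil (s * t) a.
Proof. by apply/funext => n; rewrite /fps_dil exprMn -mulrA [t ^+ n * _]mulrC. Qed.

Lemma fps_dilC t k : fps_dil t (fpsC k) = fpsC k.
Proof. by apply/funext => -[|n]; rewrite /fps_dil ?mulr1 ?mul0r. Qed.

Lemma fps_dilX t : fps_dil t fpsX = fpsC t * fpsX.
Proof.
apply/funext => n; rewrite coef_fpsCM /fps_dil /fpsX mulrC.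
by case: eqP => [->//|_]; rewrite !mulr0.
Qed.

Definition fps_euler a : fps K := fun n => a n *+ n.

Fact fps_euler_is_zmod_morphism : zmod_morphism fps_euler.
Proof. by move=> a b; apply/funext => n; rewrite /fps_euler mulrnBl. Qed.

HB.instance Definition _ := GRing.isZmodMorphism.Build (fps K) (fps K) fps_euler
  fps_euler_is_zmod_morphism.

Lemma fps_eulerM a b : fps_euler (a * b) = fps_euler a * b + a * fps_euler b.
Proof.
apply/funext => n; rewrite coef_fpsD /fps_euler !coef_fpsM -sumrMnl -big_split /=.
apply: eq_bigr => -[i /= iN] _; by rewrite mulrnAl mulrnAr -mulrnDr subnKC.
Qed.

Lemma fps_eulerC k : fps_euler (fpsC k) = 0.
Proof. by apply/funext => -[|n]; rewrite /fps_euler /fpsC ?mulr0n ?mul0rn. Qed.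

Lemma fps_eulerX : fps_euler fpsX = fpsX.
Proof. by apply/funext => n; rewrite /fps_euler /fpsX; case: eqP => [->|_]; rewrite ?mul0rn. Qed.

Lemma fps_euler_dil t a : fps_euler (fps_dil t a) = fps_dil t (fps_euler a).
Proof. by apply/funext => n; rewrite /fps_euler /fps_dil mulrnAl. Qed.

Lemma fps_eulerV a b : a * b = 1 -> fps_euler b = - (fps_euler a * b ^+ 2).
Proof.
move=> ab; have := fps_eulerM a b; rewrite ab -(rmorph1 fpsC) fps_eulerC => /esym.
move=> /(congr1 (fun c => b * c)); rewrite mulr0 mulrDr !mulrA [b * a]mulrC ab mul1r.
by rewrite addrC => /eqP; rewrite addr_eq0 => /eqP ->; rewrite [b * _]mulrC.
Qed.

Lemma fps_euler2V a b : a * b = 1 -> fps_euler (fps_euler b) =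
  2 * fps_euler a ^+ 2 * b ^+ 3 - fps_euler (fps_euler a) * b ^+ 2.
Proof.
move=> ab; have eulerb := fps_eulerV ab.
by rewrite {1}eulerb raddfN /= fps_eulerM expr2 fps_eulerM eulerb; ring.
Qed.

Lemma coef_fps_expr_order e n k : e 0%N = 0 -> (n < k)%N -> (e ^+ k) n = 0.
Proof.
move=> e0; elim: k n => // k IH n nk; rewrite exprS coef_fpsM big1// => -[[|i] iN] _ /=.
  by rewrite e0 mul0r.
by rewrite IH ?mulr0//; lia.
Qed.

Lemma fps_powers_widen (x : nat -> K) e n m : e 0%N = 0 -> (n < m)%N ->
  \sum_(k < n.+1) (e ^+ k) n * x k = \sum_(k < m) (e ^+ k) n * x k.
Proof.
move=> e0 nm; rewrite -!(big_mkord xpredT (fun k => (e ^+ k) n * x k)).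
rewrite [RHS](big_cat_nat _ nm)//= [X in _ + X]big_nat_cond [X in _ + X]big1 ?addr0//.
by move=> k /andP[/andP[nk _] _]; rewrite coef_fps_expr_order ?mul0r.
Qed.

(* the series 1 / (1 - e), for e of positive order *)
Definition fps_geom e : fps K := fun n => \sum_(k < n.+1) (e ^+ k) n.

Lemma fps_geom_widen e n m : e 0%N = 0 -> (n < m)%N ->
  fps_geom e n = (\sum_(k < m) e ^+ k) n.
Proof.
move=> e0 nm; have := fps_powers_widen (fun=> 1) e0 nm.
by rewrite coef_fps_sum; under eq_bigr do rewrite mulr1; under [RHS]eq_bigr do rewrite mulr1.
Qed.

Lemma fps_geomP e : e 0%N = 0 -> (1 - e) * fps_geom e = 1.
Proof.
move=> e0; apply/funext => n.
transitivity (((1 - e) * \sum_(k < n.+1) e ^+ k) n).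
  rewrite !coef_fpsM; apply: eq_bigr => i _; congr (_ * _).
  by apply: fps_geom_widen => //; lia.
rewrite -opprB mulNr -subrX1 opprB coef_fpsD coef_fpsN.
by rewrite (coef_fps_expr_order e0 (ltnSn n)) subr0.
Qed.

End FormalPowerSeries.

Arguments fpsX {K}.

Lemma mulr1_uniq (A : comNzRingType) (a b c : A) : a * b = 1 -> a * c = 1 -> b = c.
Proof. by move=> ab ac; rewrite -[b]mulr1 -ac mulrA [b * a]mulrC ab mul1r. Qed.

Lemma fps_inv_ex (K : comUnitRingType) (a : fps K) : a 0%N \is a GRing.unit ->
  exists b, a * b = 1.
Proof.
move=> a0; pose e := 1 - fpsC (a 0%N)^-1 * a.
have e0 : e 0%N = 0 by rewrite /e coef_fpsD coef_fpsN coef_fpsCM mulVr ?subrr.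
exists (fpsC (a 0%N)^-1 * fps_geom e).
by rewrite -[RHS](fps_geomP e0) {2}/e subKr mulrCA mulrA.
Qed.

Section L1Bounds.
Variable R : rcfType.
Implicit Types (a b e : fps R[i]) (M N : R).

Definition l1_le a M := forall n, \sum_(i < n) normc (a i) <= M.

Lemma l1_le_ge0 a M : l1_le a M -> 0 <= M.
Proof. by move/(_ 0%N); rewrite big_ord0. Qed.

Lemma l1_le_trans a M N : l1_le a M -> M <= N -> l1_le a N.
Proof. by move=> aM MN n; exact: le_trans (aM n) MN. Qed.

Lemma l1_le_dominated a b M : (forall n, normc (a n) <= normc (b n)) ->
  l1_le b M -> l1_le a M.
Proof. by move=> ab bM n; apply: le_trans (bM n); apply: ler_sum => i _; exact: ab. Qed.

Lemma l1_le_coef a M n : l1_le a M -> normc (a n) <= M.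
Proof.
move=> /(_ n.+1); rewrite big_ord_recr /=; apply: le_trans.
by rewrite lerDr sumr_ge0// => i _; exact: normc_ge0.
Qed.

Lemma l1_leD a b M N : l1_le a M -> l1_le b N -> l1_le (a + b) (M + N).
Proof.
move=> aM bN n; apply: le_trans (lerD (aM n) (bN n)).
by rewrite -big_split /=; apply: ler_sum => i _; exact: le_normcD.
Qed.

Lemma l1_leN a M : l1_le a M -> l1_le (- a) M.
Proof. by apply: l1_le_dominated => n; rewrite coef_fpsN normcN. Qed.

Lemma l1_leB a b M N : l1_le a M -> l1_le b N -> l1_le (a - b) (M + N).
Proof. by move=> aM /l1_leN; exact: l1_leD. Qed.

Lemma l1_leCM (k : R[i]) a M : l1_le a M -> l1_le (fpsC k * a) (normc k * M).
Proof.
move=> aM n; under eq_bigr do rewrite coef_fpsCM normcM.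
by rewrite -mulr_sumr ler_wpM2l ?normc_ge0.
Qed.

Lemma l1_le1 : l1_le 1 1.
Proof.
case=> [|n]; first by rewrite big_ord0.
by rewrite big_ord_recl normc1 big1 ?addr0// => i _; rewrite normc0.
Qed.

Lemma l1_leC (k : R[i]) : l1_le (fpsC k) (normc k).
Proof. by rewrite -[fpsC k]mulr1 -[normc k]mulr1; exact: l1_leCM l1_le1. Qed.

Lemma l1_leXM a M : l1_le a M -> l1_le (fpsX * a) M.
Proof.
move=> aM [|n]; first by rewrite big_ord0; exact: l1_le_ge0 aM.
rewrite big_ord_recl coef_fpsXM normc0 add0r.
by under eq_bigr do rewrite coef_fpsXM /=.
Qed.

Lemma sum_normc_fpsM_le a b M n : l1_le a M ->
  \sum_(i < n) normc ((a * b) i) <= M * \sum_(i < n) normc (b i).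
Proof.
move=> aM; elim: n b => [|n IH] b; first by rewrite !big_ord0 mulr0.
have -> : a * b = fpsC (b 0%N) * a + fpsX * (a * fps_shift b).
  by rewrite {1}[b]fps_shiftE; ring.
apply: (@le_trans _ _ (\sum_(i < n.+1) (normc ((fpsC (b 0%N) * a) i) +
    normc ((fpsX * (a * fps_shift b)) i)))).
  by apply: ler_sum => i _; exact: le_normcD.
rewrite big_split /= [X in _ + X]big_ord_recl coef_fpsXM normc0 add0r.
rewrite [in leRHS]big_ord_recl mulrDr lerD//.
  by rewrite [leRHS]mulrC; exact: l1_leCM.
by under eq_bigr do rewrite coef_fpsXM /=; exact: IH.
Qed.

Lemma l1_leM a b M N : l1_le a M -> l1_le b N -> l1_le (a * b) (M * N).
Proof.
move=> aM bN n; apply: le_trans (sum_normc_fpsM_le b n aM) _.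
by rewrite ler_wpM2l// (l1_le_ge0 aM).
Qed.

Lemma l1_le_dil (t : R[i]) a M : normc t <= 1 -> l1_le a M -> l1_le (fps_dil t a) M.
Proof.
move=> t1; apply: l1_le_dominated => n.
by rewrite normcM normcX ler_piMr ?normc_ge0// exprn_ile1 ?normc_ge0.
Qed.

Lemma l1_le_dil_normc (s t : R[i]) a M : normc s = normc t ->
  l1_le (fps_dil s a) M -> l1_le (fps_dil t a) M.
Proof. by move=> st; apply: l1_le_dominated => n; rewrite !normcM !normcX st. Qed.

Lemma l1_le_dilB (s t : R[i]) a M : normc s <= 1 -> normc t <= 1 ->
  l1_le (fps_euler a) M -> l1_le (fps_dil s a - fps_dil t a) (M * normc (s - t)).
Proof.
move=> s1 t1 /(l1_leCM (s - t)); rewrite [M * _]mulrC; apply: l1_le_dominated => n.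
rewrite coef_fpsCM coef_fpsD coef_fpsN /fps_dil /fps_euler -mulrBr !normcM normcMn.
apply: le_trans (ler_wpM2l (normc_ge0 _) (subrX_le n s1 t1)) _.
by rewrite mulrnAr mulr_natl mulrnAr mulrC.
Qed.

Lemma l1_le_iter_shift n a M : l1_le a M -> l1_le (iter n (@fps_shift _) a) M.
Proof.
move=> aM m; under eq_bigr do rewrite iter_fps_shiftE.
apply: le_trans (aM (n + m)%N); rewrite big_split_ord /= lerDr.
by rewrite sumr_ge0// => i _; exact: normc_ge0.
Qed.

Lemma l1_le_geometric a M (q : R) : 0 <= q < 1 ->
  (forall n, normc (a n) <= M * q ^+ n) -> l1_le a (M / (1 - q)).
Proof.
move=> /andP[q0 q1] a_le n.
have M0 : 0 <= M by have := a_le 0%N; rewrite mulr1; apply: le_trans; exact: normc_ge0.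
apply: (@le_trans _ _ (\sum_(i < n) M * q ^+ i)); first by apply: ler_sum.
rewrite -mulr_sumr ler_wpM2l// -[leRHS]mul1r ler_pdivlMr ?subr_gt0//.
by rewrite mulrC -opprB mulNr -subrX1 opprB lerBlDr lerDl exprn_ge0.
Qed.

(* The partial sums B of the norms of b satisfy B <= 1 + theta B since
   b = 1 + e b; this replaces the convergence of the Neumann series. *)
Lemma l1_le_neumann e (theta : R) : l1_le e theta -> theta < 1 ->
  exists2 b : fps R[i], (1 - e) * b = 1 & l1_le b (1 - theta)^-1.
Proof.
move=> e_theta theta1; have theta1' : 0 < 1 - theta by rewrite subr_gt0.
have [|b eb] := @fps_inv_ex _ (1 - e).
  rewrite unitfE coef_fpsD coef_fpsN subr_eq0; apply/eqP => e0.
  by have := le_lt_trans (l1_le_coef 0 e_theta) theta1; rewrite -e0 normc1 ltxx.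
exists b => // n; set B := \sum_(i < n) _.
suff B_le : B <= 1 + theta * B by rewrite -[leRHS]mul1r ler_pdivlMr//; lra.
apply: le_trans (lerD (l1_le1 n) (sum_normc_fpsM_le b n e_theta)).
rewrite -big_split /B /=; apply: ler_sum => i _.
have {1}-> : b = 1 + e * b by rewrite -eb; ring.
exact: le_normcD.
Qed.

Lemma l1_le_inv_perturb a b e M (d : R) : a * b = 1 -> l1_le b M -> l1_le e d ->
  d * M <= 2^-1 -> exists2 c : fps R[i], (a + e) * c = 1 & l1_le c (2 * M).
Proof.
move=> ab bM ed dM.
have [||c ebc c2] := @l1_le_neumann (- (e * b)) 2^-1; last 1 first.
- exists (b * c); first by rewrite -[RHS]ebc -ab; ring.
  by have := l1_leM bM c2; congr l1_le; field.
- exact/l1_leN/(l1_le_trans (l1_leM ed bM)).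
- by rewrite invf_lt1// ltr1n.
Qed.

End L1Bounds.

Section AbsolutelySummableSeries.
Variable R : realType.
Implicit Types (a b : fps R[i]) (x y : R[i]).

Definition abs_summable : {pred fps R[i]} := fun a => `[< exists M, l1_le a M >].

Lemma abs_summableP a : reflect (exists M, l1_le a M) (a \in abs_summable).
Proof. exact: asboolP. Qed.

Lemma l1_le_abs_summable a M : l1_le a M -> a \in abs_summable.
Proof. by move=> aM; apply/abs_summableP; exists M. Qed.

Fact abs_summable_subring_closed : subring_closed abs_summable.
Proof.
split=> [|a b /abs_summableP[M aM] /abs_summableP[N bN]|
          a b /abs_summableP[M aM] /abs_summableP[N bN]].
- exact: l1_le_abs_summable (@l1_le1 R).
- exact: l1_le_abs_summable (l1_leB aM bN).
- exact: l1_le_abs_summable (l1_leM aM bN).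
Qed.

HB.instance Definition _ := GRing.isSubringClosed.Build (fps R[i]) abs_summable
  abs_summable_subring_closed.

Lemma abs_summableC (k : R[i]) : fpsC k \in abs_summable.
Proof. exact: l1_le_abs_summable (@l1_leC R k). Qed.

Lemma abs_summableXM a : a \in abs_summable -> fpsX * a \in abs_summable.
Proof. by case/abs_summableP => M /l1_leXM/l1_le_abs_summable. Qed.

Lemma abs_summableX : fpsX \in abs_summable.
Proof. by rewrite -[fpsX]mulr1; exact/abs_summableXM/rpred1. Qed.

Lemma abs_summable_shift a : a \in abs_summable -> fps_shift a \in abs_summable.
Proof. by case/abs_summableP => M /(@l1_le_iter_shift _ 1)/l1_le_abs_summable. Qed.

Lemma abs_summable_dil x a : normc x <= 1 -> a \in abs_summable ->
  fps_dil x a \in abs_summable.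
Proof. by move=> x1 /abs_summableP[M /(l1_le_dil x1)/l1_le_abs_summable]. Qed.

Lemma abs_summable_tail a (e : R) : a \in abs_summable -> 0 < e ->
  exists n, l1_le (iter n (@fps_shift _) a) e.
Proof.
move=> /abs_summableP[M aM] e0; pose A n := \sum_(i < n) normc (a i).
have ndA : nondecreasing_seq A.
  apply/nondecreasing_seqP => n; rewrite /A big_ord_recr lerDl; exact: normc_ge0.
have cvgA : cvgn A.
  by apply: nondecreasing_is_cvgn => //; exists M => _ [n _ <-]; exact: aM.
have /cvgrPdist_lt/(_ _ e0)[n _ /(_ n (leqnn n)) /= dist_lt] : A @ \oo --> limn A by [].
exists n => m; under eq_bigr do rewrite iter_fps_shiftE.
have -> : \sum_(i < m) normc (a (n + i)%N) = A (n + m)%N - A n.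
  by apply/esym/eqP; rewrite subr_eq addrC /A big_split_ord.
apply: le_trans (ltW (le_lt_trans (ler_norm _) dist_lt)).
by rewrite lerD2r; exact: nondecreasing_cvgn_le.
Qed.

Lemma abs_summable_cvg a : a \in abs_summable -> cvgn (series (a : nat -> R[i]^o)).
Proof.
move=> /abs_summableP[M aM].
have cvg_part (f : R[i] -> R) : (forall z, `|f z| <= normc z) ->
    cvgn (series (f \o a)).
  move=> f_le; apply: normed_cvg; apply: nondecreasing_is_cvgn.
    by apply: nondecreasing_series => n _ _; exact: normr_ge0.
  exists M => _ [n _ <-]; rewrite /normed_series_of seriesEord /=.
  by apply: le_trans (aM n); apply: ler_sum => i _; exact: f_le.
apply/cvg_ex; exists (limn (series (@complex.Re R \o a)) +i*
                      limn (series (@complex.Im R \o a))).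
apply/cvgC_ReIm; split=> /=.
  rewrite (_ : (fun _ => _) = series (@complex.Re R \o a)).
    exact: cvg_part (@ler_Re_normc R).
  by apply/funext => n; exact: Re_sum.
rewrite (_ : (fun _ => _) = series (@complex.Im R \o a)).
  exact: cvg_part (@ler_Im_normc R).
by apply/funext => n; exact: Im_sum.
Qed.

Definition fps_sum a : R[i] := limn (series (a : nat -> R[i]^o)).

Lemma fps_sumP a : a \in abs_summable ->
  series (a : nat -> R[i]^o) @ \oo --> (fps_sum a : R[i]^o).
Proof. exact: abs_summable_cvg. Qed.

Lemma fps_sum_unique a (l : R[i]) :
  series (a : nat -> R[i]^o) @ \oo --> (l : R[i]^o) -> fps_sum a = l.
Proof. by move=> a_l; apply: (cvg_lim _ a_l); exact: norm_hausdorff. Qed.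

Lemma fps_sum_le a M : l1_le a M -> normc (fps_sum a) <= M.
Proof.
move=> aM; apply: cvgC_normc_le (fps_sumP (l1_le_abs_summable aM)) _ => n.
by rewrite /series /= big_mkord; apply: le_trans (aM n); exact: normc_sum.
Qed.

Lemma fps_sumD a b : a \in abs_summable -> b \in abs_summable ->
  fps_sum (a + b) = fps_sum a + fps_sum b.
Proof.
move=> sa sb; apply: fps_sum_unique.
have -> : series (a + b : nat -> R[i]^o) =
    series (a : nat -> R[i]^o) + series (b : nat -> R[i]^o).
  by apply/funext => n; rewrite /series /= big_split.
exact: cvgD (fps_sumP sa) (fps_sumP sb).
Qed.

Lemma fps_sumCM k a : a \in abs_summable -> fps_sum (fpsC k * a) = k * fps_sum a.
Proof.
move=> sa; apply: fps_sum_unique.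
have -> : series (fpsC k * a : nat -> R[i]^o) =
    (fun n => k * series (a : nat -> R[i]^o) n).
  apply/funext => n; rewrite /series /= mulr_sumr.
  by apply: eq_bigr => i _; rewrite coef_fpsCM.
exact: cvgMl_tmp (fps_sumP sa).
Qed.

Lemma fps_sumXM a : a \in abs_summable -> fps_sum (fpsX * a) = fps_sum a.
Proof.
move=> sa; apply: fps_sum_unique; rewrite -cvg_shiftS /=.
apply: cvg_trans (fps_sumP sa); apply: near_eq_cvg; apply: nearW => n.
rewrite !seriesEord /= big_ord_recl coef_fpsXM add0r.
by apply: eq_bigr => i _; rewrite coef_fpsXM.
Qed.

Lemma fps_sum1 : fps_sum 1 = 1.
Proof.
apply: fps_sum_unique; rewrite -cvg_shiftS /=; apply: cvg_near_cst.
by apply: nearW => n; rewrite seriesEord /= big_ord_recl big1 ?addr0.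
Qed.

Lemma fps_sumC k : fps_sum (fpsC k) = k.
Proof. by rewrite -[fpsC k]mulr1 fps_sumCM ?rpred1// fps_sum1 mulr1. Qed.

Lemma fps_sumN a : a \in abs_summable -> fps_sum (- a) = - fps_sum a.
Proof. by move=> sa; rewrite -mulN1r -(rmorphN1 (@fpsC _)) fps_sumCM// mulN1r. Qed.

Lemma fps_sumB a b : a \in abs_summable -> b \in abs_summable ->
  fps_sum (a - b) = fps_sum a - fps_sum b.
Proof. by move=> sa sb; rewrite fps_sumD ?fps_sumN ?rpredN. Qed.

Lemma fps_sum_shift a : a \in abs_summable ->
  fps_sum a = a 0%N + fps_sum (fps_shift a).
Proof.
move=> /abs_summable_shift sa; rewrite {1}[a]fps_shiftE.
by rewrite fps_sumD ?abs_summableC ?abs_summableXM// fps_sumC fps_sumXM.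
Qed.

(* The defect D b := fps_sum (a * b) - fps_sum a * fps_sum b is unchanged when b
   is shifted, and it is dominated by the norm of b. *)
Lemma fps_sumM a b : a \in abs_summable -> b \in abs_summable ->
  fps_sum (a * b) = fps_sum a * fps_sum b.
Proof.
move=> sa sb; have [M aM] := abs_summableP _ sa.
have defect_le n c (e : R) : c \in abs_summable -> l1_le (iter n (@fps_shift _) c) e ->
    normc (fps_sum (a * c) - fps_sum a * fps_sum c) <= 2 * M * e.
  elim: n c => [|n IH] c sc ce.
    apply: le_trans (normcB _ _) _; rewrite normcM -mulrA mulrDl mul1r.
    by rewrite lerD ?(fps_sum_le (l1_leM aM ce))// ler_pM ?normc_ge0 ?fps_sum_le.
  have ss := abs_summable_shift sc.
  suff -> : fps_sum (a * c) - fps_sum a * fps_sum c =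
      fps_sum (a * fps_shift c) - fps_sum a * fps_sum (fps_shift c).
    by apply: IH => //; rewrite -iterSr.
  have -> : a * c = fpsC (c 0%N) * a + fpsX * (a * fps_shift c).
    by rewrite {1}[c]fps_shiftE; ring.
  rewrite (fps_sum_shift sc) fps_sumD ?(abs_summableXM, rpredM, abs_summableC)//.
  by rewrite fps_sumCM ?fps_sumXM ?rpredM//; ring.
have M0 := l1_le_ge0 aM.
apply/eqP; rewrite -subr_eq0 -normc_eq0 eq_le normc_ge0 andbT.
apply/ler_addgt0Pr => e e0; rewrite add0r.
have [|n tail_le] := @abs_summable_tail b (e / (2 * M + 1)) sb.
  by rewrite divr_gt0// ltr_wpDl ?mulr_ge0.
apply: le_trans (defect_le n b _ sb tail_le) _.
by rewrite mulrCA ler_piMr ?(ltW e0)// ler_pdivrMr; lra.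
Qed.

Definition ev a x : R[i] := fps_sum (fps_dil x a).

Lemma evP a x : normc x <= 1 -> a \in abs_summable ->
  series ((fun n => a n * x ^+ n) : nat -> R[i]^o) @ \oo --> (ev a x : R[i]^o).
Proof. by move=> x1 sa; exact: fps_sumP (abs_summable_dil x1 sa). Qed.

Lemma ev_le a x M : normc x <= 1 -> l1_le a M -> normc (ev a x) <= M.
Proof. by move=> x1 aM; apply: fps_sum_le; exact: l1_le_dil. Qed.

Lemma ev_dil t a x : ev (fps_dil t a) x = ev a (t * x).
Proof. by rewrite /ev fps_dil_dil mulrC. Qed.

Lemma evC k x : ev (fpsC k) x = k.
Proof. by rewrite /ev fps_dilC fps_sumC. Qed.

Lemma ev1 x : ev 1 x = 1.
Proof. exact: (evC 1). Qed.

Lemma evX x : ev fpsX x = x.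
Proof.
rewrite /ev fps_dilX fps_sumCM ?abs_summableX// -[fpsX]mulr1.
by rewrite fps_sumXM ?rpred1// fps_sum1 mulr1.
Qed.

Lemma ev0 a : ev a 0 = a 0%N.
Proof. by rewrite /ev fps_dil0 fps_sumC. Qed.

Section EvalInClosedUnitDisc.
Variable x : R[i].
Hypothesis x1 : normc x <= 1.

Lemma evD a b : a \in abs_summable -> b \in abs_summable ->
  ev (a + b) x = ev a x + ev b x.
Proof. by move=> sa sb; rewrite /ev rmorphD fps_sumD ?abs_summable_dil. Qed.

Lemma evM a b : a \in abs_summable -> b \in abs_summable ->
  ev (a * b) x = ev a x * ev b x.
Proof. by move=> sa sb; rewrite /ev rmorphM fps_sumM ?abs_summable_dil. Qed.

Lemma evN a : a \in abs_summable -> ev (- a) x = - ev a x.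
Proof. by move=> sa; rewrite /ev rmorphN fps_sumN ?abs_summable_dil. Qed.

Lemma evB a b : a \in abs_summable -> b \in abs_summable ->
  ev (a - b) x = ev a x - ev b x.
Proof. by move=> sa sb; rewrite evD ?evN ?rpredN. Qed.

End EvalInClosedUnitDisc.

Lemma ev_lipschitz a M x y : a \in abs_summable -> l1_le (fps_euler a) M ->
  normc x <= 1 -> normc y <= 1 -> normc (ev a x - ev a y) <= M * normc (x - y).
Proof.
move=> sa aM x1 y1; have /fps_sum_le := l1_le_dilB x1 y1 aM.
by rewrite fps_sumB ?abs_summable_dil.
Qed.

End AbsolutelySummableSeries.

Arguments abs_summable {R}.
Global Opaque fps_sum.

Section DiscreteFourier.

Lemma closed_field_prim_root (F : closedFieldType) n : n%:R != 0 :> F ->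
  exists z : F, n.-primitive_root z.
Proof.
move=> n_neq0; have n_gt0 : (0 < n)%N by rewrite lt0n; apply: contraNneq n_neq0 => ->.
have [rs XnB1E] := closed_field_poly_normal ('X^n - 1 : {poly F}).
rewrite (monicP _) ?monicXnsubC // scale1r in XnB1E.
have rs_unity : all n.-unity_root rs by apply/allP=> z; rewrite -root_prod_XsubC -XnB1E.
have size_rs : (n < (size rs).+1)%N.
  by rewrite -(size_prod_XsubC rs id) -XnB1E size_XnsubC.
have [|z] := hasP (has_prim_root n_gt0 rs_unity _ size_rs); last by exists z.
by rewrite -separable_prod_XsubC -XnB1E separable_Xn_sub_1.
Qed.

Lemma sum_expr_prim_root (F : idomainType) n (z : F) k : n.-primitive_root z ->
  ~~ (n %| k)%N -> \sum_(j < n) (z ^+ k) ^+ j = 0.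
Proof.
move=> z_prim; rewrite (prim_order_dvd z_prim) -subr_eq0 => zk_neq1.
apply: (mulfI zk_neq1).
by rewrite -subrX1 -exprM mulnC exprM (prim_expr_order z_prim) expr1n subrr mulr0.
Qed.

Lemma discrete_fourier_inversion (F : idomainType) N (z : F) (c : nat -> F) n :
  N.-primitive_root z -> (n < N)%N ->
  \sum_(j < N) (\sum_(i < N) c i * (z ^+ j) ^+ i) * (z ^+ (N - n)) ^+ j = N%:R * c n.
Proof.
move=> z_prim nN; under eq_bigr do rewrite mulr_suml.
have termE i j : c i * (z ^+ j) ^+ i * (z ^+ (N - n)) ^+ j =
    c i * (z ^+ (i + (N - n))) ^+ j.
  by rewrite -mulrA -!exprM -exprD mulnC mulnDl.
rewrite exchange_big /= (bigD1 (Ordinal nN))//= [X in _ + X]big1 ?addr0 => [|i i_neq].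
  under eq_bigr do rewrite termE /= subnKC ?(ltnW nN)// (prim_expr_order z_prim).
  by under eq_bigr do rewrite expr1n mulr1; rewrite sumr_const card_ord mulr_natl.
under eq_bigr do rewrite termE.
rewrite -mulr_sumr (sum_expr_prim_root z_prim) ?mulr0//.
apply: contra i_neq => /dvdnP[q iE]; apply/eqP/val_inj => /=.
by have := ltn_ord i; case: q iE => [|[|q]]; lia.
Qed.

End DiscreteFourier.

Section CoefficientEstimate.
Variable R : realType.
Implicit Types (c : fps R[i]) (x : R[i]).

Lemma normc_prim_root n (z : R[i]) : n.-primitive_root z -> normc z = 1.
Proof.
move=> z_prim; have n_gt0 := prim_order_gt0 z_prim.
have /(congr1 (@normc R)) := prim_expr_order z_prim; rewrite normcX normc1 => /eqP.
by rewrite pexpr_eq1 ?normc_ge0// => /eqP.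
Qed.

Lemma ev_shift c x : normc x <= 1 -> c \in abs_summable ->
  ev c x = c 0%N + x * ev (fps_shift c) x.
Proof.
move=> x1 sc; have ss := abs_summable_shift sc.
rewrite {1}[c]fps_shiftE evD ?evM ?evC ?evX// ?rpredM//.
all: by rewrite ?abs_summableC ?abs_summableX.
Qed.

Lemma ev_partial_sum c x n : normc x <= 1 -> c \in abs_summable ->
  ev c x = \sum_(i < n) c i * x ^+ i + x ^+ n * ev (iter n (@fps_shift _) c) x.
Proof.
move=> x1; elim: n c => [|n IH] c sc; first by rewrite big_ord0 add0r mul1r.
rewrite (ev_shift x1 sc) (IH _ (abs_summable_shift sc)) big_ord_recl /= mulr1.
rewrite -iterSr mulrDr mulr_sumr mulrA -exprS addrA; congr (_ + _ + _ * _).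
by apply: eq_bigr => i _; rewrite /fps_shift mulrCA -exprS.
Qed.

(* c_n is recovered from the values of c at the N-th roots of unity, N > n, up to
   the tail of the series. *)
Lemma normc_coef_le_sup c (M : R) n : c \in abs_summable ->
  (forall x, normc x = 1 -> normc (ev c x) <= M) -> normc (c n) <= M.
Proof.
move=> sc c_le; apply/ler_addgt0Pr => e e0.
have [k tail_le] := abs_summable_tail sc e0.
have [kN nN] : (k <= maxn k n.+1)%N /\ (n < maxn k n.+1)%N by rewrite leq_maxl leq_maxr.
move: (maxn _ _) kN nN => N kN nN.
have N0 : 0 < N%:R :> R by rewrite ltr0n (leq_trans _ nN).
have [z z_prim] : exists z : R[i], N.-primitive_root z.
  by apply: closed_field_prim_root; rewrite -normc_eq0 normc_nat gt_eqF.
have z1 := normc_prim_root z_prim.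
have partial_sum_le j : normc (\sum_(i < N) c i * (z ^+ j) ^+ i) <= M + e.
  have zj1 : normc (z ^+ j) = 1 by rewrite normcX z1 expr1n.
  have zj_le1 : normc (z ^+ j) <= 1 by rewrite zj1.
  rewrite -[X in normc X](addrK ((z ^+ j) ^+ N * ev (iter N (@fps_shift _) c) (z ^+ j))).
  rewrite -ev_partial_sum//.
  apply: le_trans (normcB _ _) _; rewrite lerD ?c_le//.
  rewrite normcM normcX zj1 expr1n mul1r; apply: ev_le => //.
  by rewrite -(subnK kN) iterD; exact: l1_le_iter_shift.
suff : normc (N%:R * c n) <= N%:R * (M + e) by rewrite normcM normc_nat ler_pM2l.
rewrite -(discrete_fourier_inversion c z_prim nN).
apply: le_trans (normc_sum _ _ _) _.
apply: (@le_trans _ _ (\sum_(j < N) (M + e))).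
  by apply: ler_sum => j _; rewrite normcM !normcX z1 !expr1n mulr1.
by rewrite sumr_const card_ord mulr_natl.
Qed.

Lemma sum_inv_mulSSS n : \sum_(i < n) (i.+1%:R * i.+2%:R)^-1 = 1 - n.+1%:R^-1 :> R.
Proof.
elim: n => [|n IH]; first by rewrite big_ord0 invr1 subrr.
by rewrite big_ord_recr /= IH; field; rewrite nat1r -natrD !pnatr_eq0.
Qed.

Lemma l1_le_euler2 c (M : R) : (forall n, normc (c n) <= M) ->
  (forall n, normc (fps_euler (fps_euler c) n) <= M) -> l1_le c (6 * M).
Proof.
move=> c_le euler2_le n.
have M0 : 0 <= M by apply: le_trans (c_le 0%N); exact: normc_ge0.
apply: (@le_trans _ _ (\sum_(i < n) 6 * M * (i.+1%:R * i.+2%:R)^-1)).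
  apply: ler_sum => -[i /= _] _.
  rewrite ler_pdivlMr ?mulr_gt0 ?ltr0n// -!natr1.
  have := c_le i; have := euler2_le i; rewrite /fps_euler !normcMn -[leLHS]mulr_natr.
  rewrite -[normc _ *+ i]mulr_natr.
  have := mulr_ge0 (normc_ge0 (c i)) (sqr_ge0 (i%:R - 1 : R)).
  by move: (normc (c i)) (i%:R) => B N; lra.
by rewrite -mulr_sumr sum_inv_mulSSS ler_piMr ?mulr_ge0// gerBl invr_ge0.
Qed.

End CoefficientEstimate.

Section MinimumModulus.
Variable R : realType.
Implicit Types (a : fps R[i]) (x y : R[i]).

Let disc : set (R * R) := [set p | normc (p.1 +i* p.2) <= 1].

Lemma compact_closed_unit_disc : compact disc.
Proof.
have in_square (p : R * R) : disc p -> p.1 \in `[-1, 1] /\ p.2 \in `[-1, 1].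
  rewrite /disc !in_itv /= -!ler_norml => p_disc.
  split; apply: le_trans p_disc.
    exact: (ler_Re_normc (p.1 +i* p.2)).
  exact: (ler_Im_normc (p.1 +i* p.2)).
have discE : disc = (fun p : R * R => p.1 ^+ 2 + p.2 ^+ 2) @^-1` [set r | r <= 1].
  apply/funext => p; apply: (congr1 is_true); rewrite -[1 in RHS](expr1n _ 2).
  by rewrite -(sqr_normc_ReIm (p.1 +i* p.2)) ler_pXn2r ?nnegrE ?normc_ge0.
apply: (subclosed_compact _ (compact_setX (@segment_compact R (-1) 1)
  (@segment_compact R (-1) 1))) => [|p /in_square[]//].
rewrite discE; apply: preimage_closed; last exact: closed_le.
move=> p _; apply: cvgD => /=.
  by apply: (@continuous_comp _ _ _ fst (fun r : R => r ^+ 2));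
    [exact: cvg_fst | exact: exprn_continuous].
by apply: (@continuous_comp _ _ _ snd (fun r : R => r ^+ 2));
  [exact: cvg_snd | exact: exprn_continuous].
Qed.

Lemma lipschitz_unit_disc_EVT_min (f : R[i] -> R) (M : R) :
  (forall x y, normc x <= 1 -> normc y <= 1 -> `|f x - f y| <= M * normc (x - y)) ->
  exists2 x, normc x <= 1 & forall y, normc y <= 1 -> f x <= f y.
Proof.
move=> f_lip; pose g (p : R * R) := f (p.1 +i* p.2).
have disc0 : disc !=set0 by exists (0, 0); rewrite /disc /= expr0n addr0 sqrtr0.
have g_cont : {within disc, continuous g}.
  apply/subspace_continuousP => p p_disc; apply/cvgrPdist_lt => e e0.
  have M1 : 0 < `|M| + 1 by rewrite ltr_wpDl.
  pose d := e / (2 * (`|M| + 1)); have d0 : 0 < d by rewrite divr_gt0// mulr_gt0.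
  rewrite near_withinE; exists (ball p.1 d, ball p.2 d).
    by split; exact: nbhsx_ballx.
  move=> q [/= q1 q2] q_disc; apply: le_lt_trans (f_lip _ _ p_disc q_disc) _.
  have dist_lt : normc ((p.1 +i* p.2) - (q.1 +i* q.2)) < e / (`|M| + 1).
    apply: le_lt_trans (ler_normc_ReIm _) _; rewrite Re_subc Im_subc /=.
    by apply: lt_le_trans (ltrD q1 q2) _; rewrite -mulr2n -mulr_natl /d invfM mulrCA mulVKf.
  apply: le_lt_trans (ler_wpM2r (normc_ge0 _) (ler_norm M)) _.
  apply: le_lt_trans (ler_wpM2r (normc_ge0 _) (_ : _ <= `|M| + 1)) _; first by rewrite lerDl.
  by rewrite mulrC -ltr_pdivlMr.
have [p p_disc p_min] := compact_EVT_min disc0 compact_closed_unit_disc g_cont.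
exists (p.1 +i* p.2) => [|[y1 y2] y_le1]; first by move: p_disc; rewrite inE.
by apply: (p_min (y1, y2)); rewrite inE.
Qed.

Lemma ev_min_modulus a : a \in abs_summable -> fps_euler a \in abs_summable ->
  (forall x, normc x <= 1 -> ev a x != 0) ->
  exists2 m : R, 0 < m & forall x, normc x <= 1 -> m <= normc (ev a x).
Proof.
move=> sa /abs_summableP[M aM] a_neq0.
have [|x x1 x_min] := @lipschitz_unit_disc_EVT_min (fun x => normc (ev a x)) M.
  move=> x y x1 y1; apply: le_trans (ev_lipschitz sa aM x1 y1).
  exact: (ler_dist_dist (ev a x : Rcomplex R)).
by exists (normc (ev a x)) => //; rewrite normc_gt0 a_neq0.
Qed.

End MinimumModulus.

Section WienerLemma.
Variable R : realType.
Implicit Types (a b : fps R[i]) (m t : R) (x : R[i]).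

(* Differentiating a b = 1 twice bounds b and b'' on the unit circle. *)
Lemma l1_le_inv_apriori a b m M1 M2 : 0 < m ->
  (forall x, normc x <= 1 -> m <= normc (ev a x)) ->
  l1_le (fps_euler a) M1 -> l1_le (fps_euler (fps_euler a)) M2 ->
  a \in abs_summable -> b \in abs_summable -> a * b = 1 ->
  l1_le b (6 * (m^-1 + 2 * M1 ^+ 2 * m^-1 ^+ 3 + M2 * m^-1 ^+ 2)).
Proof.
move=> m0 a_ge aM1 aM2 sa sb ab.
have mV0 : 0 <= m^-1 by rewrite invr_ge0 ltW.
have M10 := l1_le_ge0 aM1; have M20 := l1_le_ge0 aM2.
have sa1 := l1_le_abs_summable aM1; have sa2 := l1_le_abs_summable aM2.
have evb_le x : normc x <= 1 -> normc (ev b x) <= m^-1.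
  move=> x1; have /(congr1 (@normc R)) := evM x1 sa sb.
  rewrite ab ev1 normc1 normcM => ev_ab.
  by rewrite -[leRHS]mul1r ler_pdivlMr// ev_ab mulrC ler_wpM2r ?normc_ge0 ?a_ge.
have s2 : 2 * fps_euler a ^+ 2 * b ^+ 3 \in abs_summable by rewrite !rpredM ?rpredX ?rpred_nat.
have s2' : fps_euler (fps_euler a) * b ^+ 2 \in abs_summable by rewrite rpredM ?rpredX.
have bound1_ge0 : 0 <= 2 * M1 ^+ 2 * m^-1 ^+ 3 by rewrite !mulr_ge0 ?exprn_ge0.
have bound2_ge0 : 0 <= M2 * m^-1 ^+ 2 by rewrite mulr_ge0 ?exprn_ge0.
apply: l1_le_euler2 => n; apply: normc_coef_le_sup => [|x x1].
- by [].
- by apply: le_trans (evb_le x _) _; rewrite ?x1// -addrA lerDl addr_ge0.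
- by rewrite (fps_euler2V ab) rpredB.
have x_le1 : normc x <= 1 by rewrite x1.
rewrite (fps_euler2V ab) evB// !evM ?rpredM ?rpredX ?rpred_nat//.
have -> : ev (2 : fps R[i]) x = 2 by rewrite -(rmorph_nat (@fpsC _)) evC.
move: (ev _ x) (ev _ x) (ev b x) (ev_le x_le1 aM1) (ev_le x_le1 aM2) (evb_le x x_le1).
move=> A1 A2 B A1_le A2_le B_le.
apply: le_trans (normcB _ _) _; rewrite !normcM normc_nat -addrA.
rewrite -[leLHS]add0r -[m^-1 ^+ 3]/(m^-1 * (m^-1 * m^-1)) !expr2.
by rewrite !lerD// !ler_pM// ?mulr_ge0 ?normc_ge0.
Qed.

Lemma unit_segment_step_ind (P : R -> Prop) (d : R) : 0 < d -> P 0 ->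
  (forall s t : R, 0 <= s <= 1 -> 0 <= t <= 1 -> `|t - s| <= d -> P s -> P t) -> P 1.
Proof.
move=> d0 P0 P_step; pose n := (Num.truncn d^-1).+1.
have n0 : 0 < n%:R :> R by rewrite ltr0n.
have in_segment k : (k <= n)%N -> 0 <= (k%:R / n%:R : R) <= 1.
  by move=> kn; rewrite divr_ge0//= ler_pdivrMr// mul1r ler_nat.
suff Pk k : (k <= n)%N -> P (k%:R / n%:R) by have := Pk n (leqnn n); rewrite divff ?gt_eqF.
elim: k => [|k IH] kn; first by rewrite mul0r.
apply: P_step (IH (ltnW kn)); rewrite ?in_segment ?(ltnW kn)//.
rewrite -mulrBl -natrB// subSnn mul1r ger0_norm ?invr_ge0//.
by rewrite invf_ple// ltW// truncnS_gt.
Qed.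

(* The a priori bound lets 1/a be continued from any disc of radius t < 1 on which
   it is known to be summable to a disc whose radius is larger by a fixed step. *)
Theorem wiener_inverse a : a \in abs_summable -> fps_euler a \in abs_summable ->
  fps_euler (fps_euler a) \in abs_summable ->
  (forall x, normc x <= 1 -> ev a x != 0) ->
  exists2 b : fps R[i], a * b = 1 & b \in abs_summable.
Proof.
move=> sa sa1 sa2 a_neq0.
have [m m0 a_ge] := ev_min_modulus sa sa1 a_neq0.
have [[M1 aM1] [M2 aM2]] := (abs_summableP _ sa1, abs_summableP _ sa2).
have [|b ab] := @fps_inv_ex _ a; first by rewrite unitfE -ev0 a_neq0// normc0.
pose M := 6 * (m^-1 + 2 * M1 ^+ 2 * m^-1 ^+ 3 + M2 * m^-1 ^+ 2).
have real_dil_le1 t : 0 <= t <= 1 -> normc t%:C <= 1.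
  by move=> /andP[t0 t1]; rewrite normc_real ger0_norm.
have dil_ab t : fps_dil t%:C a * fps_dil t%:C b = 1 by rewrite -rmorphM ab rmorph1.
have apriori t : 0 <= t <= 1 -> fps_dil t%:C b \in abs_summable -> l1_le (fps_dil t%:C b) M.
  move=> /real_dil_le1 t1 sb; apply: (l1_le_inv_apriori m0 _ _ _ _ sb (dil_ab t)).
  - by move=> x x1; rewrite ev_dil a_ge// normcM mulr_ile1 ?normc_ge0.
  - by rewrite fps_euler_dil; exact: l1_le_dil t1 aM1.
  - by rewrite !fps_euler_dil; exact: l1_le_dil t1 aM2.
  - exact: abs_summable_dil.
have s0 : fps_dil 0%:C b \in abs_summable by rewrite fps_dil0 abs_summableC.
have MM1 : 0 <= M1 * M.
  by rewrite mulr_ge0 ?(l1_le_ge0 aM1) ?(l1_le_ge0 (apriori 0 _ s0))// lexx ler01.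
suff : fps_dil 1%:C b \in abs_summable by rewrite fps_dil1; exists b.
apply: (@unit_segment_step_ind (fun t => fps_dil t%:C b \in abs_summable)
  (2 * (M1 * M + 1))^-1).
- by rewrite invr_gt0 mulr_gt0// ltr_wpDl.
- exact: s0.
move=> s t s01 t01 st sb.
have dil_dist := l1_le_dilB (real_dil_le1 _ t01) (real_dil_le1 _ s01) aM1.
have [|c tac c2M] := l1_le_inv_perturb (dil_ab s) (apriori _ s01 sb) dil_dist.
  rewrite distc_real mulrAC.
  apply: le_trans (ler_wpM2l MM1 st) _.
  by rewrite invfM mulrCA ler_piMr ?invr_ge0// ler_pdivrMr; lra.
have -> : fps_dil t%:C b = c.
  by apply: mulr1_uniq (dil_ab t) _; rewrite -[RHS]tac addrC subrK.
exact: l1_le_abs_summable c2M.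
Qed.

End WienerLemma.

Section EntireSeries.
Variable R : realType.
Implicit Types (a f g : fps R[i]) (w x z : R[i]).

Definition entire : {pred fps R[i]} :=
  fun a => `[< forall z, fps_dil z a \in abs_summable >].

Lemma entire_dil_summable z a : a \in entire -> fps_dil z a \in abs_summable.
Proof. by move=> /asboolP. Qed.

Lemma entire_summable a : a \in entire -> a \in abs_summable.
Proof. by move=> /(entire_dil_summable 1); rewrite fps_dil1. Qed.

Fact entire_subring_closed : subring_closed entire.
Proof.
split=> [|a b ea eb|a b ea eb]; apply/asboolP => z.
- by rewrite rmorph1 rpred1.
- by rewrite rmorphB rpredB ?entire_dil_summable.
- by rewrite rmorphM rpredM ?entire_dil_summable.
Qed.

HB.instance Definition _ := GRing.isSubringClosed.Build (fps R[i]) entire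
  entire_subring_closed.

Lemma entireC k : fpsC k \in entire.
Proof. by apply/asboolP => z; rewrite fps_dilC abs_summableC. Qed.

Lemma entireX : fpsX \in entire.
Proof. by apply/asboolP => z; rewrite fps_dilX rpredM ?abs_summableC ?abs_summableX. Qed.

Lemma entire_dil z a : a \in entire -> fps_dil z a \in entire.
Proof. by move=> ea; apply/asboolP => y; rewrite fps_dil_dil entire_dil_summable. Qed.

Lemma entire_euler a : a \in entire -> fps_euler a \in entire.
Proof.
move=> ea; apply/asboolP => z.
have [M aM] := abs_summableP _ (entire_dil_summable (2 * z) ea).
apply: l1_le_abs_summable (l1_le_dominated _ aM) => n.
rewrite /fps_dil /fps_euler !normcM normcMn !normcX normcM normc_nat exprMn.
rewrite mulrnAl -mulrnAr ler_wpM2l ?normc_ge0// -mulr_natl ler_wpM2r ?exprn_ge0 ?normc_ge0//.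
by rewrite -natrX ler_nat ltnW// ltn_expl.
Qed.

Lemma l1_le_iter_shift_dil a (r M : R) n : 1 <= r -> l1_le (fps_dil r%:C a) M ->
  l1_le (iter n (@fps_shift _) a) (M / r ^+ n).
Proof.
move=> r1 /(@l1_le_iter_shift _ n) aM m; have r0 : 0 < r by exact: lt_le_trans r1.
rewrite ler_pdivlMr ?exprn_gt0// mulr_suml; apply: le_trans (aM m).
apply: ler_sum => i _; rewrite !iter_fps_shiftE normcM normcX normc_real gtr0_norm//.
by rewrite ler_wpM2l ?normc_ge0// ler_weXn2l ?leq_addr.
Qed.

Lemma entire_div_root f w : f \in entire -> normc w <= 1 -> ev f w = 0 ->
  exists2 g, g \in entire & f = (fpsX - fpsC w) * g.
Proof.
move=> ef w1 fw0; pose g : fps R[i] := fun n => ev (iter n.+1 (@fps_shift _) f) w.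
have s_shift n : iter n (@fps_shift _) f \in abs_summable.
  by elim: n => [|n IH]; [exact: entire_summable | exact: abs_summable_shift].
exists g; last first.
  apply/funext => -[|n]; rewrite mulrBl coef_fpsD coef_fpsN coef_fpsXM coef_fpsCM.
    by apply/eqP; rewrite add0r -addr_eq0 -(ev_shift w1 (s_shift 0%N)) fw0.
  by rewrite /g (ev_shift w1 (s_shift n.+1)) iter_fps_shiftE addn0 addrK.
apply/asboolP => z; pose r := 2 * (normc z + 1).
have r1 : 1 <= r by have := normc_ge0 z; rewrite /r; lra.
have r0 : 0 < r by exact: lt_le_trans r1.
have [M fM] := abs_summableP _ (entire_dil_summable r%:C ef).
apply: (l1_le_abs_summable (@l1_le_geometric _ _ M 2^-1 _ _)) => [|n].
  by rewrite invr_ge0 ler0n invf_lt1 ?ltr1n.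
have := ev_le w1 (l1_le_iter_shift_dil n.+1 r1 fM); rewrite -/(g n) normcM normcX => g_le.
apply: le_trans (ler_wpM2r (exprn_ge0 _ (normc_ge0 z)) g_le) _.
rewrite -mulrA ler_wpM2l ?(l1_le_ge0 fM)// mulrC ler_pdivrMr ?exprn_gt0//.
apply: (@le_trans _ _ ((2^-1 * r) ^+ n)).
  have z_le : normc z <= 2^-1 * r by rewrite /r mulKf ?lerDl ?pnatr_eq0.
  by rewrite lerXn2r ?nnegrE ?(le_trans (normc_ge0 z) z_le) ?normc_ge0.
by rewrite exprMn ler_wpM2l ?exprn_ge0// ler_weXn2l.
Qed.

Lemma ev_euler_root f g w : normc w <= 1 -> g \in entire ->
  f = (fpsX - fpsC w) * g -> ev (fps_euler f) w = w * ev g w.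
Proof.
move=> w1 eg ->; have seg := entire_summable (entire_euler eg).
have sg := entire_summable eg.
have sXC : fpsX - fpsC w \in abs_summable by rewrite rpredB ?abs_summableX ?abs_summableC.
rewrite fps_eulerM raddfB /= fps_eulerX fps_eulerC subr0 evD// ?rpredM ?abs_summableX//.
rewrite !evM ?abs_summableX// evB ?abs_summableX ?abs_summableC// evX evC.
by rewrite subrr mul0r addr0.
Qed.

Lemma ev_conj a x : (forall n, (a n)^*%C = a n) -> normc x <= 1 -> a \in abs_summable ->
  ev a x^*%C = (ev a x)^*%C.
Proof.
move=> a_real x1 sa; apply: fps_sum_unique; apply/cvgC_normcP => e e0.
have /cvgC_normcP/(_ e e0) := evP x1 sa; apply: filterS => n; rewrite -normc_conj.
congr (normc _ < e); rewrite rmorphB !seriesEord /= rmorph_sum; congr (_ - _).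
by apply: eq_bigr => i _; rewrite rmorphM rmorphXn /= a_real.
Qed.

End EntireSeries.

Arguments entire {R}.

Section ComplexExponential.
Variable R : realType.
Implicit Types z w : R[i].

Lemma addCE (a b c d : R) : (a +i* b) + (c +i* d) = (a + c) +i* (b + d).
Proof. by []. Qed.

Lemma mulCE (a b c d : R) :
  (a +i* b) * (c +i* d) = (a * c - b * d) +i* (a * d + b * c).
Proof. by []. Qed.

Lemma cexp_real (x : R) : cexp x%:C = (expR x)%:C.
Proof. by rewrite /cexp /= cos0 sin0 mulr1 mulr0. Qed.

Lemma cexp0 : cexp 0 = 1 :> R[i].
Proof. by rewrite (cexp_real 0) expR0. Qed.

Lemma cexpD z w : cexp (z + w) = cexp z * cexp w.
Proof.
case: z w => [a b] [c d]; rewrite /cexp /= mulCE expRD cosD sinD.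
by congr (_ +i* _); ring.
Qed.

Lemma cexp_conj z : cexp z^*%C = (cexp z)^*%C.
Proof. by case: z => x y; rewrite /cexp /= cosN sinN mulrN. Qed.

Lemma normc_cexp z : normc (cexp z) = expR (complex.Re z).
Proof.
by rewrite /cexp /= !exprMn -mulrDr cos2Dsin2 mulr1 sqrtr_sqr ger0_norm// expR_ge0.
Qed.

Lemma cexp_neq0 z : cexp z != 0.
Proof. by rewrite -normc_gt0 normc_cexp expR_gt0. Qed.

Definition fps_exp z : fps R[i] := fun n => z ^+ n / n`!%:R.

Let fact_neq0 n : n`!%:R != 0 :> R[i].
Proof. by rewrite pnatr_eq0 -lt0n fact_gt0. Qed.

Lemma fps_dil_exp z w : fps_dil w (fps_exp z) = fps_exp (z * w).
Proof. by apply/funext => n; rewrite /fps_exp /fps_dil exprMn mulrAC. Qed.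

Lemma fps_expD z w : fps_exp (z + w) = fps_exp z * fps_exp w.
Proof.
apply/funext => n; rewrite coef_fpsM /fps_exp addrC exprDn mulr_suml.
apply: eq_bigr => -[i /= iN] _; rewrite ltnS in iN.
have := congr1 (fun k => k%:R : R[i]) (bin_fact iN); rewrite !natrM => <-.
have binom_neq0 : 'C(n, i)%:R != 0 :> R[i] by rewrite pnatr_eq0 -lt0n bin_gt0.
by rewrite -mulr_natr; field; rewrite !fact_neq0 binom_neq0.
Qed.

Lemma fps_euler_exp z : fps_euler (fps_exp z) = fpsC z * (fpsX * fps_exp z).
Proof.
apply/funext => -[|n]; rewrite coef_fpsCM coef_fpsXM /fps_euler ?mulr0//.
rewrite /fps_exp exprS factS natrM -mulr_natr.
by field; rewrite fact_neq0 nat1r pnatr_eq0.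
Qed.

Lemma l1_le_exp z : l1_le (fps_exp z) (expR (normc z)).
Proof.
move=> n; have -> : \sum_(i < n) normc (fps_exp z i) = series (exp_coeff (normc z)) n.
  rewrite seriesEord; apply: eq_bigr => i _.
  by rewrite /fps_exp /exp_coeff /= normcM normcV normcX normc_nat.
apply: nondecreasing_cvgn_le; last exact: is_cvg_series_exp_coeff.
by apply: nondecreasing_series => i _ _; rewrite /exp_coeff /= divr_ge0 ?exprn_ge0 ?normc_ge0.
Qed.

Lemma entire_exp z : fps_exp z \in entire.
Proof.
by apply/asboolP => w; rewrite fps_dil_exp; exact: l1_le_abs_summable (l1_le_exp _).
Qed.

Lemma fps_sum_exp_real (x : R) : fps_sum (fps_exp x%:C) = (expR x)%:C.
Proof.
have partial_sumE n : series (fps_exp x%:C : nat -> R[i]^o) n = (series (exp_coeff x) n)%:C.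
  rewrite !seriesEord /= rmorph_sum; apply: eq_bigr => i _.
  by rewrite /fps_exp /exp_coeff /= rmorphM fmorphV rmorphXn rmorph_nat.
apply: fps_sum_unique; apply/cvgC_ReIm; split=> /=.
  by under eq_fun do rewrite partial_sumE /=; exact: is_cvg_series_exp_coeff.
by under eq_fun do rewrite partial_sumE /=; exact: cvg_cst.
Qed.

Lemma fps_exp_imagE (y : R) n :
  fps_exp (0 +i* y) n = cos_coeff y n +i* sin_coeff y n.
Proof.
have -> : 0 +i* y = 'i%C * y%:C :> R[i] by rewrite mulCE; congr (_ +i* _); ring.
rewrite /fps_exp /cos_coeff /sin_coeff exprMn -rmorphXn.
rewrite -(rmorph_nat (real_complex R)) -fmorphV -mulrA -rmorphM /=.
have expr_i_double k : 'i%C ^+ k.*2 = ((-1) ^+ k)%:C :> R[i].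
  by rewrite -mul2n exprM sqr_i rmorphXn /= rmorphN1.
rewrite -(odd_double_half n); case: (odd n) => /=.
  rewrite add1n exprS expr_i_double odd_double doubleK mulCE.
  by congr (_ +i* _); rewrite /=; ring.
rewrite add0n expr_i_double odd_double doubleK /= -exprnP mulCE.
by congr (_ +i* _); rewrite /=; ring.
Qed.

Lemma fps_sum_exp_imag (y : R) : fps_sum (fps_exp (0 +i* y)) = cos y +i* sin y.
Proof.
apply: fps_sum_unique; apply/cvgC_ReIm; split=> /=.
  rewrite (_ : (fun _ => _) = series (cos_coeff y)).
    by rewrite unlock; exact: is_cvg_series_cos_coeff.
  apply/funext => n; rewrite !seriesEord Re_sum.
  by apply: eq_bigr => i _; rewrite fps_exp_imagE.
rewrite (_ : (fun _ => _) = series (sin_coeff y)).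
  by rewrite unlock; exact: is_cvg_series_sin_coeff.
apply/funext => n; rewrite !seriesEord Im_sum.
by apply: eq_bigr => i _; rewrite fps_exp_imagE.
Qed.

Lemma fps_sum_exp z : fps_sum (fps_exp z) = cexp z.
Proof.
case: z => x y; have -> : x +i* y = x%:C + 0 +i* y :> R[i].
  by rewrite addCE addr0 add0r.
rewrite fps_expD fps_sumM ?entire_summable ?entire_exp//.
rewrite fps_sum_exp_real fps_sum_exp_imag cexpD cexp_real.
by rewrite /cexp /= expR0 !mul1r.
Qed.

Lemma ev_exp z w : ev (fps_exp z) w = cexp (z * w).
Proof. by rewrite /ev fps_dil_exp fps_sum_exp. Qed.

End ComplexExponential.

Section LambertCurve.
Variable R : realType.
Implicit Types (f df : R -> R) (t x y : R) (z : R[i]).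

Lemma is_derive_lt0_decr f df x y : x < y ->
  (forall c, x <= c <= y -> is_derive c 1 f (df c)) ->
  (forall c, x < c < y -> df c < 0) -> f y < f x.
Proof.
move=> xy f_df df_lt0.
have f_cont : {within `[x, y], continuous f}.
  apply: derivable_within_continuous => c; rewrite in_itv /= => /f_df f_dfc.
  exact: ex_derive.
have f_df_oo c : c \in `]x, y[%R -> is_derive c 1 f (df c).
  by rewrite in_itv /= => /andP[xc cy]; apply: f_df; rewrite !ltW.
have [c] := MVT xy f_df_oo f_cont; rewrite in_itv /= => xcy fE.
by rewrite -subr_lt0 fE nmulr_rlt0 ?subr_gt0 ?df_lt0.
Qed.

Lemma mul_cos_lt_sin y : 0 < y < pi -> y * cos y < sin y.
Proof.
move=> /andP[y0 y_pi]; rewrite -subr_lt0.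
have -> : 0 = 0 * cos 0 - sin 0 :> R by rewrite sin0 mul0r subr0.
apply: (@is_derive_lt0_decr (fun u => u * cos u - sin u) (fun u => - (u * sin u)) _ _ y0).
  by move=> u _; apply: is_derive_eq; rewrite /GRing.scale /=; ring.
move=> u /andP[u0 uy]; rewrite oppr_lt0 mulr_gt0// sin_gt0_pi// u0.
exact: lt_trans y_pi.
Qed.

Lemma pihalf_gt1 : 1 < pi / 2 :> R.
Proof.
rewrite lt_neqAle pihalf_ge1 andbT; apply/eqP => pihalf1.
by have := @cos1_gt0 R; rewrite pihalf1 cos_pihalf ltxx.
Qed.

Lemma gtr0_lt_pihalf_itv y : 0 < y -> y < pi / 2 -> 0 < y < pi.
Proof. by move=> y0 yp; rewrite y0; have := pi_gt0 R; lra. Qed.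

(* The zeros x + i y of t + z + e^-z with 0 < y < pi are x = ln (sin y / y),
   t = - lambert_shift y. *)
Definition ln_sinc y := ln (sin y) - ln y.
Definition lambert_shift y := y * cos y / sin y + ln_sinc y.

Lemma is_derive_ln_sinc y : 0 < y < pi -> is_derive y 1 ln_sinc (cos y / sin y - y^-1).
Proof.
move=> y_itv; have sin_gt0 := sin_gt0_pi y_itv; move: y_itv => /andP[y0 _].
have ln_sin' := is_derive1_comp (is_derive1_ln sin_gt0) (is_derive_sin y).
have ln' := is_derive1_ln y0.
apply: (@is_derive_eq _ _ _ (@ln R \o @sin R - @ln R)).
by rewrite /GRing.scale /= mulrC.
Qed.

Lemma is_derive_lambert_shift y : 0 < y < pi ->
  is_derive y 1 lambert_shift (2 * cos y / sin y - y / sin y ^+ 2 - y^-1).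
Proof.
move=> y_itv; have sin_neq0 := lt0r_neq0 (sin_gt0_pi y_itv).
have ln_sinc' := is_derive_ln_sinc y_itv.
have sinV' : is_derive y 1 (fun u => (sin u)^-1) (- (sin y) ^- 2 *: cos y).
  exact: is_deriveV.
apply: (@is_derive_eq _ _ _ ((fun u => u * cos u) * (fun u => (sin u)^-1) + ln_sinc)).
move: y_itv => /andP[/lt0r_neq0 y_neq0 _]; rewrite /GRing.scale /=.
have := cos2Dsin2 y; move: (cos y) (sin y) sin_neq0 => c s s_neq0 cs.
have -> : y / s ^+ 2 = y * (c ^+ 2 + s ^+ 2) / s ^+ 2 by rewrite cs mulr1.
by field; rewrite s_neq0 y_neq0.
Qed.

Lemma ln_sinc_decr : {in `]0, pi[ &, {homo ln_sinc : x y /~ x < y}}.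
Proof.
move=> y x; rewrite !in_itv /= => /andP[_ y_pi] /andP[x0 _] xy.
apply: (is_derive_lt0_decr xy) => u /andP[xu uy].
  by apply: is_derive_ln_sinc; rewrite (lt_le_trans x0 xu) (le_lt_trans uy y_pi).
have u_itv : 0 < u < pi by rewrite (lt_trans x0 xu) (lt_trans uy y_pi).
have u0 : 0 < u by case/andP: u_itv.
rewrite subr_lt0 ltr_pdivrMr ?sin_gt0_pi// mulrC ltr_pdivlMr// mulrC.
exact: mul_cos_lt_sin.
Qed.

Lemma lambert_shift_decr : {in `]0, pi[ &, {homo lambert_shift : x y /~ x < y}}.
Proof.
move=> y x; rewrite !in_itv /= => /andP[_ y_pi] /andP[x0 _] xy.
apply: (is_derive_lt0_decr xy) => u /andP[xu uy].
  by apply: is_derive_lambert_shift; rewrite (lt_le_trans x0 xu) (le_lt_trans uy y_pi).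
have u_itv : 0 < u < pi by rewrite (lt_trans x0 xu) (lt_trans uy y_pi).
have u0 : 0 < u by case/andP: u_itv.
have s0 := sin_gt0_pi u_itv.
have -> : 2 * cos u / sin u - u / sin u ^+ 2 - u^-1 =
    - ((u - sin u * cos u) ^+ 2 + sin u ^+ 2 * (1 - cos u ^+ 2)) / (u * sin u ^+ 2).
  by field; rewrite !gt_eqF.
rewrite mulNr oppr_lt0 divr_gt0 ?mulr_gt0 ?exprn_gt0// -sin2cos2.
by rewrite ltr_wpDl ?sqr_ge0 ?mulr_gt0 ?exprn_gt0.
Qed.

Lemma lambert_shift_inj : {in `]0, pi[ &, injective lambert_shift}.
Proof.
move=> x y x_itv y_itv shift_eq; have [xy|yx|//] := ltgtP x y.
  by have := lambert_shift_decr y_itv x_itv xy; rewrite shift_eq ltxx.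
by have := lambert_shift_decr x_itv y_itv yx; rewrite shift_eq ltxx.
Qed.

Lemma lambert_shift1_gt0 : 0 < lambert_shift 1.
Proof.
have s0 : 0 < sin 1 :> R by rewrite sin_gt0_pi// gtr0_lt_pihalf_itv// pihalf_gt1.
have c0 := @cos1_gt0 R.
have ln_sinV_le : - ln (sin 1) <= (sin 1)^-1 - 1 :> R.
  rewrite -lnV ?posrE//; have := @le_ln1Dx R ((sin 1)^-1 - 1).
  by rewrite subrKC; apply; rewrite ltrBDl subrr invr_gt0.
have cos_sin_gt1 : 1 < cos 1 + sin 1 :> R.
  rewrite -(@ltr_pXn2r _ 2)// ?nnegrE ?addr_ge0 ?(ltW c0) ?(ltW s0)//.
  by rewrite sqrrD expr1n addrAC cos2Dsin2 ltrDl mulrn_wgt0// mulr_gt0.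
have : 0 < (cos 1 + sin 1 - 1) / sin 1 :> R by rewrite divr_gt0// subr_gt0.
have -> : (cos 1 + sin 1 - 1) / sin 1 = cos 1 / sin 1 + 1 - (sin 1)^-1 :> R.
  by field; rewrite gt_eqF.
by rewrite /lambert_shift /ln_sinc ln1 subr0 mul1r; lra.
Qed.

Lemma lambert_shift_pihalf_lt0 : lambert_shift (pi / 2) < 0.
Proof.
rewrite /lambert_shift /ln_sinc cos_pihalf sin_pihalf mulr0 mul0r add0r ln1 sub0r.
by rewrite oppr_lt0 ln_gt0 ?pihalf_gt1.
Qed.

Definition is_lambert_angle y := 1 <= y < pi / 2 /\ lambert_shift y = 0.

Lemma is_lambert_angle_itv y : is_lambert_angle y -> 0 < y < pi.
Proof.
by case=> /andP[y1 y_lt] _; rewrite gtr0_lt_pihalf_itv// (lt_le_trans ltr01).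
Qed.

Lemma is_lambert_angle_ex : exists y, is_lambert_angle y.
Proof.
have [||y y_itv y0] := @IVT R lambert_shift 1 (pi / 2) 0 (ltW pihalf_gt1).
- apply: derivable_within_continuous => y; rewrite in_itv /= => /andP[y1 y2].
  have y_itv : 0 < y < pi by have := pi_gt0 R; lra.
  by have := is_derive_lambert_shift y_itv => shift'; exact: ex_derive.
- by rewrite ge_min (ltW lambert_shift_pihalf_lt0) orbT le_max (ltW lambert_shift1_gt0).
exists y; split=> //; move: y_itv; rewrite in_itv /= => /andP[-> y2].
rewrite lt_neqAle y2 andbT; apply: contra_eqN y0 => /eqP ->.
by rewrite lt_eqF ?lambert_shift_pihalf_lt0.
Qed.

Lemma lambert_eqE t x y : t%:C + (x +i* y) + cexp (- (x +i* y)) = 0 <->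
  t + x + expR (- x) * cos y = 0 /\ y = expR (- x) * sin y.
Proof.
rewrite /cexp /= cosN sinN mulrN; split=> [[re_eq im_eq]|[re_eq im_eq]].
  by split=> //; apply/eqP; rewrite -subr_eq0 -[X in X - _]add0r im_eq.
by rewrite !addCE re_eq add0r -im_eq subrr.
Qed.

Lemma lambert_eq_upper t x y : 0 < y < pi ->
  t%:C + (x +i* y) + cexp (- (x +i* y)) = 0 -> x = ln_sinc y /\ t = - lambert_shift y.
Proof.
move=> y_itv /lambert_eqE[re_eq im_eq]; have s0 := sin_gt0_pi y_itv.
have y0 : 0 < y by case/andP: y_itv.
have expE : expR (- x) = y / sin y by rewrite {1}im_eq mulfK// gt_eqF.
have xE : x = ln_sinc y.
  by rewrite -[LHS]opprK -[- x]expRK expE ln_div ?posrE// opprB.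
split=> //; rewrite /lambert_shift -xE; move: re_eq; rewrite expE.
by rewrite [y / sin y * _]mulrAC; lra.
Qed.

End LambertCurve.

Section LambertPoint.
Variables (R : realType) (b : R).
Hypothesis b_angle : is_lambert_angle b.
Implicit Types (t x y : R) (w z : R[i]).

Definition lambert_pt : R[i] := ln_sinc b +i* b.

Local Notation a := (ln_sinc b).
Local Notation W := lambert_pt.

Let b_itv := is_lambert_angle_itv b_angle.

Lemma lambert_ptE : W = lambert_curve b +i* b.
Proof.
by case: b_angle => _ /eqP; rewrite /lambert_shift addrC addr_eq0 /lambert_pt => /eqP ->.
Qed.

Lemma lambert_pt_zero : W + cexp (- W) = 0.
Proof.
have b0 : 0 < b by case/andP: b_itv.
have s0 := sin_gt0_pi b_itv.
have expE : expR (- a) = b / sin b by rewrite opprB expRB !lnK ?posrE.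
have : 0%:C + W + cexp (- W) = 0; last by rewrite rmorph0 add0r.
apply/lambert_eqE; rewrite expE divfK ?gt_eqF// add0r; split=> //.
have [->] := lambert_ptE; rewrite /lambert_curve [b / sin b * _]mulrAC addrC subrr//.
Qed.

Lemma lambert_pt_conj_zero : W^*%C + cexp (- W^*%C) = 0.
Proof. by rewrite -rmorphN cexp_conj -rmorphD lambert_pt_zero rmorph0. Qed.

Lemma lambert_pt_Re_le0 : a <= 0.
Proof.
have [/andP[b1 b_lt] _] := b_angle; have s0 := sin_gt0_pi b_itv.
have cos_gt0 : 0 < cos b by apply: cos_gt0_pihalf; have := pihalf_gt1; lra.
have [->] := lambert_ptE; rewrite oppr_le0 divr_ge0 ?mulr_ge0 ?(ltW cos_gt0) ?(ltW s0)//.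
exact: le_trans b1.
Qed.

Lemma lambert_pt_Re_lt_Im : - a < b.
Proof.
have [/andP[b1 b_lt] _] := b_angle; have s0 := sin_gt0_pi b_itv.
have b0 : 0 < b by case/andP: b_itv.
have [pi_half1 pi_half2] := (@pihalf_gt1 R, @pihalf_lt2 R).
have cos_lt_sin : cos b < sin b.
  rewrite -cosBpihalf -[cos (b - _)]cosN opprB ltr_cos ?in_itv /=; lra.
have [->] := lambert_ptE; rewrite opprK /lambert_curve.
by rewrite ltr_pdivrMr// ltr_pM2l.
Qed.

Lemma sqr_lambert_pt_Re_lt : a ^+ 2 < b ^+ 2.
Proof.
have [a0 ab] := (lambert_pt_Re_le0, lambert_pt_Re_lt_Im).
by rewrite -[a ^+ 2]sqrrN ltr_pXn2r ?nnegrE//; lra.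
Qed.

Lemma normc_lambert_pt_lt_pi : normc W < pi.
Proof.
have [/andP[b1 b_lt] _] := b_angle; have p0 := pi_gt0 R.
rewrite -(@ltr_pXn2r _ 2) ?nnegrE ?normc_ge0 ?(ltW p0)// sqr_normc_ReIm /=.
have b2 : b ^+ 2 < (pi / 2) ^+ 2 by rewrite ltr_pXn2r ?nnegrE//; lra.
have := sqr_lambert_pt_Re_lt; rewrite exprMn in b2.
by have := exprn_gt0 2 p0; lra.
Qed.

(* Along the zeros of t + z + e^-z in the upper half plane, Im z determines Re z
   and t, and both |z| and t increase with Im z. *)
Lemma lambert_zero_upper t z : 0 <= t -> 0 < complex.Im z -> normc z <= normc W ->
  t%:C + z + cexp (- z) = 0 -> t = 0 /\ z = W.
Proof.
move=> t0 + z_le.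
have z_le2 : complex.Re z ^+ 2 + complex.Im z ^+ 2 <= a ^+ 2 + b ^+ 2.
  by rewrite -sqr_normc_ReIm -(sqr_normc_ReIm W) lerXn2r ?nnegrE ?normc_ge0.
have : complex.Im z < pi.
  apply: le_lt_trans (le_trans (ler_norm _) (ler_Im_normc z)) _.
  exact: le_lt_trans z_le normc_lambert_pt_lt_pi.
case: z z_le2 {z_le} => x y /= z_le2 y_pi y0 z_zero.
have y_itv : 0 < y < pi by rewrite y0.
have [xE tE] := lambert_eq_upper y_itv z_zero.
have [_ shift0] := b_angle; have [b0 b_pi] := andP b_itv.
suff yb : y = b by rewrite tE xE yb shift0 oppr0.
have [yb|by_|//] := ltgtP y b.
  by have := lambert_shift_decr b_itv y_itv yb; lra.
have xa : x < a by rewrite xE; exact: ln_sinc_decr.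
have a2 : a ^+ 2 < x ^+ 2.
  have a0 := lambert_pt_Re_le0; rewrite -[a ^+ 2]sqrrN -[x ^+ 2]sqrrN ltr_pXn2r ?nnegrE//; lra.
have b2 : b ^+ 2 < y ^+ 2 by rewrite ltr_pXn2r ?nnegrE ?ltW.
lra.
Qed.

Lemma lambert_zero_unique t z : 0 <= t -> normc z <= normc W ->
  t%:C + z + cexp (- z) = 0 -> t = 0 /\ (z = W \/ z = W^*%C).
Proof.
move=> t0 z_le z_zero; have [Im_lt0|Im_gt0|Im0] := ltgtP (complex.Im z) 0.
- have [||||-> zE] := @lambert_zero_upper t z^*%C.
  + exact: t0.
  + by case: (z) Im_lt0 => x y /=; rewrite oppr_gt0.
  + by rewrite normc_conj.
  + rewrite -[t%:C]conjc_real -rmorphN cexp_conj -!rmorphD z_zero; exact: rmorph0.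
  by split=> //; right; rewrite -zE conjcK.
- by have [//|//|//|//|-> ->] := @lambert_zero_upper t z; split=> //; left.
exfalso; case: z Im0 z_zero {z_le} => x y y0 /lambert_eqE[+ _].
by rewrite (y0 : y = 0) cos0 mulr1; have := expR_ge1Dx (- x); lra.
Qed.

End LambertPoint.

Section LambertBranches.
Variables (R : realType) (b : R).
Hypothesis b_angle : is_lambert_angle b.
Implicit Types (x y : R) (w : R[i]).

Local Notation W := (lambert_pt b).

Let b_itv := is_lambert_angle_itv b_angle.

Lemma mul_cexp_eqN1 w : w * cexp w = -1 <-> w + cexp (- w) = 0.
Proof.
have cexpK : cexp w * cexp (- w) = 1 by rewrite -cexpD subrr cexp0.
split=> [wE|/eqP].
  have {1}-> : w = - cexp (- w) by rewrite -[LHS]mulr1 -cexpK mulrA wE mulN1r.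
  by rewrite addNr.
by rewrite addr_eq0 => /eqP wE; rewrite {1}wE mulNr mulrC cexpK.
Qed.

(* The solutions of w e^w = -1 lie on the curve that bounds the range of the
   principal branch. *)
Lemma mul_cexp_eqN1_curve x y : (x +i* y) * cexp (x +i* y) = -1 ->
  [/\ y != 0, x = lambert_curve y & y = expR (- x) * sin y].
Proof.
move=> /mul_cexp_eqN1 w_zero.
have /lambert_eqE[] : 0%:C + (x +i* y) + cexp (- (x +i* y)) = 0.
  by rewrite rmorph0 add0r.
rewrite add0r => re_eq im_eq.
have y_neq0 : y != 0.
  apply/eqP => y0; move: re_eq; rewrite y0 cos0 mulr1.
  by have := expR_ge1Dx (- x); lra.
have sin_neq0 : sin y != 0.
  by apply: contra y_neq0 => /eqP sin0; rewrite im_eq sin0 mulr0.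
split=> //; rewrite /lambert_curve {1}im_eq [_ * sin y * _]mulrAC mulfK//.
by apply/eqP; rewrite -subr_eq0 opprK re_eq.
Qed.

Lemma mul_cexp_eqN1_upper x y : 0 < y < pi ->
  (x +i* y) * cexp (x +i* y) = -1 -> x +i* y = W.
Proof.
move=> y_itv /mul_cexp_eqN1 w_zero.
have [|xE shift0] := @lambert_eq_upper R 0 x y y_itv; first by rewrite rmorph0 add0r.
rewrite /lambert_pt xE; suff -> : y = b by [].
apply: lambert_shift_inj => //; case: b_angle => _ ->.
by apply/eqP; rewrite -oppr_eq0 -shift0.
Qed.

Lemma mul_cexp_eqN1_lower x y : 0 < - y < pi ->
  (x +i* y) * cexp (x +i* y) = -1 -> x +i* y = W^*%C.
Proof.
move=> y_itv w_sol; rewrite -(mul_cexp_eqN1_upper (x := x) y_itv) /= ?opprK//.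
by rewrite -[x -i* y]/((x +i* y)^*%C) cexp_conj -rmorphM w_sol rmorphN1.
Qed.

Lemma lambert_pt_sol : W * cexp W = -1.
Proof. exact/mul_cexp_eqN1/lambert_pt_zero. Qed.

Lemma lambert_pt_conj_sol : W^*%C * cexp W^*%C = -1.
Proof. exact/mul_cexp_eqN1/lambert_pt_conj_zero. Qed.

Lemma lambertW0_N1 : lambertW 0 (-1) = W.
Proof.
have [b0 b_pi] := andP b_itv.
apply: xget_unique => [|[x y] [w_sol [not_above not_below]]].
  split; first exact: lambert_pt_sol.
  rewrite lambert_ptE//; split; last left; rewrite /lambert_above /lambert_below /=.
    by rewrite mul1r mul0r => -[|[_]]; [rewrite leNgt b_pi | rewrite ltxx].
  by rewrite mul1r mul0r oppr0 => -[|[/andP[_]]|[_]]; lra.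
have [y_neq0 xE _] := mul_cexp_eqN1_curve w_sol.
apply: mul_cexp_eqN1_upper => //; apply/andP; split; last first.
  by rewrite ltNge; apply/negP => y_pi; apply: not_above; left; rewrite /= mul1r.
rewrite lt_neqAle eq_sym y_neq0 /= leNgt; apply/negP => y_lt0.
case: not_below => [not_below|[_ /eqP]]; last by rewrite oppr0 (negbTE y_neq0).
apply: not_below; rewrite /lambert_below /= mul1r mul0r oppr0.
by have [y_le|y_gt] := leP y (- pi); [apply: Or31 | apply: Or32; rewrite y_lt0 -xE].
Qed.

Lemma lambertWN1_N1 : lambertW (-1) (-1) = W^*%C.
Proof.
have [b0 b_pi] := andP b_itv; have p0 := pi_gt0 R.
apply: xget_unique => [|[x y] [w_sol [below0 not_below1]]].
  split; first exact: lambert_pt_conj_sol.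
  rewrite lambert_ptE//; split; rewrite /lambert_below /= ?mul1r ?mul0r ?oppr0.
    apply: Or32; rewrite ltrN2 b_pi oppr_lt0 b0 /lambert_curve cosN sinN.
    by rewrite mulNr invrN mulrN mulNr opprK.
  by rewrite -[1.*2.+1]/3%N -[1.*2]/2%N => -[|[/andP[_]]|[]//]; lra.
have [y_neq0 xE im_eq] := mul_cexp_eqN1_curve w_sol.
apply: mul_cexp_eqN1_lower => //.
have y_lt0 : y < 0.
  case: below0 => /= [|[/andP[_]]|[_ y0]]; rewrite ?mul1r ?mul0r ?oppr0//; first lra.
  by move: y_neq0; rewrite y0 eqxx.
rewrite oppr_gt0 y_lt0 /= ltNge; apply/negP => y_le.
have sin_lt0 : sin y < 0 by rewrite -(pmulr_rlt0 _ (expR_gt0 (- x))) -im_eq.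
have y_ge : - (2 * pi) <= y.
  rewrite leNgt; apply/negP => y_lt; apply: not_below1.
  rewrite /lambert_below /= -[1.*2.+1]/3%N -[1.*2]/2%N.
  have [y_le3|y_gt3] := leP y (- (3 * pi)); [exact: Or31 | apply: Or32].
  by rewrite y_lt -xE.
suff : 0 <= sin y by lra.
by rewrite -sinD2pi sin_ge0_pi// -mulr_natl; apply/andP; split; lra.
Qed.

End LambertBranches.

Section ConjugateQuadratic.
Variable R : realType.
Implicit Types (al be e : R) (w z : R[i]).

Definition conj_quad z : fps R[i] := (fpsX - fpsC z) * (fpsX - fpsC z^*%C).

Lemma conj_quadE z : conj_quad z =
  fpsX ^+ 2 - fpsC (2 * complex.Re z)%:C * fpsX + fpsC (normc z ^+ 2)%:C.
Proof.
have -> : (2 * complex.Re z)%:C = z + z^*%C :> R[i] by rewrite addcJ rmorphM rmorph_nat.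
have -> : (normc z ^+ 2)%:C = z * z^*%C :> R[i] by rewrite rmorphXn -sqr_normc.
by rewrite /conj_quad rmorphD rmorphM; ring.
Qed.

Lemma subc_conj_neq0 z : complex.Im z != 0 -> z - z^*%C != 0.
Proof.
case: z => x y /= y_neq0; rewrite -normc_gt0 /= subrr expr0n add0r sqrtr_sqr.
by rewrite normr_gt0 opprK -mulr2n mulrn_eq0.
Qed.

Lemma normc_subc_conj z : 0 <= complex.Im z -> normc (z - z^*%C) = 2 * complex.Im z.
Proof.
case: z => x y /= y0; rewrite subrr expr0n add0r sqrtr_sqr opprK -mulr2n.
by rewrite ger0_norm ?mulrn_wge0// mulr_natl.
Qed.

Lemma linear_factor_inv z : 1 < normc z ->
  exists2 v : fps R[i], (fpsX - fpsC z) * v = 1 & l1_le v (normc z - 1)^-1.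
Proof.
move=> z1; have z0 : 0 < normc z by exact: lt_trans z1.
have zE : fpsC z * fpsC z^-1 = 1 :> fps R[i].
  by rewrite -rmorphM divff ?rmorph1 -?normc_gt0.
have [||v vE v_le] := @l1_le_neumann _ (fpsC z^-1 * fpsX) (normc z)^-1; last 1 first.
- exists (fpsC (- z^-1) * v); first by rewrite -[RHS]vE -[in RHS]zE rmorphN; ring.
  have := l1_leCM (- z^-1) v_le; rewrite normcN normcV; congr l1_le.
  by field; rewrite !lt0r_neq0 ?subr_gt0.
- by have := l1_leCM z^-1 (l1_leXM (@l1_le1 R)); rewrite mulr1 normcV mulr1.
- by rewrite invf_lt1.
Qed.

Lemma conj_quad_inv z : 1 < normc z -> 0 < complex.Im z ->
  exists2 v : fps R[i], conj_quad z * v = 1 & l1_le v (complex.Im z * (normc z - 1))^-1.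
Proof.
move=> z1 Im_z.
have [u uE u_le] := linear_factor_inv z1.
have [|v vE v_le] := @linear_factor_inv z^*%C; first by rewrite normc_conj.
exists (fpsC (z - z^*%C)^-1 * (u - v)).
  transitivity (fpsC (z - z^*%C)^-1 * ((fpsX - fpsC z^*%C) * ((fpsX - fpsC z) * u) -
    (fpsX - fpsC z) * ((fpsX - fpsC z^*%C) * v))); first by rewrite /conj_quad; ring.
  rewrite uE vE !mulr1.
  have -> : fpsX - fpsC z^*%C - (fpsX - fpsC z) = fpsC (z - z^*%C) by rewrite rmorphB; ring.
  rewrite -rmorphM.
  by rewrite mulVf ?rmorph1// subc_conj_neq0 ?gt_eqF.
have := l1_leCM (z - z^*%C)^-1 (l1_leB u_le v_le).
rewrite normcV normc_subc_conj ?ltW// normc_conj; congr l1_le.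
by field; rewrite !lt0r_neq0 ?subr_gt0.
Qed.

Lemma conj_quad_add_linear w z al be e : normc w = 1 -> e < 1 ->
  complex.Re z = complex.Re w - e * al / (2 * (1 - e)) ->
  normc z ^+ 2 = 1 + e * be / (1 - e) ->
  fpsC (1 - e)%:C * conj_quad w + fpsC e%:C * (fpsC al%:C * fpsX + fpsC be%:C) =
  fpsC (1 - e)%:C * conj_quad z.
Proof.
move=> w1 e1 Re_z normc_z; have e1_neq0 : 1 - e != 0 by rewrite subr_eq0 gt_eqF.
rewrite !conj_quadE w1 expr1n.
have coef1E : fpsC (1 - e)%:C * fpsC (2 * complex.Re z)%:C =
    fpsC (1 - e)%:C * fpsC (2 * complex.Re w)%:C - fpsC e%:C * fpsC al%:C :> fps R[i].
  by rewrite -!rmorphM -!rmorphB; congr (fpsC _%:C); rewrite Re_z; field.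
have coef0E : fpsC (1 - e)%:C * fpsC (normc z ^+ 2)%:C =
    fpsC (1 - e)%:C + fpsC e%:C * fpsC be%:C :> fps R[i].
  by rewrite -!rmorphM -!rmorphD; congr (fpsC _%:C); rewrite normc_z; field.
rewrite rmorph1; move: coef1E coef0E; move: (fpsC (1 - e)%:C) (fpsC e%:C) => S E.
move: (fpsC (2 * complex.Re z)%:C) (fpsC (2 * complex.Re w)%:C) (fpsC (normc z ^+ 2)%:C).
move: (fpsC al%:C) (fpsC be%:C) => A B P1 P2 C coef1E coef0E.
by rewrite [RHS]mulrDr mulrBr !mulrA coef1E coef0E; ring.
Qed.

Lemma sqr_perturb_le (p al e : R) : `|p| <= 1 -> 0 < e <= 2^-1 ->
  (p - e * al / (2 * (1 - e))) ^+ 2 <= p ^+ 2 + e * (2 * `|al| + al ^+ 2).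
Proof.
move=> p1 /andP[e0 e_le]; have e1 : 0 < 1 - e by lra.
set x := p - _; have x_le : `|x| <= `|p| + e * `|al|.
  apply: le_trans (ler_normB _ _) _.
  rewrite lerD2l !normrM normfV [`|2 * _|]gtr0_norm ?mulr_gt0// (gtr0_norm e0).
  rewrite ler_pdivrMr ?mulr_gt0// ler_peMr ?mulr_ge0 ?(ltW e0)//; lra.
have : `|x| ^+ 2 <= (`|p| + e * `|al|) ^+ 2.
  by rewrite lerXn2r ?nnegrE ?addr_ge0 ?mulr_ge0 ?(ltW e0).
rewrite sqrrD !real_normK ?num_real// exprMn real_normK ?num_real//.
have := ler_wpM2r (mulr_ge0 (ltW e0) (normr_ge0 al)) p1.
have eal2_ge0 := mulr_ge0 (ltW e0) (sqr_ge0 al).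
by have := ler_wpM2r eal2_ge0 e_le; lra.
Qed.

Lemma sqr_ge_sub1_ge (n d be : R) : 0 <= n -> 0 < d -> 0 < be ->
  1 + d <= n ^+ 2 <= 1 + be -> d / (2 + be) <= n - 1.
Proof.
move=> n0 d0 be0 /andP[n2_ge n2_le].
have n_ge1 : 1 <= n by rewrite -(@ler_pXn2r _ 2) ?nnegrE// expr1n; lra.
have n_le : n <= 1 + be by apply: le_trans n2_le; rewrite expr2 ler_peMl.
rewrite ler_pdivrMr ?addr_gt0//.
apply: (@le_trans _ _ ((n - 1) * (n + 1))); first by rewrite -subr_sqr expr1n; lra.
by rewrite ler_wpM2l; lra.
Qed.

(* Adding e (al X + be) with be > 0 pushes the roots of the quadratic out of the
   unit disc at a speed proportional to e and keeps them away from each other. *)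
Lemma conj_quad_perturb w al be : normc w = 1 -> 0 < complex.Im w -> 0 < be ->
  exists d e0 : R, [/\ 0 < d, 0 < e0 < 1 & forall e, 0 < e <= e0 -> exists z,
    [/\ fpsC (1 - e)%:C * conj_quad w + fpsC e%:C * (fpsC al%:C * fpsX + fpsC be%:C) =
          fpsC (1 - e)%:C * conj_quad z,
        d <= complex.Im z & d * e <= normc z - 1]].
Proof.
move=> w1 Im_w be0; set r := complex.Im w in Im_w *; set p := complex.Re w.
have prE : p ^+ 2 + r ^+ 2 = 1 by rewrite -sqr_normc_ReIm w1 expr1n.
have p_le1 : `|p| <= 1 by rewrite -w1 ler_Re_normc.
have r20 : 0 < r ^+ 2 by rewrite exprn_gt0.
pose D := 2 * (2 * `|al| + al ^+ 2 + 1).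
have D0 : 0 < D by have := normr_ge0 al; have := sqr_ge0 al; rewrite /D; lra.
exists (Num.min (r / 2) (be / (2 + be))), (Num.min 2^-1 (r ^+ 2 / D)); split.
- by rewrite lt_min !divr_gt0// addr_gt0.
- by rewrite lt_min invr_gt0 ltr0n divr_gt0//= gt_min invf_lt1 ?ltr1n.
move=> e /andP[e0]; rewrite le_min => /andP[e_le eD].
have e1 : 0 < 1 - e by lra.
pose x := p - e * al / (2 * (1 - e)); pose c := 1 + e * be / (1 - e).
have x2_le : x ^+ 2 <= 1 - r ^+ 2 / 2.
  have := sqr_perturb_le al p_le1 (introT andP (conj e0 e_le)).
  by move: eD; rewrite ler_pdivlMr// /D -/x; lra.
have ebe0 : 0 < e * be by rewrite mulr_gt0.
have c_ge : 1 + e * be <= c by rewrite lerD2l ler_pdivlMr// ler_piMr ?ltW//; lra.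
have c_le : c <= 1 + be by rewrite lerD2l ler_pdivrMr// mulrC ler_pM2l//; lra.
pose y := Num.sqrt (c - x ^+ 2).
have y2E : y ^+ 2 = c - x ^+ 2 by rewrite sqr_sqrtr//; lra.
have z2E : normc (x +i* y) ^+ 2 = c by rewrite sqr_normc_ReIm /= y2E addrC subrK.
exists (x +i* y); split.
- by apply: conj_quad_add_linear => //; rewrite -subr_gt0.
- rewrite ge_min -(@ler_pXn2r _ 2) ?nnegrE ?sqrtr_ge0 ?divr_ge0 ?(ltW Im_w)// y2E.
  by rewrite expr_div_n; apply/orP; left; lra.
apply: le_trans (sqr_ge_sub1_ge (normc_ge0 (x +i* y)) ebe0 be0 _); last by rewrite z2E c_ge.
by rewrite -mulrA [leRHS]mulrC ler_wpM2r ?(ltW e0)// ge_min lexx orbT.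
Qed.

End ConjugateQuadratic.

Section SimpleConjugateZeros.
Variable R : realType.
Implicit Types (al be e : R) (f g h r k : fps R[i]) (w x z : R[i]).

Lemma conj_quad_perturb_inv w al be : normc w = 1 -> 0 < complex.Im w -> 0 < be ->
  exists C e0 : R, [/\ 0 <= C, 0 < e0 < 1 & forall e, 0 < e <= e0 ->
    exists2 v : fps R[i], (fpsC (1 - e)%:C * conj_quad w +
                fpsC e%:C * (fpsC al%:C * fpsX + fpsC be%:C)) * v = 1
             & l1_le v (C / e)].
Proof.
move=> w1 Im_w be0.
have [d [e0 [d0 /andP[e00 e01] root]]] := conj_quad_perturb al w1 Im_w be0.
exists ((1 - e0)^-1 / d ^+ 2), e0; split.
- by rewrite mulr_ge0 ?invr_ge0 ?sqr_ge0// subr_ge0 ltW.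
- by rewrite e00.
move=> e /[dup] /andP[e_gt0 e_le] /root[z [-> d_le de_le]].
have de0 : 0 < d * e by rewrite mulr_gt0.
have n1 : 0 < normc z - 1 by exact: lt_le_trans de_le.
have Im_z : 0 < complex.Im z by exact: lt_le_trans d_le.
have [v zv v_le] : exists2 v : fps R[i], conj_quad z * v = 1 &
    l1_le v (complex.Im z * (normc z - 1))^-1.
  by apply: conj_quad_inv => //; rewrite -subr_gt0.
have e1 : 0 < 1 - e by rewrite subr_gt0 (le_lt_trans e_le).
exists (fpsC (1 - e)%:C^-1 * v).
  by rewrite mulrACA -rmorphM zv mulr1 divff ?rmorph1// -normc_gt0 normc_real gtr0_norm.
apply: l1_le_trans (l1_leCM _ v_le) _.
rewrite normcV normc_real gtr0_norm// -mulrA.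
rewrite ler_pM ?invr_ge0 ?mulr_ge0 ?(ltW e1) ?(ltW Im_z) ?(ltW n1)//.
  by rewrite lef_pV2 ?posrE// ?subr_gt0// lerD2l lerN2.
rewrite -invfM lef_pV2 ?posrE ?mulr_gt0 ?exprn_gt0// expr2 -mulrA.
by rewrite ler_pM ?(ltW d0) ?(ltW de0).
Qed.

Lemma real_linear_interpolation w z : complex.Im w != 0 ->
  exists al be : R, al%:C * w + be%:C = z /\ be * complex.Im w = complex.Im (w * z^*%C).
Proof.
case: w z => [p r] [x y] /= r0; exists (y / r), (x - y / r * p).
split; last by field.
by rewrite mulCE addCE; congr (_ +i* _); field.
Qed.

Lemma ev_sub_root w x : normc x <= 1 -> ev (fpsX - fpsC w) x = x - w.
Proof. by move=> x1; rewrite evB ?abs_summableX ?abs_summableC// evX evC. Qed.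

Lemma ev_linear (u v : R[i]) x : normc x <= 1 ->
  ev (fpsC u * fpsX + fpsC v) x = u * x + v.
Proof.
move=> x1; have sC := @abs_summableC R; have sX := @abs_summableX R.
by rewrite (evD x1 (rpredM (sC u) sX) (sC v)) (evM x1 (sC u) sX) !evC evX.
Qed.

Lemma entire_linear (u v : R[i]) : fpsC u * fpsX + fpsC v \in entire.
Proof. by rewrite rpredD ?rpredM ?entireC ?entireX. Qed.

Lemma entire_sub_root w : fpsX - fpsC w \in entire.
Proof. by rewrite rpredB ?entireX ?entireC. Qed.

Lemma entire_conj_quad w : conj_quad w \in entire.
Proof. by rewrite rpredM ?entire_sub_root. Qed.

Lemma conj_quad_conj w : conj_quad w^*%C = conj_quad w.
Proof. by rewrite /conj_quad conjcK mulrC. Qed.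

Lemma entire_div_conj_quad f w : f \in entire -> normc w <= 1 -> complex.Im w != 0 ->
  ev f w = 0 -> ev f w^*%C = 0 -> exists2 g : fps R[i], g \in entire & f = conj_quad w * g.
Proof.
move=> ef w1 Im_w fw0 fwc0; have wc1 : normc w^*%C <= 1 by rewrite normc_conj.
have [g eg fE] := entire_div_root ef w1 fw0.
have gwc0 : ev g w^*%C = 0.
  have sX := entire_summable (entire_sub_root w).
  have /eqP := fwc0; rewrite fE (evM wc1 sX (entire_summable eg)) ev_sub_root//.
  rewrite mulf_eq0 -oppr_eq0 opprB (negbTE (subc_conj_neq0 Im_w)) => /eqP//.
have [k ek gE] := entire_div_root eg wc1 gwc0.
by exists k => //; rewrite fE gE mulrA.
Qed.

Lemma ev_euler_conj_quad w g : normc w <= 1 -> g \in entire ->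
  ev (fps_euler (conj_quad w * g)) w = w * ((w - w^*%C) * ev g w).
Proof.
move=> w1 eg; have eX := entire_sub_root w^*%C.
have eXg : (fpsX - fpsC w^*%C) * g \in entire by exact: rpredM.
rewrite (ev_euler_root w1 eXg (esym (mulrA _ _ _))).
by rewrite (evM w1 (entire_summable eX) (entire_summable eg)) ev_sub_root.
Qed.

(* The inverse r of g is l modulo q, so that e + (1 - e) q g is g times
   (1 - e) q + e l up to a relative error of order e. *)
Lemma perturb_mul_approx_inv (A : comNzRingType) (e q g l r k v : A) :
  g * r = 1 -> r = l + q * k -> ((1 - e) * q + e * l) * v = 1 ->
  (e + (1 - e) * (q * g)) * ((1 - e) * (r * v)) = 1 - e * (1 - k + e * (l * k * v)).
Proof.
move=> gr rE qv.
transitivity ((1 - e) * v * (e * r + (1 - e) * q * (g * r))); first by ring.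
rewrite gr mulr1 rE.
transitivity ((1 - e) * (((1 - e) * q + e * l) * v) +
  e * k * (((1 - e) * q + e * l) * v - e * l * v)); first by ring.
by rewrite qv; ring.
Qed.

Lemma conj_quad_mul_resolvent w al be g r k : normc w = 1 -> 0 < complex.Im w ->
  0 < be -> g * r = 1 -> r = fpsC al%:C * fpsX + fpsC be%:C + conj_quad w * k ->
  r \in abs_summable -> k \in abs_summable ->
  exists C e0 : R, [/\ 0 <= C, 0 < e0 < 1 & forall e, 0 < e <= e0 ->
    exists2 v : fps R[i], (fpsC e%:C + fpsC (1 - e)%:C * (conj_quad w * g)) * v = 1
             & l1_le v (C / e)].
Proof.
move=> w1 Im_w be0 gr rE /abs_summableP[Mr rM] sk.
pose lin : fps R[i] := fpsC al%:C * fpsX + fpsC be%:C.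
have /abs_summableP[Ml lkM] : lin * k \in abs_summable.
  by rewrite !(rpredM, rpredD) ?abs_summableC ?abs_summableX.
move: (sk) => /abs_summableP[Mk kM].
have [C [e0 [C0 /andP[e00 e01] quad_inv]]] := conj_quad_perturb_inv al w1 Im_w be0.
have Mr0 := l1_le_ge0 rM; have Mk0 := l1_le_ge0 kM; have Ml0 := l1_le_ge0 lkM.
pose D := 1 + Mk + Ml * C.
have D0 : 0 < D by rewrite /D -addrA ltr_wpDr// addr_ge0 ?mulr_ge0.
exists (2 * (Mr * C)), (Num.min e0 (2 * D)^-1); split.
- by rewrite !mulr_ge0.
- by rewrite lt_min e00 invr_gt0 mulr_gt0//= gt_min e01.
move=> e /andP[e_gt0]; rewrite le_min => /andP[e_le eD].
have e1 : 0 < 1 - e by rewrite subr_gt0 (le_lt_trans e_le).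
have [v quad_v v_le] := quad_inv e (introT andP (conj e_gt0 e_le)).
pose err : fps R[i] := fpsC e%:C * (1 - k + fpsC e%:C * (lin * k * v)).
have approx_inv : (fpsC e%:C + fpsC (1 - e)%:C * (conj_quad w * g)) *
    (fpsC (1 - e)%:C * (r * v)) = 1 - err.
  have sE : fpsC (1 - e)%:C = 1 - fpsC e%:C :> fps R[i] by rewrite !rmorphB !rmorph1.
  by rewrite sE in quad_v *; exact: perturb_mul_approx_inv gr rE quad_v.
have err_le : l1_le err 2^-1.
  have eE : normc e%:C = e by rewrite normc_real gtr0_norm.
  have := l1_leCM e%:C (l1_leD (l1_leB (@l1_le1 R) kM) (l1_leCM e%:C (l1_leM lkM v_le))).
  rewrite eE => /l1_le_trans; apply.
  rewrite [e * (Ml * _)]mulrCA [e * (C / e)]mulrC divfK ?gt_eqF// -/D.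
  by rewrite -ler_pdivlMr// -invfM.
have [|u err_u u_le] := l1_le_neumann err_le; first by rewrite invf_lt1 ?ltr1n.
exists (fpsC (1 - e)%:C * (r * v) * u); first by rewrite mulrA approx_inv.
have s_le := l1_leCM (1 - e)%:C (l1_leM rM v_le).
apply: l1_le_trans (l1_leM s_le u_le) _.
rewrite normc_real gtr0_norm// (_ : (1 - 2^-1)^-1 = 2); last by field.
rewrite mulrC -[leRHS]mulrA -[Mr * C / e]mulrA ler_wpM2l// ler_piMl ?gerBl ?(ltW e_gt0)//.
by rewrite !mulr_ge0 ?invr_ge0 ?(ltW e_gt0).
Qed.

End SimpleConjugateZeros.

Lemma segment_locally_bounded (R : realType) (a b : R) (P : R -> R -> Prop) :
  (forall C C' s, C <= C' -> P s C -> P s C') ->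
  (forall s0, a <= s0 <= b -> exists C d, 0 < d /\
     forall s, a <= s <= b -> `|s - s0| < d -> P s C) ->
  exists C, forall s, a <= s <= b -> P s C.
Proof.
move=> P_incr P_loc.
have := @segment_compact R a b => /compact_near_coveringP/near_covering_withinP.
move=> /(_ R +oo%R (fun C s => P s C) _)[s0|C [_ P_C]].
  rewrite /= in_itv /= => /P_loc[C [d [d0 P_near]]].
  exists (ball s0 d, [set x | C <= x]).
    by split; [exact: nbhsx_ballx | apply: nbhs_pinfty_ge; exact: num_real].
  move=> [s C'] [/= s_near CC']; rewrite in_itv /= => s_itv.
  by apply: P_incr CC' (P_near _ s_itv _); rewrite distrC.
exists (C + 1) => s s_itv; apply: P_C; first by rewrite ltrDl.
by rewrite /= in_itv.
Qed.

Section ResolventBound.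
Variable R : realType.
Implicit Types (C d e s t : R) (g k : fps R[i]) (x z : R[i]).

(* As w z^* E^* = w^* - w, the imaginary part of w z^* is - 2 Im w Re E / |E|^2. *)
Lemma Im_mul_conj_gt0 (w z E : R[i]) : normc w = 1 -> 0 < complex.Im w ->
  z * E = w * (w - w^*%C) -> complex.Re E < 0 -> 0 < complex.Im (w * z^*%C).
Proof.
move=> w1 Im_w zE Re_E.
have wwc : w * w^*%C = 1 by rewrite -sqr_normc normcE_complex w1 expr1n.
have : (w * z^*%C) * E^*%C = w^*%C - w.
  by rewrite -mulrA -conjcM zE conjcM mulrA wwc mul1r conjcB conjcK.
move: (w * z^*%C) => u {zE wwc w1}.
case: u E w Re_E Im_w => [u1 u2] [e1 e2] [p r] /= Re_E r0.
move=> /[dup] /(congr1 (@complex.Re R)) /= re_eq /(congr1 (@complex.Im R)) /= im_eq.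
have u2E : u2 * (e1 ^+ 2 + e2 ^+ 2) = - (2 * r * e1).
  transitivity (e1 * (u1 * - e2 + u2 * e1) + e2 * (u1 * e1 - u2 * - e2)); first by ring.
  by rewrite re_eq im_eq; ring.
have e12 : 0 < e1 ^+ 2 + e2 ^+ 2.
  by rewrite ltr_wpDr ?sqr_ge0// -sqrrN exprn_gt0// oppr_gt0.
rewrite -(pmulr_lgt0 _ e12) u2E oppr_gt0 nmulr_llt0// mulr_gt0//.
Qed.

Variables (h : fps R[i]) (w : R[i]).
Hypotheses (h_entire : h \in entire) (h_real : forall n, (h n)^*%C = h n).
Hypotheses (w1 : normc w = 1) (Im_w : 0 < complex.Im w).
Hypothesis h_zero : ev h w = 0.
Hypothesis h_zeros : forall t x, 0 <= t -> normc x <= 1 -> t%:C + ev h x = 0 ->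
  t = 0 /\ (x = w \/ x = w^*%C).
Hypothesis h_outward : complex.Re (ev (fps_euler h) w) < 0.

Let w_le1 : normc w <= 1. Proof. by rewrite w1. Qed.
Let wc_le1 : normc w^*%C <= 1. Proof. by rewrite normc_conj. Qed.
Let sh := entire_summable h_entire.

Let conj_sub_w : w^*%C - w != 0.
Proof. by rewrite -oppr_eq0 opprB subc_conj_neq0 ?gt_eqF. Qed.

Let h_euler_neq0 : ev (fps_euler h) w != 0.
Proof. by apply: contraTneq h_outward => ->; rewrite ltxx. Qed.

Let ev_h_conj x : normc x <= 1 -> ev h x^*%C = (ev h x)^*%C.
Proof. by move=> x1; exact: ev_conj. Qed.

Lemma zero_quotient_ex : exists2 g, g \in entire & h = conj_quad w * g.
Proof.
apply: (entire_div_conj_quad h_entire w_le1 _ h_zero); first by rewrite gt_eqF.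
by rewrite ev_h_conj// h_zero rmorph0.
Qed.

Lemma zero_quotient_conj g : g \in entire -> h = conj_quad w * g ->
  ev g w^*%C = (ev g w)^*%C.
Proof.
move=> eg hE; have euler_w := ev_euler_conj_quad w_le1 eg.
have := ev_euler_conj_quad wc_le1 eg; rewrite conj_quad_conj conjcK -hE.
have euler_h_real n : (fps_euler h n)^*%C = fps_euler h n by rewrite rmorphMn /= h_real.
rewrite (ev_conj euler_h_real)// ?entire_summable ?entire_euler//.
rewrite hE euler_w !conjcM conjcB conjcK.
have wc_neq0 : w^*%C != 0 by rewrite -normc_gt0 normc_conj w1.
by move=> /(mulfI wc_neq0)/(mulfI conj_sub_w)->.
Qed.

Lemma zero_quotient_neq0 g x : g \in entire -> h = conj_quad w * g -> normc x <= 1 ->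
  ev g x != 0.
Proof.
move=> eg hE x1; apply: contraNneq h_euler_neq0 => gx0.
have euler_w : ev g w = 0 -> ev (fps_euler h) w = 0.
  by rewrite hE ev_euler_conj_quad// => ->; rewrite !mulr0.
have hx0 : 0%:C + ev h x = 0.
  rewrite rmorph0 add0r hE (evM x1 _ (entire_summable eg)) ?gx0 ?mulr0//.
  exact/entire_summable/entire_conj_quad.
have [_ [xE|xE]] := h_zeros (lexx 0) x1 hx0; rewrite xE in gx0.
  exact/eqP/euler_w.
by apply/eqP/euler_w/eqP; rewrite -conjc_eq0 -(zero_quotient_conj eg hE) gx0.
Qed.

Lemma resolvent_near1 : exists C e0, [/\ 0 <= C, 0 < e0 < 1 & forall e, 0 < e <= e0 ->
  exists2 v : fps R[i], (fpsC e%:C + fpsC (1 - e)%:C * h) * v = 1 & l1_le v (C / e)].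
Proof.
have [g eg hE] := zero_quotient_ex.
have sg := entire_summable eg; have g_neq0 x (x1 : normc x <= 1) := zero_quotient_neq0 eg hE x1.
have [r gr sr] : exists2 r : fps R[i], g * r = 1 & r \in abs_summable.
  have eg1 := entire_euler eg; have eg2 := entire_euler eg1.
  exact: wiener_inverse sg (entire_summable eg1) (entire_summable eg2) g_neq0.
have [al [be [interp beE]]] := real_linear_interpolation (ev g w)^-1 (lt0r_neq0 Im_w).
have be0 : 0 < be.
  rewrite -(pmulr_lgt0 _ Im_w) beE; apply: (Im_mul_conj_gt0 w1 Im_w _ h_outward).
  by rewrite hE (ev_euler_conj_quad w_le1 eg) [_ * ev g w]mulrC mulrCA mulKf ?g_neq0.
pose lin : fps R[i] := fpsC al%:C * fpsX + fpsC be%:C.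
have e_lin : lin \in entire by exact: entire_linear.
have e_defect : 1 - lin * g \in entire by exact: rpredB (rpred1 _) (rpredM e_lin eg).
have ev_defect x : normc x <= 1 -> ev (1 - lin * g) x = 1 - (al%:C * x + be%:C) * ev g x.
  move=> x1; have sl := entire_summable e_lin.
  by rewrite (evB x1 (rpred1 _) (rpredM sl sg)) ev1 (evM x1 sl sg) ev_linear.
have [|||k ek kE] := entire_div_conj_quad (w := w) e_defect w_le1.
- by rewrite gt_eqF.
- by rewrite ev_defect// interp mulVf ?subrr ?g_neq0.
- rewrite ev_defect// (zero_quotient_conj eg hE) -[al%:C]conjc_real -[be%:C]conjc_real.
  rewrite -conjcM -rmorphD interp -conjcM mulVf ?g_neq0//.
  by rewrite conjc1 subrr.
rewrite hE; apply: (conj_quad_mul_resolvent (r := r) (k := k * r) w1 Im_w be0 gr) => //.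
  rewrite -[LHS]mul1r -(subrK (lin * g) 1) kE mulrDl -[lin * g * r]mulrA gr mulr1.
  by rewrite addrC mulrA.
exact: rpredM (entire_summable ek) sr.
Qed.

Lemma resolvent_nonvanishing s x : 0 <= s < 1 -> normc x <= 1 ->
  ev (1 - fpsC s%:C * (1 - h)) x != 0.
Proof.
move=> /andP[s0 s1] x1; have s1h : 1 - h \in abs_summable by exact: rpredB (rpred1 _) sh.
have sC := @abs_summableC R s%:C.
rewrite (evB x1 (rpred1 _) (rpredM sC s1h)) (evM x1 sC s1h) (evB x1 (rpred1 _) sh) evC ev1.
apply/eqP => hx0; have [s_eq0|s_neq0] := eqVneq s 0.
  by move/eqP: hx0; rewrite s_eq0 rmorph0 mul0r subr0 oner_eq0.
have s_gt0 : 0 < s by rewrite lt_def s_neq0.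
have t_gt0 : 0 < (1 - s) / s by rewrite divr_gt0// subr_gt0.
have [|t_eq0 _] := h_zeros (ltW t_gt0) x1; last by rewrite t_eq0 ltxx in t_gt0.
have sC_neq0 : s%:C != 0 :> R[i] by rewrite -normc_gt0 normc_real gtr0_norm.
apply: (mulfI sC_neq0); rewrite mulr0 -[RHS]hx0 rmorphM rmorphB fmorphV rmorph1.
by field.
Qed.

Let resolvent_le s C := s < 1 ->
  exists2 v : fps R[i], (1 - fpsC s%:C * (1 - h)) * v = 1 & l1_le v (C / (1 - s)).

Lemma resolvent_bound_near_lt1 s0 : 0 <= s0 < 1 ->
  exists C d, 0 < d /\ forall s, 0 <= s -> `|s - s0| < d -> resolvent_le s C.
Proof.
move=> s0_itv; have e1h : 1 - h \in entire by exact: rpredB (rpred1 _) h_entire.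
have eF : 1 - fpsC s0%:C * (1 - h) \in entire.
  exact: rpredB (rpred1 _) (rpredM (entireC _) e1h).
have eF1 := entire_euler eF; have eF2 := entire_euler eF1.
have [v Fv /abs_summableP[M vM]] := wiener_inverse (entire_summable eF)
  (entire_summable eF1) (entire_summable eF2) (fun x => resolvent_nonvanishing s0_itv).
have /abs_summableP[N hN] := entire_summable e1h.
have [M0 N0] := (l1_le_ge0 vM, l1_le_ge0 hN).
exists (2 * M), (2 * (N * M + 1))^-1; split.
  by rewrite invr_gt0 mulr_gt0// ltr_wpDl ?mulr_ge0.
move=> s s_ge0 s_near s1.
have [|u Fu u_le] := l1_le_inv_perturb Fv vM (l1_leCM (s0%:C - s%:C) hN).
  rewrite distc_real distrC -mulrA; apply: le_trans (ler_wpM2r (mulr_ge0 N0 M0) (ltW s_near)) _.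
  by rewrite invfM -mulrA ler_piMr ?invr_ge0// mulrC ler_pdivrMr; have := mulr_ge0 N0 M0; lra.
exists u; first by rewrite -[RHS]Fu rmorphB; ring.
by apply: l1_le_trans u_le _; rewrite ler_peMr ?mulr_ge0// invf_ge1 ?gerBl ?subr_gt0.
Qed.

Lemma resolvent_bound_near_1 :
  exists C d, 0 < d /\ forall s, `|s - 1| < d -> resolvent_le s C.
Proof.
have [C [e0 [C0 /andP[e00 e01] resolvent]]] := resolvent_near1.
exists C, e0; split=> // s s_near s1; rewrite distrC in s_near.
have [|v hv vM] := resolvent (1 - s).
  by rewrite subr_gt0 s1 (ltW (le_lt_trans (ler_norm _) s_near)).
by exists v => //; rewrite -[RHS]hv subKr rmorphB rmorph1; ring.
Qed.

Theorem resolvent_bound : exists C, forall s, 0 <= s < 1 ->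
  exists2 v : fps R[i], (1 - fpsC s%:C * (1 - h)) * v = 1 & l1_le v (C / (1 - s)).
Proof.
have [|s0 s0_itv|C resolvent] := @segment_locally_bounded R 0 1 resolvent_le.
- move=> C C' s CC' resolvent /[dup] s1 /resolvent[v hv vM]; exists v => //.
  by apply: l1_le_trans vM _; rewrite ler_wpM2r// invr_ge0 subr_ge0 ltW.
- have [s01|s0_ge1] := ltP s0 1.
    have [|C [d [d0 near_s0]]] := @resolvent_bound_near_lt1 s0; first by case/andP: s0_itv => ->.
    by exists C, d; split=> // s /andP[s_ge0 _]; exact: near_s0.
  have [C [d [d0 near_1]]] := resolvent_bound_near_1; exists C, d; split=> // s _.
  have -> : s0 = 1 by case/andP: s0_itv => _ s0_le1; apply/eqP; rewrite eq_le s0_le1.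
  exact: near_1.
by exists C => s /andP[s0 s1]; apply: resolvent => //; rewrite s0 ltW.
Qed.

End ResolventBound.

Section LambertResolvent.
Variable R : realType.
Implicit Types (s t : R) (x z : R[i]).

Definition lambert_fps : fps R[i] := fpsX + fps_exp (-1).

Lemma entire_lambert_fps : lambert_fps \in entire.
Proof. by rewrite rpredD ?entireX ?entire_exp. Qed.

Lemma ev_lambert_fps z : ev lambert_fps z = z + cexp (- z).
Proof.
rewrite /ev rmorphD fps_sumD ?entire_dil_summable ?entireX ?entire_exp//.
by rewrite -!/(ev _ _) evX ev_exp mulN1r.
Qed.

Lemma ev_euler_lambert_fps z : ev (fps_euler lambert_fps) z = z - z * cexp (- z).
Proof.
have -> : fps_euler lambert_fps = fpsX - fpsX * fps_exp (-1).
  by rewrite raddfD /= fps_eulerX fps_euler_exp rmorphN1 mulN1r.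
have sX : fps_dil z fpsX \in abs_summable by rewrite entire_dil_summable ?entireX.
have sE : fps_dil z (fps_exp (-1)) \in abs_summable.
  by rewrite entire_dil_summable ?entire_exp.
rewrite /ev rmorphB rmorphM fps_sumB ?fps_sumM ?rpredM//.
by rewrite -!/(ev _ _) evX ev_exp mulN1r.
Qed.

Lemma lambert_fps_real n : (lambert_fps n)^*%C = lambert_fps n.
Proof.
rewrite /lambert_fps coef_fpsD rmorphD /= /fpsX conjc_nat /fps_exp conjcM.
by rewrite rmorphXn rmorphN1 conjc_inv conjc_nat.
Qed.

Variable b : R.
Hypothesis b_angle : is_lambert_angle b.
Local Notation W := (lambert_pt b).
Local Notation rho := (normc W).

Let W_neq0 : W != 0.
Proof.
case: b_angle => /andP[b1 _] _; apply/eqP => -[_ b0].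
by rewrite b0 ler10 in b1.
Qed.

Let rho0 : 0 < rho. Proof. by rewrite normc_gt0 W_neq0. Qed.

Let h := fps_dil rho%:C lambert_fps.
Let w := W / rho%:C.

Let rhoC_neq0 : rho%:C != 0 :> R[i].
Proof. by rewrite -normc_gt0 normc_real normr_gt0 gt_eqF. Qed.

Let rho_w : rho%:C * w = W.
Proof. by rewrite mulrC divfK. Qed.

Lemma scaled_lambert_resolvent_bound : exists C, forall s, 0 <= s < 1 ->
  exists2 v : fps R[i], (1 - fpsC s%:C * (1 - h)) * v = 1 & l1_le v (C / (1 - s)).
Proof.
have wcE : rho%:C * w^*%C = W^*%C by rewrite -[in RHS]rho_w [RHS]conjcM conjc_real.
apply: (@resolvent_bound _ h w).
- exact: entire_dil entire_lambert_fps.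
- move=> n; rewrite conjcM lambert_fps_real rmorphXn.
  by congr (_ * _ ^+ n); exact: conjc_real.
- by rewrite normcM normcV normc_real gtr0_norm// divff ?gt_eqF.
- rewrite /w -fmorphV Im_mulc /= mulr0 add0r divr_gt0//.
  by case: b_angle => /andP[b1 _] _; exact: lt_le_trans b1.
- by rewrite ev_dil rho_w ev_lambert_fps lambert_pt_zero.
- move=> t x t0 x1; rewrite ev_dil ev_lambert_fps addrA => zero.
  have [|-> x_eq] := lambert_zero_unique b_angle t0 _ zero.
    by rewrite normcM normc_real gtr0_norm// ler_piMr ?(ltW rho0).
  split=> //; case: x_eq => xE; [left | right]; apply: (mulfI rhoC_neq0).
    by rewrite xE rho_w.
  by rewrite xE wcE.
rewrite fps_euler_dil ev_dil rho_w ev_euler_lambert_fps.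
have -> : cexp (- W) = - W by apply/eqP; rewrite -addr_eq0 addrC lambert_pt_zero.
rewrite mulrN opprK.
have := lambert_pt_Re_le0 b_angle; have := sqr_lambert_pt_Re_lt b_angle.
by rewrite /lambert_pt mulCE addCE /= -!expr2; lra.
Qed.

Definition lambert_resolvent (s : R[i]) : fps R[i] := fps_geom (fpsC s * (1 - lambert_fps)).

Lemma sub1_lambert_fps0 : (1 - lambert_fps) 0%N = 0.
Proof.
by rewrite coef_fpsD coef_fpsN /lambert_fps coef_fpsD /fps_exp expr0 fact0 divr1 add0r subrr.
Qed.

Lemma lambert_resolventP (s : R[i]) :
  (1 - fpsC s * (1 - lambert_fps)) * lambert_resolvent s = 1.
Proof. by apply: fps_geomP; rewrite coef_fpsCM sub1_lambert_fps0 mulr0. Qed.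

Lemma l1_le_lambert_resolvent : exists C, forall s z, 0 <= s < 1 -> normc z = rho ->
  l1_le (fps_dil z (lambert_resolvent s%:C)) (C / (1 - s)).
Proof.
have [C resolvent] := scaled_lambert_resolvent_bound; exists C => s z s_itv z_rho.
apply: (@l1_le_dil_normc _ rho%:C); first by rewrite normc_real z_rho ger0_norm ?ltW.
have [v hv v_le] := resolvent s s_itv.
suff -> : fps_dil rho%:C (lambert_resolvent s%:C) = v by [].
apply: mulr1_uniq hv.
have := congr1 (fps_dil rho%:C) (lambert_resolventP s%:C).
by rewrite rmorphM !rmorphB rmorphM rmorphB !rmorph1 /= fps_dilC.
Qed.

Lemma ev_lambert_resolvent s z : 0 <= s < 1 -> normc z = rho -> z + cexp (- z) = 0 ->
  ev (lambert_resolvent s%:C) z = (1 - s%:C)^-1.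
Proof.
move=> /[dup] /andP[s0 s1] s_itv z_rho z_zero; have [C resolvent] := l1_le_lambert_resolvent.
have sr := l1_le_abs_summable (resolvent s z s_itv z_rho).
have sl : fps_dil z (1 - lambert_fps) \in abs_summable.
  by rewrite entire_dil_summable ?rpredB ?rpred1 ?entire_lambert_fps.
have ev1 : fps_sum (fps_dil z (1 - lambert_fps)) = 1.
  rewrite rmorphB rmorph1 fps_sumB ?rpred1 ?entire_dil_summable ?entire_lambert_fps//.
  by rewrite fps_sum1 -/(ev _ _) ev_lambert_fps z_zero subr0.
have := congr1 (fun c => fps_sum (fps_dil z c)) (lambert_resolventP s%:C).
rewrite rmorphM rmorphB rmorphM !rmorph1 /= fps_dilC fps_sum1.
have sC := @abs_summableC R s%:C.
rewrite (fps_sumM (rpredB (rpred1 _) (rpredM sC sl)) sr).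
rewrite (fps_sumB (rpred1 _) (rpredM sC sl)) fps_sumCM// ev1 fps_sum1 mulr1 => evE.
have sub1s_neq0 : 1 - s%:C != 0 :> R[i].
  by rewrite -normc_gt0 (distc_real 1) normr_gt0 gt_eqF ?subr_gt0.
by apply: (mulfI sub1s_neq0); rewrite divff.
Qed.

End LambertResolvent.

Section BlockPartitions.
Local Open Scope set_scope.
Variables (T : finType) (D : pred nat).
Hypothesis D0 : ~~ D 0.
Implicit Types (A B : {set T}) (P Q : {set {set T}}).

Definition block_partitions A k := [set P : {set {set T}} | [&& finset.partition P A,
  #|P| == k & [forall (B | B \in P), D #|B|]]].

Lemma block_partitionsP A k P : reflect
  [/\ finset.partition P A, #|P| = k & {in P, forall B, D #|B|}]
  (P \in block_partitions A k).
Proof.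
rewrite inE; apply: (iffP and3P) => [[PA /eqP Pk /forall_inP PD]|[PA Pk PD]].
  by split.
by split=> //; [exact/eqP | exact/forall_inP].
Qed.

Let D_neq0 B : D #|B| -> B != finset.set0.
Proof. by apply: contraTneq => ->; rewrite cards0. Qed.

Lemma partition_setD_notin A B P : B != finset.set0 -> finset.partition P (A :\: B) ->
  B \notin P.
Proof.
move=> B0 PA; apply: contraNN B0 => /(finset.partitionS PA).
by rewrite finset.subsetD => /andP[_]; rewrite -finset.setI_eq0 finset.setIid.
Qed.

Lemma block_partitions_setU1 A B k P : B \subset A -> D #|B| ->
  P \in block_partitions (A :\: B) k -> B |: P \in block_partitions A k.+1.
Proof.
move=> BA BD /block_partitionsP[PA Pk PD]; have B0 := D_neq0 BD.
have BP := partition_setD_notin B0 PA.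
apply/block_partitionsP; split; last by move=> C /finset.setU1P[->//|/PD].
  have -> : A = B :|: (A :\: B) by rewrite finset.setDE finset.setUIr finset.setUCr
    finset.setIT; apply/esym/finset.setUidPr.
  apply: finset.partitionU1 => //.
  by rewrite -finset.setI_eq0 finset.setIDA finset.setDIl finset.setDv finset.set0I.
by rewrite cardsU1 BP Pk.
Qed.

Lemma block_partitions_setD1 A B k P : P \in block_partitions A k.+1 -> B \in P ->
  P :\ B \in block_partitions (A :\: B) k.
Proof.
move=> /block_partitionsP[PA Pk PD] BP; apply/block_partitionsP; split.
- exact: finset.partitionD1.
- by have := cardsD1 B P; rewrite BP Pk add1n => -[].
- by move=> C /finset.setD1P[_ /PD].
Qed.

Lemma card_block_partitions_with A B k : B \subset A -> D #|B| ->
  #|[set P in block_partitions A k.+1 | B \in P]| = #|block_partitions (A :\: B) k|.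
Proof.
move=> BA BD; have B0 := D_neq0 BD.
have setU1_inj : {in block_partitions (A :\: B) k &, injective (fun P => B |: P)}.
  move=> P Q /block_partitionsP[/(partition_setD_notin B0) BP _ _].
  move=> /block_partitionsP[/(partition_setD_notin B0) BQ _ _] PQ.
  by rewrite -(setU1K BP) -(setU1K BQ) PQ.
rewrite -(card_in_imset setU1_inj); apply: eq_card => P; rewrite inE.
apply/andP/imsetP => [[PA BP]|[Q QA ->]].
  by exists (P :\ B); rewrite ?finset.setD1K ?block_partitions_setD1.
by rewrite block_partitions_setU1// finset.setU11.
Qed.

Lemma card_block_partitionsS A k :
  (k.+1 * #|block_partitions A k.+1| =
   \sum_(B : {set T} | (B \subset A) && D #|B|) #|block_partitions (A :\: B) k|)%N.
Proof.
transitivity (\sum_(P in block_partitions A k.+1) \sum_(B in P) 1)%N.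
  rewrite mulnC -sum_nat_const; apply: eq_bigr => P /block_partitionsP[_ <- _].
  by rewrite sum1_card.
rewrite (exchange_big_dep xpredT)//= [RHS]big_mkcond /=; apply: eq_bigr => B _.
rewrite sum1_card; case: ifP => [/andP[BA BD]|BAD].
  by rewrite -card_block_partitions_with//; apply: eq_card => P; rewrite [RHS]inE.
apply: eq_card0 => P; rewrite unfold_in; apply/negP => /andP[/block_partitionsP[PA _ PD] BP].
by move: BAD; rewrite (finset.partitionS PA BP) PD.
Qed.

Lemma block_partitions0 A : block_partitions A 0 =
  if A == finset.set0 then [set finset.set0] else finset.set0.
Proof.
apply/finset.setP => P; rewrite inE cards_eq0; case: (eqVneq A) => [->|A0]; rewrite inE.
  rewrite finset.partition_set0; case: eqVneq => //= ->.
  by apply/forall_inP => B; rewrite inE.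
apply/negP => /and3P[PA /eqP P0 _]; move: PA; rewrite P0 /finset.partition.
by rewrite /finset.cover big_set0 eq_sym (negbTE A0).
Qed.

Lemma sum_subset_card (V : nmodType) A (F : nat -> V) :
  \sum_(B : {set T} | B \subset A) F #|B| = \sum_(j < #|A|.+1) F j *+ 'C(#|A|, j).
Proof.
have card_lt B : B \subset A -> (#|B| < #|A|.+1)%N by move=> BA; exact: subset_leq_card.
rewrite (partition_big (fun B : {set T} => inord #|B| : 'I_(#|A|.+1)) xpredT)//=.
apply: eq_bigr => j _; rewrite -cards_draws.
rewrite (eq_bigr (fun=> F j)) => [|B /andP[BA /eqP <-]]; last by rewrite inordK ?card_lt.
rewrite sumr_const; congr (_ *+ _); apply: eq_card => B; rewrite !inE unfold_in /=.
by case: (boolP (B \subset A)) => //= BA; rewrite -val_eqE /= inordK ?card_lt.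
Qed.

End BlockPartitions.

Section BlockPartitionSeries.
Variables (K : numFieldType) (D : pred nat).
Hypothesis D0 : ~~ D 0.

Definition block_egf : fps K := fun n => if D n then n`!%:R^-1 else 0.

Lemma card_block_partitions_egf (T : finType) (A : {set T}) k :
  (k`! * #|block_partitions D A k|)%:R = (#|A|)`!%:R * (block_egf ^+ k) #|A| :> K.
Proof.
elim: k A => [|k IH] A.
  rewrite fact0 mul1n expr0 coef_fps1 block_partitions0 -cards_eq0.
  by case: eqP => [->|_]; rewrite ?cards1 ?mulr1// cards0 mulr0.
rewrite factS mulnAC card_block_partitionsS// mulnC natrM natr_sum mulr_sumr.
have termE (B : {set T}) : (B \subset A) && D #|B| ->
    k`!%:R * #|block_partitions D (A :\: B)%SET k|%:R =
    (#|A| - #|B|)`!%:R * (block_egf ^+ k) (#|A| - #|B|)%N :> K.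
  by move=> /andP[BA _]; rewrite -natrM IH cardsD (finset.setIidPr BA).
rewrite (eq_bigr _ termE) big_mkcondr /=.
rewrite (sum_subset_card A (fun j => if D j then
  (#|A| - j)`!%:R * (block_egf ^+ k) (#|A| - j)%N else 0)).
rewrite exprS coef_fpsM mulr_sumr; apply: eq_bigr => -[j /= jA] _.
rewrite {2}/block_egf; case: ifP => _; last by rewrite mul0r mulr0 mul0rn.
rewrite ltnS in jA; rewrite -(bin_fact jA) !natrM -mulr_natl.
have fact_neq0 : j`!%:R != 0 :> K by rewrite pnatr_eq0 -lt0n fact_gt0.
by move: ((block_egf ^+ k) _) => c; field.
Qed.

End BlockPartitionSeries.

Section LambertStirling.
Variable R : realType.

Lemma sub1_lambert_fps_egf :
  1 - lambert_fps R = - fps_dil (-1) (block_egf _ (leq 2)).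
Proof.
apply/funext => n; rewrite coef_fpsD !coef_fpsN /lambert_fps coef_fpsD coef_fps1.
rewrite /fps_exp /fps_dil /block_egf /fpsX; case: n => [|[|n]] /=.
- by rewrite expr0 fact0 divr1 add0r subrr mul0r oppr0.
- by rewrite expr1 factS fact0 divr1 subrr subr0 mul0r oppr0.
- by rewrite !add0r mulrC.
Qed.

Lemma coef_sub1_lambert_fps_expr n k : ((1 - lambert_fps R) ^+ k) n =
  (-1) ^+ (n + k) * (k`!%:R * (stirling2_ge2 n k)%:R / n`!%:R).
Proof.
have fact_neq0 : n`!%:R != 0 :> R[i] by rewrite pnatr_eq0 -lt0n fact_gt0.
have := card_block_partitions_egf R[i] (D := leq 2) isT [set: 'I_n]%SET k.
rewrite cardsT card_ord natrM -/(stirling2_ge2 n k) => ->.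
rewrite sub1_lambert_fps_egf (exprNn (fps_dil _ _)) -(rmorphXn (fps_dil (-1))).
rewrite -(rmorphN1 (@fpsC _)) -(rmorphXn (@fpsC _)).
rewrite coef_fpsCM /fps_dil exprD /= [X in _ = _ * X]mulrAC divff// mul1r.
by rewrite mulrC -mulrA mulrC.
Qed.

End LambertStirling.

Section LebesgueDilation.
Variable R : realType.
Local Notation RM := (measurableTypeR R).
Local Notation mu := (@lebesgue_measure R).
Implicit Types (c : R) (D : set RM).

Definition dilation c : RM -> RM := fun x => c * x.

Lemma measurable_dilation c : measurable_fun [set: RM] (dilation c).
Proof. exact: measurable_funM. Qed.

Definition dilated_lebesgue c : {measure set RM -> \bar R}.
Proof.
by refine (pushforward mu (dilation c) : {measure set RM -> \bar R}); exact: measurable_dilation.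
Defined.

Lemma lebesgue_measure_dilation c (c0 : 0 < c) D : measurable D ->
  mu D = mscale (NngNum (ltW c0)) (dilated_lebesgue c) D.
Proof.
move=> mD; apply: lebesgue_measure_unique => //= _ [[a b]] _ <-.
rewrite /mscale /dilated_lebesgue /= /pushforward.
have -> : dilation c @^-1` `]a, b]%classic = `]a / c, b / c]%classic.
  by apply/seteqP; split=> x /=;
    rewrite /dilation !in_itv /= ltr_pdivrMr// ler_pdivlMr// mulrC.
rewrite !lebesgue_measure_itv /= !lte_fin ltr_pM2r ?invr_gt0//.
case: ifPn => ab; last by rewrite mule0.
by rewrite -!EFinB -EFinM -mulrBl mulrCA divff ?mulr1// gt_eqF.
Qed.

Lemma ge0_integral_dilation c D (f : R -> \bar R) : 0 < c -> measurable D ->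
  measurable_fun D f -> (forall x, 0 <= f x)%E ->
  (\int[mu]_(x in D) f x = c%:E * \int[mu]_(x in dilation c @^-1` D) f (c * x)%R)%E.
Proof.
move=> c0 mD mf f0.
transitivity (\int[mscale (NngNum (ltW c0)) (dilated_lebesgue c)]_(x in D) f x)%E.
  by apply: eq_measure_integral => A mA _; exact: lebesgue_measure_dilation.
rewrite ge0_integral_mscale//=; congr (_ * _)%E.
exact: (ge0_integral_pushforward (measurable_dilation c)).
Qed.

Lemma Rintegral_dilation c D (f : R -> R) : 0 < c -> measurable D ->
  mu.-integrable D (EFin \o f) ->
  \int[mu]_(x in D) f x = c * \int[mu]_(x in dilation c @^-1` D) f (c * x).
Proof.
move=> c0 mD f_int; pose P g := (\int[mu]_(x in dilation c @^-1` D) g (c * x)%R)%E.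
have mf := measurable_int _ f_int.
have posE : (\int[mu]_(x in D) (EFin \o f)^\+ x = c%:E * P (EFin \o f)^\+)%E.
  by apply: ge0_integral_dilation => //; exact: measurable_funepos.
have negE : (\int[mu]_(x in D) (EFin \o f)^\- x = c%:E * P (EFin \o f)^\-)%E.
  by apply: ge0_integral_dilation => //; exact: measurable_funeneg.
have fin_num_mul (u : \bar R) : (c%:E * u)%E \is a fin_num -> u \is a fin_num.
  by case: u => //; rewrite ?gt0_muley ?gt0_muleNy ?lte_fin.
have P_fin : P ((EFin \o f)^\+)%E \is a fin_num.
  by apply: fin_num_mul; rewrite -posE integrable_pos_fin_num.
have N_fin : P ((EFin \o f)^\-)%E \is a fin_num.
  by apply: fin_num_mul; rewrite -negE integrable_neg_fin_num.
rewrite /Rintegral [in LHS]integralE posE negE [in RHS]integralE.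
rewrite fineB ?fin_numM// !fineM// -mulrBr -fineB//.
by congr (_ * fine (_ - _)%E); apply: eq_integral => x _; rewrite ?funeposE ?funenegE.
Qed.

End LebesgueDilation.

Section ComplexIntegral.
Context (d : measure_display) (T : measurableType d) (R : realType).
Variables (mu : {measure set T -> \bar R}) (D : set T).
Hypothesis mD : measurable D.
Implicit Types (F : T -> R[i]) (G : T -> R) (z : R[i]).

Definition Cintegral F : R[i] :=
  (\int[mu]_(t in D) complex.Re (F t)) +i* (\int[mu]_(t in D) complex.Im (F t)).

Definition Cmeasurable F := measurable_fun D (fun t => complex.Re (F t)) /\
  measurable_fun D (fun t => complex.Im (F t)).

Definition Cintegrable F := mu.-integrable D (fun t => (complex.Re (F t))%:E) /\
  mu.-integrable D (fun t => (complex.Im (F t))%:E).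

Lemma CmeasurableM F1 F2 : Cmeasurable F1 -> Cmeasurable F2 ->
  Cmeasurable (fun t => F1 t * F2 t).
Proof.
move=> [re1 im1] [re2 im2]; split.
  by under eq_fun do rewrite Re_mulc; apply: measurable_funB; exact: measurable_funM.
by under eq_fun do rewrite Im_mulc; apply: measurable_funD; exact: measurable_funM.
Qed.

Lemma Cmeasurable_cst z : Cmeasurable (fun=> z).
Proof. by split; exact: measurable_cst. Qed.

Lemma Cmeasurable_real G : measurable_fun D G -> Cmeasurable (fun t => (G t)%:C).
Proof. by split=> //; exact: measurable_cst. Qed.

Lemma Cmeasurable_cexp F : Cmeasurable F -> Cmeasurable (fun t => cexp (F t)).
Proof.
move=> [re im]; split; apply: measurable_funM; try exact: measurableT_comp.
  by apply: measurableT_comp => //; apply: continuous_measurable_fun; exact: continuous_cos.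
by apply: measurableT_comp => //; apply: continuous_measurable_fun; exact: continuous_sin.
Qed.

Lemma Cintegrable_dominated F G : Cmeasurable F -> mu.-integrable D (EFin \o G) ->
  (forall t, D t -> normc (F t) <= G t) -> Cintegrable F.
Proof.
move=> [mRe mIm] iG F_le.
split; apply: (le_integrable mD _ _ iG); try exact/measurable_EFinP.
  move=> t Dt; rewrite /= lee_fin (le_trans (ler_Re_normc _))//.
  by rewrite (le_trans (F_le _ Dt)) ?ler_norm.
move=> t Dt; rewrite /= lee_fin (le_trans (ler_Im_normc _))//.
by rewrite (le_trans (F_le _ Dt)) ?ler_norm.
Qed.

Lemma integrable_EFin_sum n (g : nat -> T -> R) :
  (forall k, mu.-integrable D (EFin \o g k)) ->
  mu.-integrable D (EFin \o (fun t => \sum_(k < n) g k t)).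
Proof.
move=> ig; rewrite (_ : EFin \o _ = fun t => (\sum_(k < n) (EFin \o g k) t)%E).
  by apply: integrable_sum => // k _; exact: ig.
by apply/funext => t; rewrite /= sumEFin.
Qed.

Lemma Rintegral_sum n (g : nat -> T -> R) : (forall k, mu.-integrable D (EFin \o g k)) ->
  \int[mu]_(t in D) (\sum_(k < n) g k t) = \sum_(k < n) \int[mu]_(t in D) g k t.
Proof.
move=> ig; rewrite /Rintegral; under eq_integral do rewrite -sumEFin.
rewrite (integral_sum mD (fun k : 'I_n => ig k)) -sum_fine// => k _.
exact: integrable_fin_num.
Qed.

Lemma CintegrableD F1 F2 : Cintegrable F1 -> Cintegrable F2 ->
  Cintegrable (fun t => F1 t + F2 t).
Proof.
move=> [re1 im1] [re2 im2]; split.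
  by apply: eq_integrable (integrableD mD re1 re2) => // t _; rewrite Re_addc EFinD.
by apply: eq_integrable (integrableD mD im1 im2) => // t _; rewrite Im_addc EFinD.
Qed.

Lemma CintegralD F1 F2 : Cintegrable F1 -> Cintegrable F2 ->
  Cintegral (fun t => F1 t + F2 t) = Cintegral F1 + Cintegral F2.
Proof.
move=> [re1 im1] [re2 im2]; rewrite /Cintegral addCE -!RintegralD//.
by congr (_ +i* _); apply: eq_Rintegral => t _; rewrite ?Re_addc ?Im_addc.
Qed.

Lemma CintegrableZl z F : Cintegrable F -> Cintegrable (fun t => z * F t).
Proof.
move=> [re im]; split.
  apply: eq_integrable (integrableB mD (integrableZl mD (complex.Re z) re)
    (integrableZl mD (complex.Im z) im)) => // t _.
  by rewrite Re_mulc EFinB !EFinM.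
apply: eq_integrable (integrableD mD (integrableZl mD (complex.Re z) im)
  (integrableZl mD (complex.Im z) re)) => // t _.
by rewrite Im_mulc EFinD !EFinM.
Qed.

Lemma CintegralZl z F : Cintegrable F ->
  Cintegral (fun t => z * F t) = z * Cintegral F.
Proof.
move=> [re im].
have reZ (r : R) : mu.-integrable D (EFin \o (fun t => r * complex.Re (F t))).
  exact: eq_integrable (integrableZl mD r re).
have imZ (r : R) : mu.-integrable D (EFin \o (fun t => r * complex.Im (F t))).
  exact: eq_integrable (integrableZl mD r im).
case: z => x y; rewrite /Cintegral mulCE -!RintegralZl// -RintegralB// -RintegralD//.
by congr (_ +i* _); apply: eq_Rintegral => t _; rewrite ?Re_mulc ?Im_mulc.
Qed.

Lemma Cintegrable0 : Cintegrable (fun=> 0).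
Proof. by split; exact: integrable0. Qed.

Lemma Cintegral0 : Cintegral (fun=> 0) = 0.
Proof. by rewrite /Cintegral /Rintegral !integral0. Qed.

Lemma Cintegrable_sum n (F : nat -> T -> R[i]) : (forall k, Cintegrable (F k)) ->
  Cintegrable (fun t => \sum_(k < n) F k t).
Proof.
move=> iF; elim: n => [|n IH].
  by under eq_fun do rewrite big_ord0; exact: Cintegrable0.
by under eq_fun do rewrite big_ord_recr /=; exact: CintegrableD.
Qed.

Lemma Cintegral_sum n (F : nat -> T -> R[i]) : (forall k, Cintegrable (F k)) ->
  Cintegral (fun t => \sum_(k < n) F k t) = \sum_(k < n) Cintegral (F k).
Proof.
move=> iF; elim: n => [|n IH].
  by under eq_fun do rewrite big_ord0; rewrite Cintegral0 big_ord0.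
under eq_fun do rewrite big_ord_recr /=.
by rewrite CintegralD ?IH ?big_ord_recr//; exact: Cintegrable_sum.
Qed.

Lemma eq_Cintegral F1 F2 : (forall t, D t -> F1 t = F2 t) -> Cintegral F1 = Cintegral F2.
Proof.
move=> F12; rewrite /Cintegral.
by congr (_ +i* _); apply: eq_Rintegral => t /set_mem Dt; rewrite F12.
Qed.

Lemma Rintegral_dominated_cvg (f_ : nat -> T -> R) (f G : T -> R) :
  (forall n, measurable_fun D (f_ n)) -> (forall t, D t -> f_ ^~ t @ \oo --> f t) ->
  mu.-integrable D (EFin \o G) -> (forall n t, D t -> `|f_ n t| <= G t) ->
  (fun n => \int[mu]_(t in D) f_ n t) @ \oo --> \int[mu]_(t in D) f t.
Proof.
move=> mf_ f_f iG f_le.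
have mf : measurable_fun D (EFin \o f).
  apply: (emeasurable_fun_cvg (fun n => EFin \o f_ n)) => [n|t Dt].
    exact/measurable_EFinP.
  by apply: cvg_EFin; [exact: nearW | exact: f_f].
have [|||if_ _ int_cvg] := @dominated_convergence _ _ _ mu D mD (fun n => EFin \o f_ n)
  (EFin \o f) (EFin \o G) _ mf _ iG.
- by move=> n; exact/measurable_EFinP.
- by apply/aeW => t Dt; apply: cvg_EFin; [exact: nearW | exact: f_f].
- by apply/aeW => t n Dt; rewrite /= lee_fin f_le.
by apply: fine_cvg; rewrite fineK; [exact: int_cvg | exact: integrable_fin_num].
Qed.

Lemma Cintegral_dominated_cvg (F_ : nat -> T -> R[i]) F G :
  (forall n, Cmeasurable (F_ n)) ->
  (forall t, D t -> (F_ ^~ t : nat -> R[i]^o) @ \oo --> (F t : R[i]^o)) ->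
  mu.-integrable D (EFin \o G) -> (forall n t, D t -> normc (F_ n t) <= G t) ->
  ((fun n => Cintegral (F_ n)) : nat -> R[i]^o) @ \oo --> (Cintegral F : R[i]^o).
Proof.
move=> mF_ F_F iG F_le; apply/cvgC_ReIm; split.
  apply: (@Rintegral_dominated_cvg _ _ G) => // [n|t /F_F/cvgC_ReIm[]//|n t Dt].
    by case: (mF_ n).
  exact: le_trans (ler_Re_normc _) (F_le n t Dt).
apply: (@Rintegral_dominated_cvg _ _ G) => // [n|t /F_F/cvgC_ReIm[]//|n t Dt].
  by case: (mF_ n).
exact: le_trans (ler_Im_normc _) (F_le n t Dt).
Qed.

End ComplexIntegral.

Lemma exprn_mul_lt (R : realType) (r a c : R) : 0 <= r < 1 -> 0 < c -> exists n, r ^+ n * a < c.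
Proof.
move=> /andP[r0 r1] c0; have r_lt1 : `|r| < 1 by rewrite ger0_norm.
have /cvgrPdist_lt/(_ _ c0)[n _ /(_ n (leqnn n))] : r ^+ k * a @[k --> \oo] --> 0.
  by rewrite -[0](mul0r a); exact: cvgMr_tmp (cvg_expr r_lt1).
rewrite sub0r normrN => decay; exists n; exact: le_lt_trans (ler_norm _) decay.
Qed.

Section RealIntegrals.
Context (d : measure_display) (T : measurableType d) (R : realType).
Variables (mu : {measure set T -> \bar R}) (D : set T).
Hypothesis mD : measurable D.
Implicit Types (f g : T -> R) (J : set T).

Lemma integrable_nondecreasing_cvg (f_ : nat -> T -> R) f (B : R) :
  (forall n, mu.-integrable D (EFin \o f_ n)) ->
  (forall n t, D t -> 0 <= f_ n t) ->
  (forall t, D t -> {homo f_ ^~ t : n m / (n <= m)%N >-> n <= m}) ->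
  (forall t, D t -> f_ ^~ t @ \oo --> f t) ->
  (forall n, \int[mu]_(t in D) f_ n t <= B) -> mu.-integrable D (EFin \o f).
Proof.
move=> if_ f_ge0 f_nd f_f f_le.
have mf_ n : measurable_fun D (EFin \o f_ n) by exact: measurable_int (if_ n).
have f_f_EFin t : D t -> (EFin \o f_ n) t @[n --> \oo] --> (EFin \o f) t.
  by move=> Dt; apply: cvg_EFin; [exact: nearW | exact: f_f].
have f_nd_EFin t : D t ->
    {homo (fun n => (EFin \o f_ n) t) : n m / (n <= m)%N >-> (n <= m)%E}.
  by move=> Dt n m nm; rewrite lee_fin f_nd.
have f_ge0_EFin n t : D t -> (0 <= (EFin \o f_ n) t)%E by move=> Dt; rewrite lee_fin f_ge0.
apply/integrableP; split; first exact: emeasurable_fun_cvg mf_ f_f_EFin.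
have int_cvg := @cvg_monotone_convergence _ _ _ mu D mD _ mf_ f_ge0_EFin f_nd_EFin.
apply: (@le_lt_trans _ _ B%:E); last by rewrite ltry.
have -> : (\int[mu]_(t in D) `|(EFin \o f) t| =
    \int[mu]_(t in D) limn (fun n => (EFin \o f_ n) t))%E.
  apply: eq_integral => t /set_mem Dt; rewrite (cvg_lim _ (f_f_EFin t Dt))//.
  rewrite gee0_abs// lee_fin -(cvg_lim _ (f_f t Dt))//.
  by apply: limr_ge; [exact: cvgP (f_f t Dt) | apply: nearW => n; exact: f_ge0].
rewrite -(cvg_lim _ int_cvg)//; apply: lime_le; first exact: cvgP int_cvg.
apply: nearW => n; rewrite -(fineK (integrable_fin_num mD (if_ n))) lee_fin.
exact: f_le.
Qed.

Lemma integrable_indic_fin_num J : measurable J -> J `<=` D -> mu J \is a fin_num ->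
  mu.-integrable D (EFin \o \1_J).
Proof.
move=> mJ JD muJ_fin.
apply/integrableP; split; first exact/measurable_EFinP/measurable_indic.
under eq_integral do rewrite gee0_abs ?lee_fin//.
by rewrite integral_indic// (setIidl JD) ltey_eq muJ_fin.
Qed.

Lemma Rintegral_indic J : measurable J -> J `<=` D -> \int[mu]_(t in D) \1_J t = fine (mu J).
Proof. by move=> mJ JD; rewrite /Rintegral integral_indic// (setIidl JD). Qed.

(* The powers of g / l' are at least 1 on J and decay geometrically wherever f may
   be negative. *)
Lemma Rintegral_peak_gt0 f g J (e l l' : R) :
  mu.-integrable D (EFin \o f) ->
  (forall n, mu.-integrable D (EFin \o (fun t => f t * g t ^+ n))) ->
  measurable J -> J `<=` D -> (0 < mu J)%E -> mu J \is a fin_num -> 0 < e ->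
  0 <= l -> l < l' -> (forall t, J t -> e <= f t) -> (forall t, J t -> l' <= g t) ->
  (forall t, D t -> 0 <= g t) -> (forall t, D t -> 0 <= f t \/ g t <= l) ->
  exists n, 0 < \int[mu]_(t in D) (f t * g t ^+ n).
Proof.
move=> if_ ifg mJ JD muJ_gt0 muJ_fin e0 l0 ll' f_ge g_ge g_ge0 f_or_g.
have l'0 : 0 < l' by exact: le_lt_trans ll'.
pose r := l / l'; have r0 : 0 <= r by rewrite divr_ge0// ltW.
have r1 : r < 1 by rewrite ltr_pdivrMr// mul1r.
have i_abs : mu.-integrable D (EFin \o (fun t => `|f t|)) by exact: integrable_norm.
have indic_le n t : D t ->
    e * \1_J t <= (l' ^+ n)^-1 * (f t * g t ^+ n) + r ^+ n * `|f t|.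
  move=> Dt; rewrite mulrCA -exprVn -exprMn [l'^-1 * _]mulrC.
  have [Jt|nJt] := boolP (t \in J); rewrite indicE ?Jt ?(negbTE nJt) ?mulr1 ?mulr0.
    have ge1 : 1 <= g t / l' by rewrite ler_pdivlMr// mul1r g_ge//; exact: set_mem.
    have ft_ge := f_ge t (set_mem Jt); have ft0 := le_trans (ltW e0) ft_ge.
    apply: le_trans ft_ge _; rewrite ler_wpDr ?mulr_ge0 ?exprn_ge0//.
    by rewrite ler_peMr// exprn_ege1.
  have gl'0 : 0 <= g t / l' by rewrite divr_ge0 ?g_ge0// ltW.
  case: (f_or_g t Dt) => [ft0|gl]; first by rewrite addr_ge0 ?mulr_ge0 ?exprn_ge0.
  rewrite addrC -lerBlDr sub0r [r ^+ n * _]mulrC.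
  apply: le_trans (_ : `|f t| * (g t / l') ^+ n <= _); last first.
    by rewrite ler_wpM2l// lerXn2r ?nnegrE// ler_pM2r ?invr_gt0.
  by rewrite -mulNr ler_wpM2r ?exprn_ge0// -normrN ler_norm.
have muJ_le n : e * fine (mu J) <= (l' ^+ n)^-1 * (\int[mu]_(t in D) (f t * g t ^+ n)) +
    r ^+ n * \int[mu]_(t in D) `|f t|.
  have i_indic := integrable_indic_fin_num mJ JD muJ_fin.
  rewrite -(Rintegral_indic mJ JD) -!RintegralZl// -RintegralD//.
  - apply: le_Rintegral => //; last by move=> t; exact: indic_le.
      by apply: eq_integrable (integrableZl mD e i_indic) => //.
    by apply: eq_integrable (integrableD mD (integrableZl mD (l' ^+ n)^-1 (ifg n))
      (integrableZl mD (r ^+ n) i_abs)) => //.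
  - by apply: eq_integrable (integrableZl mD (l' ^+ n)^-1 (ifg n)) => //.
  - by apply: eq_integrable (integrableZl mD (r ^+ n) i_abs) => //.
have muJ0 : 0 < e * fine (mu J) by rewrite mulr_gt0// fine_gt0// muJ_gt0 ltey_eq muJ_fin.
have [|n decay] := @exprn_mul_lt _ r (\int[mu]_(t in D) `|f t|) _ _ muJ0; first by rewrite r0.
exists n; rewrite -(pmulr_rgt0 _ (_ : 0 < (l' ^+ n)^-1)) ?invr_gt0 ?exprn_gt0//.
by have := muJ_le n; lra.
Qed.

End RealIntegrals.

Section RiemannSeries.
Variables (R : realType) (x : R).
Hypothesis x1 : 1 < x.

Let ratio : R := 2 `^ (1 - x).

Lemma riemannR_doubleS n : 2 * riemannR x n.*2.+1 = ratio * riemannR x n.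
Proof.
rewrite /riemannR -doubleS -mul2n natrM powRM// invfM mulrA; congr (_ * _).
by rewrite /ratio powRD ?powRr1 ?powRN// pnatr_eq0 implybT.
Qed.

Lemma nonincreasing_riemannR : {homo riemannR x : n m / (n <= m)%N >-> m <= n}.
Proof.
move=> n m nm; rewrite /= lef_pV2 ?posrE ?powR_gt0 ?ltr0n//.
by rewrite ge0_ler_powR ?nnegrE ?ler_nat// ltW// (lt_trans _ x1).
Qed.

Lemma nondecreasing_riemannR_series :
  {homo series (riemannR x) : n m / (n <= m)%N >-> n <= m}.
Proof.
by apply: nondecreasing_series => n _ _; rewrite ltW// riemannR_gt0// ltW// (lt_trans _ x1).
Qed.

(* Pairing the terms of odd index with their successors. *)
Lemma riemannR_series_doubleS n :
  series (riemannR x) n.*2.+1 <= 1 + ratio * series (riemannR x) n.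
Proof.
have riemannR0 : riemannR x 0 = 1 by rewrite /riemannR powR1 invr1.
have -> : series (riemannR x) n.*2.+1 =
    1 + \sum_(j < n) (riemannR x j.*2.+1 + riemannR x j.*2.+2).
  elim: n => [|n IH].
    by rewrite double0 seriesSr [series _ 0%N]big_geq// big_ord0 addrC riemannR0.
  by rewrite doubleS 2!seriesSr IH [in RHS]big_ord_recr /= !addrA.
rewrite lerD2l seriesEord mulr_sumr; apply: ler_sum => j _.
rewrite -riemannR_doubleS [2 * _]mulr_natl mulr2n lerD2l.
exact: nonincreasing_riemannR.
Qed.

Lemma riemannR_series_le n : series (riemannR x) n <= (1 - ratio)^-1.
Proof.
have ratio_lt1 : ratio < 1.
  by rewrite /ratio /powR gt_eqF// expR_lt1 pmulr_llt0 ?ln_gt0 ?ltr1n// subr_lt0.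
have ratio0 : 0 <= ratio by exact: powR_ge0.
have n_le : (n <= n.*2.+1)%N by rewrite -addnn -addnS leq_addr.
have mono := nondecreasing_riemannR_series n_le.
rewrite -[leRHS]mul1r ler_pdivlMr ?subr_gt0// mulrBr mulr1 lerBlDr mulrC.
exact: le_trans mono (riemannR_series_doubleS n).
Qed.

End RiemannSeries.

Section ComplexPower.
Variable R : realType.
Implicit Types (s t x : R) (m : R[i]).

Lemma cpow_neq0 t m : cpow t m != 0.
Proof. exact: cexp_neq0. Qed.

Lemma cpowD t m1 m2 : cpow t (m1 + m2) = cpow t m1 * cpow t m2.
Proof. by rewrite /cpow mulrDl cexpD. Qed.

Lemma cpowM s t m : 0 < s -> 0 < t -> cpow (s * t) m = cpow s m * cpow t m.
Proof. by move=> s0 t0; rewrite /cpow lnM ?posrE// rmorphD mulrDr cexpD. Qed.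

Lemma cpow_real t x : 0 < t -> cpow t x%:C = (t `^ x)%:C.
Proof. by move=> t0; rewrite /cpow -rmorphM cexp_real /powR gt_eqF. Qed.

Lemma cpow1 t : 0 < t -> cpow t 1 = t%:C.
Proof. by move=> t0; rewrite (cpow_real 1 t0) powRr1 ?ltW. Qed.

Lemma normc_cpow t m : 0 < t -> normc (cpow t m) = t `^ complex.Re m.
Proof. by move=> t0; rewrite normc_cexp Re_mulc /= mulr0 subr0 /powR gt_eqF. Qed.

End ComplexPower.

Section GammaIntegral.
Variable R : realType.
Local Notation mu := (@lebesgue_measure R).
Local Notation pos := (`]0%R, +oo[%classic : set (measurableTypeR R)).
Implicit Types (c t x : R) (m : R[i]).

Lemma measurable_pos : measurable pos.
Proof. exact: measurable_itv. Qed.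

Lemma mem_pos t : pos t = (0 < t) :> Prop.
Proof. by rewrite /= in_itv /= andbT. Qed.

Definition gamma_density x c t : R := t `^ (x - 1) * expR (- (c * t)).

Definition gamma_kernel m c t : R[i] := cpow t (m - 1) * (expR (- (c * t)))%:C.

Definition cgamma m : R[i] := Cintegral mu pos (gamma_kernel m 1).

Lemma gamma_density_ge0 x c t : 0 <= gamma_density x c t.
Proof. by rewrite mulr_ge0 ?powR_ge0 ?expR_ge0. Qed.

Lemma normc_gamma_kernel m c t : 0 < t ->
  normc (gamma_kernel m c t) = gamma_density (complex.Re m) c t.
Proof.
by move=> t0; rewrite normcM normc_cpow// normc_real ger0_norm ?expR_ge0// Re_subc.
Qed.

Lemma gamma_kernel_real x c t : 0 < t -> gamma_kernel x%:C c t = (gamma_density x c t)%:C.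
Proof. by move=> t0; rewrite /gamma_kernel -(rmorphB _ x 1) cpow_real// -rmorphM. Qed.

Lemma gamma_kernelD m c t (k : nat) :
  gamma_kernel m (c + k%:R) t = gamma_kernel m c t * (expR (- t))%:C ^+ k.
Proof.
by rewrite /gamma_kernel -mulrA -rmorphXn -rmorphM /= -expRM_natl -expRD mulrDl opprD mulrN.
Qed.

Lemma powR_le_expR x c t : 0 < x -> 0 < c -> 0 <= t -> t `^ x <= (x / c) `^ x * expR (c * t).
Proof.
move=> x0 c0 t0; have xc0 : 0 < x / c by rewrite divr_gt0.
have -> : expR (c * t) = expR (c * t / x) `^ x by rewrite -expRM divfK ?gt_eqF.
have xc_expR_ge0 : 0 <= x / c * expR (c * t / x) by rewrite mulr_ge0 ?expR_ge0// ltW.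
rewrite -powRM ?expR_ge0 ?(ltW xc0)// ge0_ler_powR ?nnegrE ?(ltW x0)//.
rewrite -ler_pdivrMl//; apply: le_trans (expR_ge1Dx _).
by rewrite invf_div mulrAC lerDr.
Qed.

Lemma integrable_expR_pos c : 0 < c -> mu.-integrable pos (fun t => (expR (- (c * t)))%:E).
Proof.
move=> c0; have := integrableS measurableT measurable_pos (@subsetT _ _)
  (integrable_exponential_pdf c0).
move=> /(integrableZl measurable_pos c^-1); apply: eq_integrable => [|t /set_mem].
  exact: measurable_pos.
rewrite mem_pos => t0; rewrite /= exponential_pdfE ?ltW// -EFinM mulrA mulVf ?gt_eqF//.
by rewrite mul1r mulNr.
Qed.

Lemma integrable_gamma_density x c : 1 < x -> 0 < c ->
  mu.-integrable pos (EFin \o gamma_density x c).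
Proof.
move=> x1 c0; have half_c0 : 0 < c / 2 by rewrite divr_gt0.
pose K := ((x - 1) / (c / 2)) `^ (x - 1).
apply: (le_integrable measurable_pos _ _
  (integrableZl measurable_pos K (integrable_expR_pos half_c0))).
  apply/measurable_EFinP; apply: measurable_funM.
    exact: measurable_funS (measurable_powR _).
  by apply: measurableT_comp => //; apply: measurable_funN; exact: measurable_funM.
move=> t; rewrite mem_pos => t0.
rewrite -EFinM lee_fin (ger0_norm (gamma_density_ge0 x c t)) ger0_norm; last first.
  by apply: mulr_ge0; [exact: powR_ge0 | exact: expR_ge0].
have -> : K * expR (- (c / 2 * t)) = K * expR (c / 2 * t) * expR (- (c * t)).
  by rewrite -(mulrA K) -expRD; congr (_ * expR _); lra.
rewrite ler_pM2r ?expR_gt0//.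
by apply: powR_le_expR; [rewrite subr_gt0 | exact: half_c0 | exact: ltW].
Qed.

Lemma Cmeasurable_gamma_kernel m c : Cmeasurable pos (gamma_kernel m c).
Proof.
apply: CmeasurableM; last first.
  apply/Cmeasurable_real/measurableT_comp => //.
  by apply: measurable_funN; exact: measurable_funM.
apply/Cmeasurable_cexp/CmeasurableM; first exact: Cmeasurable_cst.
by apply: Cmeasurable_real; exact: measurable_funS (@measurable_ln R).
Qed.

Lemma Cintegrable_gamma_kernel m c : 1 < complex.Re m -> 0 < c ->
  Cintegrable mu pos (gamma_kernel m c).
Proof.
move=> m1 c0; apply: Cintegrable_dominated (integrable_gamma_density m1 c0) _.
- exact: measurable_pos.
- exact: Cmeasurable_gamma_kernel.
- by move=> t; rewrite mem_pos => t0; rewrite normc_gamma_kernel.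
Qed.

Lemma dilation_pos c : 0 < c -> dilation c @^-1` pos = pos.
Proof.
by move=> c0; apply/seteqP; split=> t; rewrite /dilation /= !in_itv /= !andbT pmulr_rgt0.
Qed.

Lemma Cintegral_dilation_pos c (F : R -> R[i]) : 0 < c -> Cintegrable mu pos F ->
  Cintegral mu pos F = c%:C * Cintegral mu pos (fun t => F (c * t)).
Proof.
move=> c0 [ReF ImF]; rewrite /Cintegral.
rewrite (Rintegral_dilation c0 measurable_pos ReF) (Rintegral_dilation c0 measurable_pos ImF).
by rewrite dilation_pos// mulCE !mul0r subr0 addr0.
Qed.

Lemma Cintegral_gamma_kernel m c : 1 < complex.Re m -> 0 < c ->
  Cintegral mu pos (gamma_kernel m c) = cgamma m / cpow c m.
Proof.
move=> m1 c0; have i_gamma := Cintegrable_gamma_kernel m1 c0.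
have gamma_dil t : pos t -> gamma_kernel m 1 (c * t) = cpow c (m - 1) * gamma_kernel m c t.
  by rewrite mem_pos => t0; rewrite /gamma_kernel cpowM// mul1r mulrA.
rewrite /cgamma (Cintegral_dilation_pos c0 (Cintegrable_gamma_kernel m1 ltr01)).
rewrite (eq_Cintegral mu gamma_dil) (CintegralZl measurable_pos _ i_gamma).
by rewrite mulrA -(cpow1 c0) -cpowD addrC subrK mulrAC divff ?mul1r ?cpow_neq0.
Qed.

Lemma Rintegral_gamma_density x c : 1 < x -> 0 < c ->
  \int[mu]_(t in pos) gamma_density x c t =
  \int[mu]_(t in pos) gamma_density x 1 t / c `^ x.
Proof.
move=> x1 c0; have Re_gamma e : complex.Re (Cintegral mu pos (gamma_kernel x%:C e)) =
    \int[mu]_(t in pos) gamma_density x e t.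
  apply: eq_Rintegral => t /set_mem; rewrite mem_pos => t0.
  by rewrite gamma_kernel_real.
by rewrite -!Re_gamma (@Cintegral_gamma_kernel x%:C c)// cpow_real// -fmorphV Re_mulc_real.
Qed.

Lemma integrable_gamma_density_geometric x : 1 < x ->
  mu.-integrable pos (EFin \o (fun t => gamma_density x 1 t / (1 - expR (- t)))).
Proof.
move=> x1; pose f k := gamma_density x k.+1%:R.
have i_f k : mu.-integrable pos (EFin \o f k) by exact: integrable_gamma_density.
have fE k t : f k t = geometric (gamma_density x 1 t) (expR (- t)) k.
  rewrite /f /geometric /= -expRM_natl /gamma_density -mulrA -expRD.
  by congr (_ * expR _); rewrite -nat1r; ring.
pose B := \int[mu]_(t in pos) gamma_density x 1 t / (1 - 2 `^ (1 - x)).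
apply: (@integrable_nondecreasing_cvg _ _ _ mu pos measurable_pos
  (fun n t => \sum_(k < n) f k t) _ B).
- by move=> n; apply: integrable_EFin_sum => //; exact: measurable_pos.
- by move=> n t _; apply: sumr_ge0 => k _; exact: gamma_density_ge0.
- move=> t _ n m nm; rewrite -!(big_mkord xpredT (f ^~ t)).
  rewrite [leRHS](@big_cat_nat _ _ _ n)//= lerDl.
  by apply: sumr_ge0 => k _; exact: gamma_density_ge0.
- move=> t; rewrite mem_pos => t0; under eq_fun do under eq_bigr do rewrite fE.
  have expR_lt1N : `|expR (- t)| < 1 by rewrite ger0_norm ?expR_ge0// expR_lt1 oppr_lt0.
  by have := cvg_geometric_series (a := gamma_density x 1 t) expR_lt1N; rewrite seriesEord.
- move=> n; rewrite (Rintegral_sum measurable_pos n i_f).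
  under eq_bigr do rewrite Rintegral_gamma_density//.
  rewrite -mulr_sumr; apply: ler_wpM2l.
    by apply: Rintegral_ge0 => t _; exact: gamma_density_ge0.
  by have := riemannR_series_le x1 n; rewrite seriesEord.
Qed.

End GammaIntegral.

Arguments measurable_pos : clear implicits.

Section ExponentialBump.
Variable R : realType.
Local Notation mu := (@lebesgue_measure R).
Local Notation pos := (`]0%R, +oo[%classic : set (measurableTypeR R)).
Implicit Types (f : R -> R) (t e : R).

Definition exp_bump t : R := 4 * (expR (- t) * (1 - expR (- t))).

Lemma exp_bumpE t : exp_bump t = 1 - 4 * (expR (- t) - 2^-1) ^+ 2.
Proof. by rewrite /exp_bump; field. Qed.

Lemma exp_bump_itv t : 0 < t -> 0 <= exp_bump t <= 1.
Proof.
move=> t0; apply/andP; split; last by rewrite exp_bumpE gerBl mulr_ge0 ?sqr_ge0.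
by rewrite !mulr_ge0 ?expR_ge0// subr_ge0 expR_le1 oppr_le0 ltW.
Qed.

Lemma exp_bump_le e t : 0 <= e -> (exp_bump t <= 1 - 4 * e ^+ 2) = (e <= `|expR (- t) - 2^-1|).
Proof.
move=> e0; rewrite exp_bumpE lerD2l lerN2 ler_pM2l// -[X in _ <= X]real_normK ?num_real//.
by rewrite ler_pXn2r ?nnegrE.
Qed.

Lemma integrable_exp_bump_powers f n : mu.-integrable pos (EFin \o f) ->
  mu.-integrable pos (EFin \o (fun t => f t * exp_bump t ^+ n)).
Proof.
move=> i_f; apply: (le_integrable (measurable_pos R) _ _ i_f) => [|t].
  apply/measurable_EFinP/measurable_funM; first exact/measurable_EFinP/measurable_int/i_f.
  apply/measurable_funX/measurable_funM => //; apply: measurable_funM.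
    exact: measurableT_comp.
  by apply: measurable_funB => //; exact: measurableT_comp.
rewrite mem_pos => /exp_bump_itv/andP[g0 g1].
by rewrite lee_fin normrM normrX (ger0_norm g0) ler_piMr ?exprn_ile1.
Qed.

Lemma continuous_ln2_ge f : {for ln 2, continuous f} -> 0 < f (ln 2) ->
  exists2 e, 0 < e < 2^-1 & forall t, `|expR (- t) - 2^-1| < e -> f (ln 2) / 2 <= f t.
Proof.
move=> f_cont f0; have half_gt0 : 0 < f (ln 2) / 2 by rewrite divr_gt0.
have Nln_half : - ln 2^-1 = ln 2 :> R by rewrite lnV ?posrE// opprK.
have : {for 2^-1, continuous (f \o (fun s => - ln s))}.
  apply: continuous_comp; last by rewrite Nln_half.
  by apply: continuousN; apply: continuous_ln; rewrite invr_gt0.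
move=> /cvgrPdist_lt/(_ _ half_gt0)[e /= e0 f_near].
exists (Num.min e 4^-1); first by rewrite lt_min e0 gt_min; apply/andP; split; lra.
move=> t; rewrite lt_min => /andP[t_near _]; have := f_near (expR (- t)).
rewrite /ball /= distrC => /(_ t_near); rewrite Nln_half expRK opprK.
by move=> /(le_lt_trans (ler_norm _)); lra.
Qed.

Lemma lebesgue_measure_expR_band e : 0 < e < 2^-1 -> exists J : set (measurableTypeR R),
  [/\ measurable J, J `<=` pos, (0 < mu J)%E, mu J \is a fin_num &
      forall t, J t -> `|expR (- t) - 2^-1| < e].
Proof.
move=> /andP[e0 e1]; exists `]- ln (2^-1 + e), - ln (2^-1 - e)[%classic.
have lt_ends : - ln (2^-1 + e) < - ln (2^-1 - e) by rewrite ltrN2 ltr_ln ?posrE; lra.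
split.
- exact: measurable_itv.
- move=> t; rewrite mem_pos /= in_itv /= => /andP[+ _]; apply: le_lt_trans.
  by rewrite oppr_ge0 ln_le0//; lra.
- by rewrite lebesgue_measure_itv /= lte_fin lt_ends -EFinB lte_fin subr_gt0.
- by rewrite lebesgue_measure_itv /= lte_fin lt_ends.
- move=> t; rewrite /= in_itv /= ltrNl ltrNr => /andP[].
  rewrite -ltr_expR lnK ?posrE; last lra.
  rewrite -[in X in _ -> X -> _]ltr_expR lnK ?posrE; last lra.
  by rewrite ltr_norml; lra.
Qed.

Lemma Rintegral_exp_bump_gt0 f : mu.-integrable pos (EFin \o f) ->
  {for ln 2, continuous f} -> 0 < f (ln 2) ->
  exists n, 0 < \int[mu]_(t in pos) (f t * exp_bump t ^+ n).
Proof.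
move=> i_f f_cont f0; have [e /andP[e0 e_half] f_ge] := continuous_ln2_ge f_cont f0.
have half_e : 0 < e / 2 < 2^-1 by lra.
have [J [mJ Jpos J0 Jfin J_near]] := lebesgue_measure_expR_band half_e.
have e_sqr : e ^+ 2 < 2^-1 ^+ 2 by rewrite ltr_pXn2r ?nnegrE ?(ltW e0).
have e_sqr_gt0 : 0 < e ^+ 2 by rewrite exprn_gt0.
apply: (@Rintegral_peak_gt0 _ _ _ mu pos (measurable_pos R) f exp_bump J (f (ln 2) / 2)
  (1 - 4 * e ^+ 2) (1 - 4 * (e / 2) ^+ 2)) => //.
- by move=> n; exact: integrable_exp_bump_powers.
- by rewrite divr_gt0.
- by lra.
- by lra.
- by move=> t /J_near t_near; apply: f_ge; apply: lt_trans t_near _; lra.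
- move=> t /J_near t_near; rewrite leNgt; apply/negP => /ltW.
  by rewrite exp_bump_le; [rewrite leNgt t_near | lra].
- by move=> t; rewrite mem_pos => /exp_bump_itv/andP[].
move=> t _; have [t_near|t_far] := ltP `|expR (- t) - 2^-1| e.
  by left; apply: le_trans (f_ge t t_near); rewrite divr_ge0// ltW.
by right; rewrite exp_bump_le// ltW.
Qed.

End ExponentialBump.

Section ComplexContinuity.
Variable R : realType.
Implicit Types (F : R -> R[i]) (f : R -> R) (x : R) (z : R[i]).

Definition Ccontinuous x F := complex.Re (F t) @[t --> x] --> complex.Re (F x) /\
  complex.Im (F t) @[t --> x] --> complex.Im (F x).

Lemma Ccontinuous_cst x z : Ccontinuous x (fun=> z).
Proof. by split; exact: cvg_cst. Qed.

Lemma Ccontinuous_real x f : {for x, continuous f} -> Ccontinuous x (fun t => (f t)%:C).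
Proof. by split=> //=; exact: cvg_cst. Qed.

Lemma CcontinuousM x F1 F2 : Ccontinuous x F1 -> Ccontinuous x F2 ->
  Ccontinuous x (fun t => F1 t * F2 t).
Proof.
move=> [re1 im1] [re2 im2]; split.
  under eq_fun do rewrite Re_mulc; rewrite Re_mulc.
  by apply: cvgB; exact: cvgM.
under eq_fun do rewrite Im_mulc; rewrite Im_mulc.
by apply: cvgD; exact: cvgM.
Qed.

Lemma Ccontinuous_cexp x F : Ccontinuous x F -> Ccontinuous x (fun t => cexp (F t)).
Proof.
move=> [re im]; have expR_re := continuous_comp re (@continuous_expR R _).
split; apply: cvgM expR_re _.
  exact: continuous_comp im (@continuous_cos R _).
exact: continuous_comp im (@continuous_sin R _).
Qed.

Lemma Ccontinuous_gamma_kernel m c x : 0 < x -> Ccontinuous x (gamma_kernel m c).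
Proof.
move=> x0; apply: CcontinuousM.
  apply/Ccontinuous_cexp/CcontinuousM; first exact: Ccontinuous_cst.
  exact/Ccontinuous_real/continuous_ln.
apply: Ccontinuous_real; apply: continuous_comp; last exact: continuous_expR.
by apply: continuousN; apply: continuousM; [exact: cst_continuous | exact: cvg_id].
Qed.

End ComplexContinuity.

Section DirichletMoments.
Variable R : realType.
Local Notation mu := (@lebesgue_measure R).
Local Notation pos := (`]0%R, +oo[%classic : set (measurableTypeR R)).
Local Notation expN t := ((expR (- t))%:C).
Variable m : R[i].
Hypothesis m1 : 1 < complex.Re m.
Implicit Types (c : nat -> R[i]) (p : {poly R}).

Let i_gamma k : Cintegrable mu pos (gamma_kernel m k.+1%:R).
Proof. exact: Cintegrable_gamma_kernel. Qed.

Let gamma_kernel_sumE n c : (fun t => gamma_kernel m 1 t * \sum_(k < n) c k * expN t ^+ k) =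
  (fun t => \sum_(k < n) c k * gamma_kernel m k.+1%:R t).
Proof.
apply/funext => t; rewrite mulr_sumr; apply: eq_bigr => k _.
by rewrite mulrCA -gamma_kernelD nat1r.
Qed.

Let i_scaled_gamma c k : Cintegrable mu pos (fun t => c k * gamma_kernel m k.+1%:R t).
Proof. exact: (CintegrableZl (measurable_pos R) (c k) (i_gamma k)). Qed.

Lemma Cintegrable_gamma_kernel_sum n c :
  Cintegrable mu pos (fun t => gamma_kernel m 1 t * \sum_(k < n) c k * expN t ^+ k).
Proof.
by rewrite gamma_kernel_sumE; exact: (Cintegrable_sum (measurable_pos R) n (i_scaled_gamma c)).
Qed.

Lemma Cintegral_gamma_kernel_sum n c :
  Cintegral mu pos (fun t => gamma_kernel m 1 t * \sum_(k < n) c k * expN t ^+ k) =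
  cgamma m * \sum_(k < n) c k / cpow k.+1%:R m.
Proof.
rewrite gamma_kernel_sumE (Cintegral_sum (measurable_pos R) n (i_scaled_gamma c)).
rewrite mulr_sumr; apply: eq_bigr => k _.
by rewrite (CintegralZl (measurable_pos R) _ (i_gamma k)) Cintegral_gamma_kernel// mulrCA.
Qed.

(* If the Gamma integral vanished, then the kernel, turned so as to be positive at ln 2,
   would be orthogonal to every polynomial in e^-t, in particular to the powers of the
   bump. *)
Lemma cgamma_neq0 : cgamma m != 0.
Proof.
apply/eqP => gamma0; pose z := (gamma_kernel m 1 (ln 2))^*%C.
pose f t := complex.Re (z * gamma_kernel m 1 t).
have ln2_gt0 : 0 < ln 2 :> R by rewrite ln_gt0// ltr1n.
have i_f : mu.-integrable pos (EFin \o f).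
  by have [] := CintegrableZl (measurable_pos R) z (i_gamma 0).
have f_cont : {for ln 2, continuous f}.
  by have [] := CcontinuousM (Ccontinuous_cst _ z) (Ccontinuous_gamma_kernel m 1 ln2_gt0).
have f_gt0 : 0 < f (ln 2).
  rewrite (_ : f _ = normc (gamma_kernel m 1 (ln 2)) ^+ 2).
    by rewrite exprn_gt0// normc_gamma_kernel// mulr_gt0 ?powR_gt0 ?expR_gt0.
  by rewrite sqr_normc_ReIm /f /z; case: (gamma_kernel _ _ _) => x y /=; ring.
have f_orthogonal p : \int[mu]_(t in pos) (f t * p.[expR (- t)]) = 0.
  pose F t := gamma_kernel m 1 t * \sum_(k < size p) (p`_k)%:C * expN t ^+ k.
  transitivity (complex.Re (Cintegral mu pos (fun t => z * F t))).
    apply: eq_Rintegral => t _; have -> : F t = gamma_kernel m 1 t * (p.[expR (- t)])%:C.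
      congr (_ * _); rewrite horner_coef rmorph_sum.
      by apply: eq_bigr => k _; rewrite rmorphM rmorphXn.
    by rewrite mulrA [in RHS]Re_mulc_real.
  pose p_ k := (p`_k)%:C; have := Cintegral_gamma_kernel_sum (size p) p_.
  rewrite (CintegralZl (measurable_pos R) z (Cintegrable_gamma_kernel_sum (size p) p_)).
  by move=> ->; rewrite gamma0 mul0r mulr0.
have [n] := Rintegral_exp_bump_gt0 i_f f_cont f_gt0.
suff -> : \int[mu]_(t in pos) (f t * exp_bump t ^+ n) = 0 by rewrite ltxx.
apply: etrans (f_orthogonal ((4%:P * ('X * (1 - 'X))) ^+ n)).
apply: eq_Rintegral => t _; congr (_ * _).
by rewrite horner_exp 2!hornerM hornerD hornerN !hornerC hornerX.
Qed.

End DirichletMoments.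

Section ZetaMoments.
Variable R : realType.
Local Notation mu := (@lebesgue_measure R).
Local Notation pos := (`]0%R, +oo[%classic : set (measurableTypeR R)).
Local Notation expN t := ((expR (- t))%:C).
Variable m : R[i].
Hypothesis m1 : 1 < complex.Re m.

Let limit : R[i] := Cintegral mu pos (fun t => gamma_kernel m 1 t / (1 - expN t)) / cgamma m.

Let moments_cvg_limit (c : nat -> nat -> R[i]) (C : R) :
  (forall s : R, 0 < s < 1 ->
    (fun n => \sum_(k < n) c n k * s%:C ^+ k : R[i]^o) @ \oo --> ((1 - s%:C)^-1 : R[i]^o)) ->
  (forall n (s : R), 0 < s < 1 -> normc (\sum_(k < n) c n k * s%:C ^+ k) <= C / (1 - s)) ->
  (fun n => \sum_(k < n) c n k / cpow k.+1%:R m : R[i]^o) @ \oo --> (limit : R[i]^o).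
Proof.
move=> c_cvg c_le; pose F n t := gamma_kernel m 1 t * \sum_(k < n) c n k * expN t ^+ k.
pose G t := C * (gamma_density (complex.Re m) 1 t / (1 - expR (- t))).
have expN_itv (t : R) : 0 < t -> 0 < expR (- t) < 1 by rewrite expR_gt0 expR_lt1 oppr_lt0.
have i_G : mu.-integrable pos (EFin \o G).
  have := integrableZl (measurable_pos R) C (integrable_gamma_density_geometric m1).
  by apply: eq_integrable => //; exact: measurable_pos.
have mF n : Cmeasurable pos (F n).
  have [iRe iIm] := Cintegrable_gamma_kernel_sum m1 n (c n).
  by split; apply/measurable_EFinP; [exact: measurable_int iRe | exact: measurable_int iIm].
have F_le n t : pos t -> normc (F n t) <= G t.
  rewrite mem_pos => t0; rewrite normcM normc_gamma_kernel// /G mulrCA ler_wpM2l//.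
    exact: gamma_density_ge0.
  exact: c_le (expN_itv t t0).
have F_cvg t : pos t -> (F ^~ t : nat -> R[i]^o) @ \oo -->
    (gamma_kernel m 1 t / (1 - expN t) : R[i]^o).
  by rewrite mem_pos => t0; apply: cvgMl_tmp; exact: c_cvg (expN_itv t t0).
have := Cintegral_dominated_cvg (measurable_pos R) mF F_cvg i_G F_le.
move=> /(@cvgMr_tmp _ _ _ _ _ _ (cgamma m)^-1); apply: cvg_trans.
apply: near_eq_cvg; apply: nearW => n.
by rewrite (Cintegral_gamma_kernel_sum m1) mulrAC divff ?mul1r ?cgamma_neq0.
Qed.

Let zeta_series_cvg_limit :
  series (fun n => (cpow n.+1%:R m)^-1 : R[i]^o) @ \oo --> (limit : R[i]^o).
Proof.
pose u (n k : nat) : R[i] := 1.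
have sumE (s : R) n : \sum_(k < n) u n k * s%:C ^+ k = (series (geometric 1 s) n)%:C.
  rewrite seriesEord rmorph_sum; apply: eq_bigr => k _.
  by rewrite mul1r [geometric _ _ _]mul1r rmorphXn.
have -> : series (fun n => (cpow n.+1%:R m)^-1 : R[i]^o) =
    (fun n => \sum_(k < n) u n k / cpow k.+1%:R m).
  by apply/funext => n; rewrite seriesEord; apply: eq_bigr => k _; rewrite mul1r.
apply: (moments_cvg_limit (C := 1)) => [s|n s] /andP[s0 s1].
  have s_lt1 : `|s| < 1 by rewrite gtr0_norm.
  rewrite -(rmorphB _ 1 s) -fmorphV; apply/cvgC_ReIm; split.
    under eq_fun do rewrite sumE; rewrite -[complex.Re _]mul1r.
    exact: cvg_geometric_series s_lt1.
  by under eq_fun do rewrite sumE; exact: cvg_cst.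
rewrite sumE normc_real geometric_seriesE ?lt_eqF//= !mul1r ger0_norm; last first.
  by apply: divr_ge0; rewrite subr_ge0 ?exprn_ile1 ?(ltW s0) ?(ltW s1).
by rewrite ler_piMl ?invr_ge0 ?subr_ge0 ?gerBl ?exprn_ge0 ?(ltW s0) ?(ltW s1).
Qed.

Lemma moments_cvg_zeta (c : nat -> nat -> R[i]) (C : R) :
  (forall s : R, 0 < s < 1 ->
    (fun n => \sum_(k < n) c n k * s%:C ^+ k : R[i]^o) @ \oo --> ((1 - s%:C)^-1 : R[i]^o)) ->
  (forall n (s : R), 0 < s < 1 -> normc (\sum_(k < n) c n k * s%:C ^+ k) <= C / (1 - s)) ->
  (fun n => \sum_(k < n) c n k / cpow k.+1%:R m : R[i]^o) @ \oo --> zeta m.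
Proof.
have -> : zeta m = limit by exact: fps_sum_unique zeta_series_cvg_limit.
exact: moments_cvg_limit.
Qed.

End ZetaMoments.

Section BernoulliSeries.
Variable R : realType.
Variables (m z : R[i]) (b : R).
Hypothesis m1 : 1 < complex.Re m.
Hypothesis b_angle : is_lambert_angle b.
Hypothesis z_norm : normc z = normc (lambert_pt b).
Hypothesis z_zero : z + cexp (- z) = 0.

Local Notation u := (1 - lambert_fps R).

Lemma poly_bernoulli_ge2E n : poly_bernoulli_ge2 m n * z ^+ n / n`!%:R =
  (\sum_(k < n.+1) (u ^+ k) n / cpow k.+1%:R m) * z ^+ n.
Proof.
rewrite mulrAC; congr (_ * _); rewrite mulr_suml; apply: eq_bigr => -[k kn] _ /=.
rewrite coef_sub1_lambert_fps_expr.
have -> : (-1) ^+ (n + k) = (-1) ^+ (n - k) :> R[i].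
  by rewrite -signr_odd oddD -oddB// signr_odd.
ring.
Qed.

Lemma bernoulli_series_cvg :
  series (fun n => poly_bernoulli_ge2 m n * z ^+ n / n`!%:R : R[i]^o) @ \oo --> zeta m.
Proof.
pose c n k : R[i] := \sum_(i < n) (u ^+ k) i * z ^+ i.
have sumE (x : nat -> R[i]) n : \sum_(k < n) c n k * x k =
    \sum_(i < n) (\sum_(k < i.+1) (u ^+ k) i * x k) * z ^+ i.
  under eq_bigr do rewrite mulr_suml.
  rewrite exchange_big; apply: eq_bigr => i _ /=.
  rewrite (fps_powers_widen x (sub1_lambert_fps0 R) (ltn_ord i)) mulr_suml.
  by apply: eq_bigr => k _; rewrite mulrAC.
have resolventE (s : R) n : \sum_(k < n) c n k * s%:C ^+ k =
    \sum_(i < n) lambert_resolvent s%:C i * z ^+ i.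
  rewrite (sumE (fun k => s%:C ^+ k)); apply: eq_bigr => i _; congr (_ * _).
  apply: eq_bigr => k _; by rewrite exprMn -(rmorphXn (@fpsC R[i])) coef_fpsCM mulrC.
have -> : series (fun n => poly_bernoulli_ge2 m n * z ^+ n / n`!%:R : R[i]^o) =
    (fun n => \sum_(k < n) c n k / cpow k.+1%:R m).
  apply/funext => n; rewrite seriesEord (sumE (fun k => (cpow k.+1%:R m)^-1)).
  by apply: eq_bigr => i _; rewrite poly_bernoulli_ge2E.
have [C resolvent_le] := l1_le_lambert_resolvent b_angle.
apply: (moments_cvg_zeta m1 (C := C)) => [s|n s] /andP[s0 s1].
  have s_itv : 0 <= s < 1 by rewrite ltW.
  rewrite -(ev_lambert_resolvent b_angle s_itv z_norm z_zero).
  have := fps_sumP (l1_le_abs_summable (resolvent_le s z s_itv z_norm)).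
  by rewrite seriesEord; under [in X in _ -> X]eq_fun do rewrite resolventE.
rewrite resolventE; have s_itv : 0 <= s < 1 by rewrite ltW.
exact: le_trans (normc_sum _ _ _) (resolvent_le s z s_itv z_norm n).
Qed.

End BernoulliSeries.

Theorem theorem4 (R : realType) (mu : R[i]) (k : int)
    (hmu : 1 < complex.Re mu) (hk : k = 0 \/ k = -1) :
  series (fun n : nat =>
      poly_bernoulli_ge2 mu n * lambertW k (-1) ^+ n / n`!%:R : R[i]^o)
    @ \oo --> zeta mu.
Proof.
have [b b_angle] := is_lambert_angle_ex R.
case: hk => ->.
  rewrite (lambertW0_N1 b_angle); apply: (bernoulli_series_cvg hmu b_angle) => //.
  exact: lambert_pt_zero.
rewrite (lambertWN1_N1 b_angle); apply: (bernoulli_series_cvg hmu b_angle).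
  exact: normc_conj.
exact: lambert_pt_conj_zero.
Qed.
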